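(* Let $n\ge 1$ and let $P(\delta_2),\ldots,P(\delta_n)$ be the $\mathrm{SPos}_n(\mathbb{R})$-radial parts of the Maass-Selberg operators $\delta_2,\ldots,\delta_n$, i.e. the operators given for $f\in C^\infty(\mathrm{SL}_n(\mathbb{R})/\mathrm{SO}_n(\mathbb{R}))$ and $g\in \mathrm{SL}_n(\mathbb{R})$ by $$P(\delta_k)f(g\,\mathrm{SO}_n(\mathbb{R})) = \left.\mathrm{tr}\left(\left(\frac{\partial}{\partial Y}\right)^k\right)\right|_{Y=0} f(g\exp(Y)\,\mathrm{SO}_n(\mathbb{R})),\qquad Y\in \mathrm{SSym}_n(\mathbb{R}).$$ Then $P(\delta_2),\ldots,P(\delta_n)$ form an algebraically independent set of generators for the (commutative) algebra $\mathbb{D}(\mathrm{SL}_n(\mathbb{R})/\mathrm{SO}_n(\mathbb{R}))$.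
   Context: For a Lie group $G$ and a closed subgroup $K$, $C^\infty(G/K)$ denotes the complex-valued smooth functions, $\tau_g$ is the translation $hK\mapsto ghK$, and $\mathbb{D}(G/K)$ is the complex unital algebra of $G$-invariant linear differential operators $D$ on $G/K$, i.e. $D(f\circ\tau_g)=(Df)\circ\tau_g$ for all $g\in G$ and $f\in C^\infty(G/K)$. Write $\mathrm{Pos}_n(\mathbb{R})=\mathrm{GL}_n(\mathbb{R})/\mathrm{O}_n(\mathbb{R})$ and $\mathrm{SPos}_n(\mathbb{R})=\mathrm{SL}_n(\mathbb{R})/\mathrm{SO}_n(\mathbb{R})$; the algebras $\mathbb{D}(\mathrm{Pos}_n(\mathbb{R}))$ and $\mathbb{D}(\mathrm{SPos}_n(\mathbb{R}))$ are commutative. Let $\mathrm{Sym}_n(\mathbb{R})$ be the space of real symmetric $n\times n$-matrices $X=(x_{ij})$, and $\mathrm{SSym}_n(\mathbb{R})$ its subspace of trace-zero matrices, both with inner product $\langle X,Y\rangle=\mathrm{tr}(XY)$. Let $\frac{\partial}{\partial X}$ be the symmetric matrix of differential operators on $\mathrm{Sym}_n(\mathbb{R})$ with diagonal entries $\frac{\partial}{\partial x_{ii}}$ and $(i,j)$- and $(j,i)$-entries $\frac12\frac{\partial}{\partial x_{ij}}$ for $i<j$. The $k$-th Maass-Selberg operator $\delta_k\in\mathbb{D}(\mathrm{Pos}_n(\mathbb{R}))$ is $$\delta_k f(g\,\mathrm{O}_n(\mathbb{R}))=\left.\mathrm{tr}\left(\left(\tfrac{\partial}{\partial X}\right)^k\right)\right|_{X=0}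 f(g\exp(X)\,\mathrm{O}_n(\mathbb{R})).$$ Radial parts: let $i:\mathrm{SPos}_n(\mathbb{R})\to\mathrm{Pos}_n(\mathbb{R})$, $g\,\mathrm{SO}_n(\mathbb{R})\mapsto g\,\mathrm{O}_n(\mathbb{R})$, and $p:\mathrm{Pos}_n(\mathbb{R})\to\mathrm{SPos}_n(\mathbb{R})$, $g\,\mathrm{O}_n(\mathbb{R})\mapsto\det(g)^{-1/n}g\,\mathrm{SO}_n(\mathbb{R})$, where the representative $g$ is chosen with $\det(g)>0$. For $D\in\mathbb{D}(\mathrm{Pos}_n(\mathbb{R}))$, the $\mathrm{SPos}_n(\mathbb{R})$-radial part $P(D)\in\mathbb{D}(\mathrm{SPos}_n(\mathbb{R}))$ is defined by $P(D)f=D(f\circ p)\circ i$. For a polynomial $Q$ on $\mathrm{SSym}_n(\mathbb{R})$, $Q\left(\frac{\partial}{\partial Y}\right)$ is the constant coefficient differential operator on $\mathrm{SSym}_n(\mathbb{R})$ characterized by $Q\left(\frac{\partial}{\partial Y}\right)e^{\langle Y,A\rangle}=Q(A)e^{\langle Y,A\rangle}$ for all $A\in\mathrm{SSym}_n(\mathbb{R})$; $\mathrm{tr}\left(\left(\frac{\partial}{\partial Y}\right)^k\right)$ is this operator for $Q(A)=\mathrm{tr}(A^k)$. The suffix $|_{Y=0}$ (resp. $|_{X=0}$) means evaluation at $0$ after differentiation. *)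

(* Defs.v *)
From mathcomp Require Import all_boot all_order all_algebra.
From mathcomp Require Import all_classical all_reals all_analysis.
From mathcomp Require Import complex.
From mathcomp Require Import -(notations) mpoly.

Set Implicit Arguments.
Unset Strict Implicit.
Unset Printing Implicit Defensive.

Import Order.TTheory GRing.Theory Num.Theory.
Import numFieldNormedType.Exports.

Local Open Scope classical_set_scope.
Local Open Scope ring_scope.
Local Open Scope complex_scope.
Local Open Scope quotient_scope.

Section HomogeneousSpaces.
Variables (R : realType) (n : nat).

Definition GL : Type := {g : 'M[R]_n | g \in unitmx}.
Definition SL : Type := {g : 'M[R]_n | \det g == 1}.

Definition GL1 : GL := exist _ 1%:M (unitmx1 R n).
Definition SL1 : SL := exist _ 1%:M (introT eqP (det1 R n)).

Definition orthmx : pred 'M[R]_n := fun k => k^T *m k == 1%:M.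
Definition sorthmx : pred 'M[R]_n := fun k => orthmx k && (\det k == 1).

Lemma orthmx_unit k : orthmx k -> k \in unitmx.
Proof. by move/eqP/mulmx1_unit => []. Qed.

Lemma orthmxM k l : orthmx k -> orthmx l -> orthmx (k *m l).
Proof.
move=> /eqP hk /eqP hl; apply/eqP.
by rewrite trmx_mul mulmxA -(mulmxA l^T) hk mulmx1 hl.
Qed.

Lemma orthmxV k : orthmx k -> orthmx (invmx k).
Proof.
move=> hk; have uk := orthmx_unit hk; move/eqP: hk => hk.
have -> : invmx k = k^T by rewrite -[LHS]mul1mx -hk -mulmxA mulmxV ?mulmx1.
by apply/eqP; rewrite trmxK; apply: mulmx1C.
Qed.

Lemma orthmx1 : orthmx 1%:M.
Proof. by apply/eqP; rewrite trmx1 mulmx1. Qed.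

Lemma SL_unit (g : SL) : val g \in unitmx.
Proof. by rewrite unitmxE (eqP (valP g)) unitr1. Qed.

(* Two group elements are related when they define the same left coset. *)
Definition pos_rel : rel GL := fun g h => orthmx (invmx (val g) *m val h).
Definition spos_rel : rel SL := fun g h => sorthmx (invmx (val g) *m val h).

Lemma invmx_swap (g h : 'M[R]_n) : g \in unitmx -> h \in unitmx ->
  invmx h *m g = invmx (invmx g *m h).
Proof.
move=> ug uh; set a := invmx g *m h; set b := invmx h *m g.
have ab1 : a *m b = 1%:M by rewrite /a /b -mulmxA mulKVmx // mulVmx.
have [ua _] := mulmx1_unit ab1.
by rewrite -[b](mulKmx ua) ab1 mulmx1.
Qed.

Lemma invmx_chain (g h l : 'M[R]_n) : h \in unitmx ->
  invmx g *m l = (invmx g *m h) *m (invmx h *m l).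
Proof. by move=> uh; rewrite -mulmxA mulKVmx. Qed.

Lemma pos_rel_equiv : equiv_class_of pos_rel.
Proof.
have sym g h : pos_rel g h -> pos_rel h g.
  by rewrite /pos_rel (invmx_swap (valP g) (valP h)); apply: orthmxV.
split=> [g|g h|h g l gh hl]; rewrite /pos_rel.
- by rewrite mulVmx ?orthmx1 ?(valP g).
- by apply/idP/idP; apply: sym.
- by rewrite (invmx_chain _ _ (valP h)); apply: orthmxM.
Qed.

Lemma spos_rel_equiv : equiv_class_of spos_rel.
Proof.
have sym g h : spos_rel g h -> spos_rel h g.
  rewrite /spos_rel (invmx_swap (SL_unit g) (SL_unit h)) => /andP[ho /eqP hd].
  by rewrite /sorthmx orthmxV // det_inv hd invr1 eqxx.
split=> [g|g h|h g l /andP[oa /eqP da] /andP[ob /eqP db]]; rewrite /spos_rel.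
- by rewrite mulVmx ?SL_unit // /sorthmx orthmx1 det1 eqxx.
- by apply/idP/idP; apply: sym.
- by rewrite (invmx_chain _ _ (SL_unit h)) /sorthmx orthmxM // det_mulmx da db mulr1 eqxx.
Qed.

Canonical pos_equiv := EquivRelPack pos_rel_equiv.
Canonical spos_equiv := EquivRelPack spos_rel_equiv.

Definition Pos : Type := {eq_quot pos_equiv}.
Definition SPos : Type := {eq_quot spos_equiv}.

(* The cosets g O_n and g SO_n of a matrix g; the value is the trivial coset
   when g does not belong to the group. *)
Definition Pos_coset (g : 'M[R]_n) : Pos := \pi_Pos (insubd GL1 g).
Definition SPos_coset (g : 'M[R]_n) : SPos := \pi_SPos (insubd SL1 g).

(* tau_g : h SO_n |-> g h SO_n *)
Definition translation (g : SL) (x : SPos) : SPos :=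
  SPos_coset (val g *m val (repr x)).

(* i : g SO_n |-> g O_n *)
Definition incl (x : SPos) : Pos := Pos_coset (val (repr x)).

(* p : g O_n |-> det(g)^{-1/n} g SO_n, for a representative with det g > 0 *)
Definition proj (x : Pos) : SPos :=
  let g := val (xget (repr x) [set g : GL | \pi_Pos g = x /\ 0 < \det (val g)]) in
  SPos_coset ((\det g `^ (- n%:R^-1)) *: g).

End HomogeneousSpaces.

Section SmoothFunctions.
Variables (R : realType) (n : nat).
Implicit Types (U S : set 'M[R]_n).

(* F is of class C^k on the open set U. *)
Fixpoint Ck (k : nat) U (F : 'M[R]_n -> R) : Prop :=
  if k is k'.+1 then
    (forall x, U x -> differentiable F x) /\ (forall v, Ck k' U ('D_v F))
  else forall x, U x -> {for x, continuous F}.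

(* A function on a subset S of a vector space is smooth if it extends locally
   to smooth functions on open sets; for an embedded submanifold S these are
   the smooth functions on the manifold S. Only the values on S matter. *)
Definition smooth_real_on S (F : 'M[R]_n -> R) : Prop :=
  forall x, S x -> exists (U : set 'M[R]_n) (G : 'M[R]_n -> R),
    [/\ open U, U x, forall k, Ck k U G & forall y, (U `&` S) y -> F y = G y].

Definition smooth_on S (h : 'M[R]_n -> R[i]) : Prop :=
  smooth_real_on S (fun x => complex.Re (h x)) /\
  smooth_real_on S (fun x => complex.Im (h x)).

(* C^oo(SL_n / SO_n), for the quotient manifold structure: f is smooth iff its
   lift to the closed submanifold SL_n of the n x n matrices is smooth. *)
Definition smooth (f : SPos R n -> R[i]) : Prop :=
  smooth_on [set g | \det g = 1] (fun g => f (SPos_coset g)).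

End SmoothFunctions.

Section DifferentialOperators.
Variables (R : realType) (n : nat).

Definition mexp (X : 'M[R]_n) : 'M[R]_n :=
  limn (series (fun k : nat => (k`!%:R)^-1 *: X ^+ k)).

Definition ssym : set 'M[R]_n := [set Y | Y^T = Y /\ \tr Y = 0].

Definition operator (T : Type) : Type := (T -> R[i]) -> (T -> R[i]).

Definition cderive (v : 'M[R]_n) : operator 'M[R]_n :=
  fun h X => 'D_v (fun Z => complex.Re (h Z)) X +i*
             'D_v (fun Z => complex.Im (h Z)) X.

(* [:: v1; ...; vr] |-> D_{v1} ... D_{vr}. If all the v_j lie in a subspace,
   the value at a point of the subspace only depends on the restriction of the
   function to that subspace. *)
Definition iderive (vs : seq 'M[R]_n) : operator 'M[R]_n :=
  fun h => foldr cderive h vs.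

(* Entry (i, j) of the matrix d/dX of operators on Sym_n: since i and j play
   symmetric roles in the coordinate x_ij of Sym_n, d/dx_ij for i <> j is the
   derivative in the direction E_ij + E_ji. *)
Definition dX (i j : 'I_n) : operator 'M[R]_n :=
  if i == j then cderive (delta_mx i i)
  else fun h X => 2%:R^-1 * cderive (delta_mx i j + delta_mx j i) h X.

Fixpoint opmx_pow (M : 'I_n -> 'I_n -> operator 'M[R]_n) (k : nat) (i j : 'I_n) :
    operator 'M[R]_n :=
  if k is k'.+1 then fun h X => \sum_(l < n) M i l (opmx_pow M k' l j h) X
  else fun h X => if i == j then h X else 0.

Definition opmx_trace (M : 'I_n -> 'I_n -> operator 'M[R]_n) : operator 'M[R]_n :=
  fun h X => \sum_(i < n) M i i h X.

Definition maass_selberg (k : nat) : operator (Pos R n) :=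
  fun f x => opmx_trace (opmx_pow dX k)
    (fun X => f (Pos_coset (val (repr x) *m mexp X))) 0.

Definition radial_part (D : operator (Pos R n)) : operator (SPos R n) :=
  fun f => D (f \o @proj R n) \o @incl R n.

(* Constant coefficient differential operators on SSym_n. *)
Definition const_coeff (L : operator 'M[R]_n) : Prop :=
  exists (N : nat) (c : 'I_N -> R[i]) (vs : 'I_N -> seq 'M[R]_n),
    (forall j v, v \in vs j -> ssym v) /\
    forall h Y, L h Y = \sum_(j < N) c j * iderive (vs j) h Y.

Definition expfun (A : 'M[R]_n) : 'M[R]_n -> R[i] :=
  fun Y => (expR (\tr (Y *m A)))%:C.

(* Q(d/dY), for Q a polynomial on SSym_n. Its defining property determines its
   action on smooth functions on SSym_n. *)
Definition Qop (Q : 'M[R]_n -> R[i]) : operator 'M[R]_n :=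
  xget (fun _ _ => 0) [set L : operator 'M[R]_n | const_coeff L /\
    forall A Y, ssym A -> ssym Y -> L (expfun A) Y = Q A * expfun A Y].

(* tr((d/dY)^k) *)
Definition trace_dY (k : nat) : operator 'M[R]_n :=
  Qop (fun A => (\tr (A ^+ k))%:C).

(* Expression of f in the chart Y |-> g exp(Y) SO_n, defined near 0 in SSym_n. *)
Definition in_chart (g : SL R n) (f : SPos R n -> R[i]) : 'M[R]_n -> R[i] :=
  fun Y => f (SPos_coset (val g *m mexp Y)).

(* Linear differential operators on SL_n / SO_n: linear endomorphisms of
   C^oo(SL_n / SO_n) given near each point, in local coordinates, by a finite
   sum of smooth multiples of iterated partial derivatives. *)
Definition diff_operator (D : operator (SPos R n)) : Prop :=
  [/\ forall f, smooth f -> smooth (D f),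
      forall (a : R[i]) f1 f2, smooth f1 -> smooth f2 ->
        D (fun x => a * f1 x + f2 x) = (fun x => a * D f1 x + D f2 x) &
      forall g : SL R n, exists (U : set 'M[R]_n) (N : nat)
          (vs : 'I_N -> seq 'M[R]_n) (a : 'I_N -> 'M[R]_n -> R[i]),
        [/\ open U, U 0, forall j v, v \in vs j -> ssym v,
            forall j, smooth_on (U `&` ssym) (a j) &
            forall f Y, smooth f -> (U `&` ssym) Y ->
              in_chart g (D f) Y =
              \sum_(j < N) a j Y * iderive (vs j) (in_chart g f) Y]].

(* D(SL_n / SO_n). Its elements are regarded as operators on C^oo(SL_n / SO_n):
   the values on functions that are not smooth are irrelevant. *)
Definition invariant_diff_operator (D : operator (SPos R n)) : Prop :=
  diff_operator D /\
  forall (g : SL R n) f, smooth f ->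
    D (f \o translation g) = D f \o translation g.

(* Value of a polynomial at a tuple of operators, the product being composition.
   Monomials are evaluated in the order T_0, T_1, ...; this order is immaterial
   for operators in the commutative algebra D(SL_n / SO_n). *)
Definition poly_operator (m : nat) (T : 'I_m -> operator (SPos R n))
    (p : mpoly m R[i]) : operator (SPos R n) :=
  fun f x => \sum_(mu <- msupp p)
    mcoeff mu p *
    (\big[(fun A B : operator (SPos R n) => A \o B)/id]_(i < m)
       (iter (tnth (multinom_val mu) i) (T i) : operator (SPos R n))) f x.

Definition algebraically_independent (m : nat)
    (T : 'I_m -> operator (SPos R n)) : Prop :=
  forall p : mpoly m R[i],
    (forall f, smooth f -> poly_operator T p f = (fun=> 0)) -> p = 0.

Definition generates_invariant_operators (m : nat)
    (T : 'I_m -> operator (SPos R n)) : Prop :=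
  (forall i, invariant_diff_operator (T i)) /\
  (forall D, invariant_diff_operator D ->
     exists p : mpoly m R[i],
       forall f, smooth f -> D f = poly_operator T p f).

End DifferentialOperators.

(* Main.v *)
Require Import Defs.
From HB Require Import structures.
From mathcomp Require Import fingroup perm.
From mathcomp Require Import all_boot all_order all_algebra.
From mathcomp Require Import all_classical all_reals all_analysis.
From mathcomp Require Import complex spectral.
From mathcomp Require Import -(notations) mpoly.
From mathcomp Require Import ring lra zify.

Set Implicit Arguments.
Unset Strict Implicit.
Unset Printing Implicit Defensive.

Import Order.TTheory GRing.Theory Num.Theory.
Import numFieldNormedType.Exports.

Local Open Scope classical_set_scope.
Local Open Scope ring_scope.
Local Open Scope complex_scope.

(** Lift the functions on SL_n / SO_n to functions on the group of matrices with
positive determinant that only depend on x x^T up to positive scalars. There the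
left-invariant fields f |-> D_{xA} f (x) represent gl_n, and those with A skew or
scalar kill the lifts; modulo shorter words, a word in these fields therefore acts
on lifts as an element of the symmetric algebra of SSym_n. This gives a principal
symbol, a polynomial on SSym_n, which is recovered by applying the operator at the
identity to powers of tr(x x^T A) det(x)^(-2/n).

The chart Y |-> g exp(Y) turns iterated partial derivatives at 0 into words, and,
since the logarithmic derivative of exp is invertible near 0, words into smooth
combinations of iterated derivatives along SSym_n. Hence the invariant differential
operators are exactly the invariant combinations of words, and the radial part of
the k-th Maass-Selberg operator is one with symbol tr(A^k).

Generation: the symbol of an invariant operator is SO_n-invariant, hence by the
spectral theorem and the theorem on symmetric polynomials a polynomial in
tr(A^2), ..., tr(A^n); subtracting this polynomial in the Maass-Selberg operators
lowers the order. Independence: the part of top weight of a relation has vanishing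
symbol, while the power sums p_2, ..., p_n take all complex values on n numbers of
sum zero. *)

(** * Symmetric functions and the spectral theorem *)

(** No enveloping algebra and no Poincare-Birkhoff-Witt theorem is used: an expression is a list of
    coefficients and words, and many expressions give the same operator. The symbol is therefore
    controlled from both sides. If it vanishes, sorting the letters leaves only shorter words
    ([low_symbol0]); if the operator vanishes at the identity, so does the symbol, because test
    functions detect it ([symb_eq0]).

    Lifts are described through [x *m x^T] up to a positive factor rather than through right
    invariance under SO_n. A skew or scalar letter is then killed without exponentiating it, and
    coset representatives, also those of negative determinant in [Pos], are compared by one matrix
    equation.

    In the chart, exp does not carry symmetric directions to symmetric ones. Only their part modulo
    skew and scalar matrices matters, and it is this part of the logarithmic derivative that is
    inverted near 0.

    Real trace-free diagonal matrices do not give all values of the power sums (the second one is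
    nonnegative), so independence needs complex points; vanishing at real points is first turned
    into an identity of polynomials. *)

Section RealPoints.
Variable R : realType.

Lemma poly_real_eq0 (q : {poly R[i]}) : (forall t : R, q.[t%:C] = 0) -> q = 0.
Proof.
move=> H; pose rs := [seq (k%:R : R)%:C | k <- iota 0 (size q)].
apply: (@roots_geq_poly_eq0 _ _ rs).
- by apply/allP => _ /mapP[k _ ->]; rewrite /root H.
- rewrite map_inj_uniq ?iota_uniq // => i j [] /eqP.
  by rewrite eqr_nat => /eqP.
- by rewrite size_map size_iota.
Qed.

Lemma base_expansion_inj D N (a b : nat -> nat) :
  (forall j, (a j < D)%N) -> (forall j, (b j < D)%N) ->
  (\sum_(j < N) a j * D ^ j = \sum_(j < N) b j * D ^ j)%N ->
  forall j, (j < N)%N -> a j = b j.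
Proof.
elim: N a b => [|N IH] a b Ha Hb //.
have E (c : nat -> nat) : (\sum_(j < N.+1) c j * D ^ j =
    (\sum_(j < N) c j.+1 * D ^ j) * D + c 0)%N.
  rewrite big_ord_recl expn0 muln1 addnC big_distrl; congr (_ + _)%N.
  by apply: eq_bigr => j _; rewrite /= expnSr mulnA.
rewrite !E => H.
have D0 : (0 < D)%N by apply: leq_ltn_trans (Ha 0%N).
have H0 : a 0%N = b 0%N.
  by have := congr1 (modn^~ D) H; rewrite !modnMDl !modn_small.
have H1 := congr1 (divn^~ D) H; rewrite !divnMDl // !divn_small // !addn0 in H1.
move=> [|j] jN //; exact: (IH (fun j => a j.+1) (fun j => b j.+1)).
Qed.

(* Kronecker substitution: [x_j = t ^ (D ^ j)] keeps the monomials of [p] apart. *)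
Lemma mpoly_real_eq0 N (p : mpoly N R[i]) :
  (forall x : 'I_N -> R, meval (fun i => (x i)%:C) p = 0) -> p = 0.
Proof.
move=> H.
pose D := (\max_(m <- msupp p) (mdeg m)).+1.
have HD m i : m \in msupp p -> (m i < D)%N.
  move=> mp; rewrite ltnS; apply: (@leq_trans (mdeg m)).
    by rewrite mdegE (bigD1 i) //= leq_addr.
  by rewrite (big_rem m) //= leq_maxl.
pose q : {poly R[i]} := \sum_(m <- msupp p) mcoeff m p *: 'X^(\sum_(i < N) m i * D ^ i)%N.
have q0 : q = 0.
  apply: poly_real_eq0 => t; rewrite -(H (fun i => t ^+ (D ^ i))) mevalE horner_sum.
  apply: eq_bigr => m _; rewrite hornerZ hornerXn; congr (_ * _).
  rewrite expr_sum; apply: eq_bigr => i _.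
  by rewrite rmorphXn /= -exprM mulnC.
apply/mpolyP => m; rewrite mcoeff0.
have [mp|] := boolP (m \in msupp p); last exact: memN_msupp_eq0.
have := congr1 (fun q : {poly R[i]} => q`_(\sum_(i < N) m i * D ^ i)%N) q0.
rewrite coef0 coef_sum => <-.
rewrite (bigD1_seq m) ?msupp_uniq //= coefZ coefXn eqxx mulr1 big_seq_cond big1 ?addr0 //.
move=> m' /andP[m'p mm']; rewrite coefZ coefXn.
case: eqP => [E|]; last by rewrite mulr0.
case/negP: mm'; apply/eqP/mnmP => i.
pose ex (m : multinom N) (j : nat) := if insub j is Some i then (m : multinom N) i else 0%N.
have exE m1 (j : 'I_N) : ex m1 j = m1 j by rewrite /ex valK.
have exD m1 j : m1 \in msupp p -> (ex m1 j < D)%N.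
  by move=> m1p; rewrite /ex; case: insub => // k; apply: HD.
have := @base_expansion_inj D N (ex m') (ex m) (fun j => exD _ j m'p) (fun j => exD _ j mp) _ i (ltn_ord i).
rewrite !exE => -> //.
by under eq_bigr do rewrite exE; under [RHS]eq_bigr do rewrite exE.
Qed.

(** This is the universal property of the symmetric algebra: a functional [Phi] on words that
    ignores the order of the letters factors through commutative monomials, hence respects every
    identity between them. It serves for derivations that commute exactly and for those that commute
    up to lower order. *)
Lemma commutative_collect (I : finType) (e : seq (R[i] * seq I)) (Phi : seq I -> R[i]) :
  (forall x : I -> R, \sum_(p <- e) p.1 * \prod_(k <- p.2) (x k)%:C = 0) ->
  (forall s t, perm_eq s t -> Phi s = Phi t) ->
  \sum_(p <- e) p.1 * Phi p.2 = 0.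
Proof.
move=> He HPhi; pose N := #|I|.
pose mnm (s : seq I) : multinom N := \big[mnm_add/mnm0]_(k <- s) mnm1 (enum_rank k).
pose P : mpoly N R[i] := \sum_(p <- e) p.1 *: mpolyX R[i] (mnm p.2).
have P0 : P = 0.
  apply: mpoly_real_eq0 => x; rewrite -[RHS](He (x \o enum_rank)) raddf_sum.
  apply: eq_bigr => p _; rewrite /= mevalZ; congr (_ * _); rewrite /mnm.
  elim: p.2 => [|k s IH]; first by rewrite !big_nil mpolyX0 meval1.
  by rewrite !big_cons mpolyXD mevalM IH mevalXU.
have mnmE s k : mnm s (enum_rank k) = count_mem k s.
  rewrite /mnm; elim: s => [|l s IH]; first by rewrite big_nil mnm0E.
  rewrite big_cons mnmDE IH /= mnm1E; congr (nat_of_bool _ + _)%N.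
  by rewrite (inj_eq enum_rank_inj).
have mnm_perm s t : mnm s = mnm t -> perm_eq s t.
  move=> E; apply/allP => k _ /=; by rewrite -!mnmE E.
pose ss := map snd e.
(* [phi] carries [Phi] over to monomials through the first listed word with the given monomial; by
   [HPhi] the choice of the word is harmless. *)
pose phi m := Phi (nth [::] ss (find (fun s => mnm s == m) ss)).
have phiE s : s \in ss -> phi (mnm s) = Phi s.
  move=> sin; apply: HPhi; apply: mnm_perm; apply/eqP.
  by apply: (nth_find [::] (a := fun s' => mnm s' == mnm s)); apply/hasP; exists s.
pose S := undup (map mnm ss).
transitivity (\sum_(m <- S) phi m * mcoeff m P); last first.
  by rewrite P0 big1 // => m _; rewrite mcoeff0 mulr0.
rewrite [RHS](eq_bigr (fun m => \sum_(p <- e) phi m * mcoeff m (p.1 *: mpolyX R[i] (mnm p.2)))); last first.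
  by move=> m _; rewrite /P raddf_sum mulr_sumr.
rewrite exchange_big /= big_seq [RHS]big_seq; apply: eq_bigr => p pe.
have pss : p.2 \in ss by apply: map_f.
rewrite (bigD1_seq (mnm p.2)) ?undup_uniq ?mem_undup ?map_f //=.
rewrite mcoeffZ mcoeffX eqxx mulr1 big1 ?addr0; first by rewrite phiE // mulrC.
by move=> m mne; rewrite mcoeffZ mcoeffX eq_sym (negbTE mne) !mulr0.
Qed.

End RealPoints.

(** * Spectral theorem for real symmetric matrices, with diagonalizing matrix in SO_n *)

Section RealSpectral.
Variable R : realType.

(** The complexified matrix is hermitian, so its spectral diagonal is real. Singularity of
    [A - r%:M] descends from [R[i]] to [R] through the determinant and yields a real eigenvector. *)
Lemma symmetric_eigenvalue n (A : 'M[R]_n.+1) : A^T = A ->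
  exists r (v : 'rV[R]_n.+1), v != 0 /\ v *m A = r *: v.
Proof.
move=> As; pose A' : 'M[R[i]]_n.+1 := map_mx (real_complex R) A.
have A'h : A' \is hermsymmx.
  apply: realsym_hermsym; last first.
    by apply/mxOverP => i j; rewrite mxE; apply/complex_realP; exists (A i j).
  apply/is_hermitianmxP; rewrite expr0 scale1r.
  by apply/matrixP => i j; rewrite !mxE -[in LHS]As mxE.
have Dr := hermitian_spectral_diag_real A'h.
have /orthomx_spectralP E := hermitian_normalmx A'h.
have Pu := spectral_unit A'.
set D := spectral_diag A' in E Dr; set P := spectralmx A' in E Pu.
have /mxOverP/(_ 0 0)/complex_realP[r Er] := Dr.
have /eqP HD : \det (A - r%:M) == 0.
  rewrite -(fmorph_eq0 (real_complex R)) -det_map_mx map_mxB /= map_scalar_mx /= -/A' -[X in X%:M]Er.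
  apply/det0P; exists (row 0 P).
    apply/eqP => P0; have := congr1 (mulmx^~ (invmx P)) P0.
    rewrite -row_mul mulmxV // mul0mx => /matrixP /(_ 0 0); rewrite !mxE eqxx /= => /eqP.
    by rewrite oner_eq0.
  rewrite mulmxBr {1}E !mulmxA -row_mul mulmxV // row1 -rowE.
  rewrite mul_mx_scalar; apply/eqP; rewrite subr_eq0; apply/eqP.
  rewrite -row_mul; apply/matrixP => i j; rewrite !mxE.
  rewrite (bigD1 0) //= !mxE eqxx mulr1n big1 ?addr0 // => l l0.
  by rewrite !mxE eq_sym (negbTE l0) mulr0n mul0r.
have /eqP/det0P[v v0 Hv] := HD.
exists r, v; split=> //; move: Hv; rewrite mulmxBr mul_mx_scalar => /eqP.
by rewrite subr_eq0 => /eqP.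
Qed.

(** [K] is the Householder reflection along [v - e], with [e] the first basis vector; for [v = e]
    this direction degenerates and the identity serves. *)
Lemma reflection_exists n (v : 'cV[R]_n.+1) : v^T *m v = 1%:M ->
  exists K : 'M[R]_n.+1, [/\ K^T = K, K *m K = 1%:M & K *m v = delta_mx 0 0].
Proof.
move=> Hv; have [->|ne] := eqVneq v (delta_mx 0 0).
  by exists 1%:M; rewrite trmx1 !mul1mx.
pose e : 'cV[R]_n.+1 := delta_mx 0 0.
have He : e^T *m e = 1%:M.
  by apply/matrixP => i j; rewrite trmx_delta mul_delta_mx !ord1 !mxE.
pose u := v - e; pose a := (u^T *m u) 0 0.
have ua : u^T *m u = a%:M by apply/matrixP => i j; rewrite !ord1 [RHS]mxE eqxx mulr1n.
have a0 : a != 0.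
  apply: contraNneq ne => a0; rewrite -subr_eq0 -/e -/u; apply/eqP/matrixP => i j.
  have : a = \sum_i u i 0 ^+ 2 by rewrite /a mxE; apply: eq_bigr => l _; rewrite mxE.
  rewrite a0 => /esym/eqP; rewrite psumr_eq0 => [/allP/(_ i)|l _]; last exact: sqr_ge0.
  rewrite mem_index_enum sqrf_eq0 => /(_ isT)/eqP ui.
  by rewrite (ord1 j) ui [RHS]mxE.
(* Since [v] and [e] both have length 1, the squared length of [v - e] is twice its inner product
   with [v]. *)
have uv : 2 *: (u^T *m v) = a%:M.
  have vv : v^T *m e = (e^T *m v)^T by rewrite trmx_mul trmxK.
  have sc : e^T *m v = v^T *m e.
    by rewrite vv; apply/matrixP => i j; rewrite !ord1 [RHS]mxE.
  rewrite -ua /u linearB /= !mulmxBl !mulmxBr Hv He sc.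
  by apply/matrixP => i j; rewrite !mxE; ring.
exists (1%:M - (2 / a) *: (u *m u^T)); split.
- by rewrite linearB /= trmx1 linearZ /= trmx_mul trmxK.
- have QQ : (u *m u^T) *m (u *m u^T) = a *: (u *m u^T).
    by rewrite -mulmxA (mulmxA u^T u) ua mul_scalar_mx scalemxAr.
  rewrite mulmxBl !mulmxBr !mulmx1 !mul1mx -scalemxAl -scalemxAr QQ !scalerA.
  set c := 2 / a; have -> : c * c * a = c + c by rewrite /c; field.
  by rewrite scalerDl opprB addrK subrK.
- rewrite mulmxBl mul1mx -scalemxAl -mulmxA.
  have -> : u^T *m v = (a / 2)%:M.
    apply: (@scalerI _ _ (2 : R)); rewrite ?pnatr_eq0 // uv.
    by rewrite scale_scalar_mx; congr (_%:M); field.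
  rewrite mul_mx_scalar scalerA.
  have -> : 2 / a * (a / 2) = 1 by field.
  by rewrite scale1r /u opprB addrC subrK.
Qed.

(** A reflection moves a unit eigenvector to the first basis vector; by symmetry a block of size 1
    then splits off, and induction applies to the other block. *)
Lemma symmetric_diagonalizable n (A : 'M[R]_n) : A^T = A ->
  exists (k : 'M[R]_n) (d : 'rV[R]_n), k^T *m k = 1%:M /\ A = k *m diag_mx d *m k^T.
Proof.
elim: n A => [|n IH] A As.
  by exists 1%:M, 0; split; apply/matrixP; case.
have [r [v [v0 Hv]]] := symmetric_eigenvalue As.
pose s := (v *m v^T) 0 0.
have s0 : 0 < s.
  have sE : s = \sum_i v 0 i ^+ 2 by rewrite /s mxE; apply: eq_bigr => l _; rewrite mxE.
  rewrite lt_def sE sumr_ge0 ?andbT => [|i _]; last exact: sqr_ge0.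
  apply: contraNneq v0 => /eqP; rewrite psumr_eq0 => [/allP H|l _]; last exact: sqr_ge0.
  apply/eqP/matrixP => i j; rewrite ord1 mxE.
  by have := H j (mem_index_enum _); rewrite sqrf_eq0 => /eqP.
pose w : 'cV[R]_n.+1 := (Num.sqrt s)^-1 *: v^T.
have ww : w^T *m w = 1%:M.
  have -> : w^T = (Num.sqrt s)^-1 *: v by apply/matrixP => i j; rewrite !mxE.
  rewrite /w -scalemxAl -scalemxAr scalerA.
  apply/matrixP => i j; rewrite !ord1 mxE -/s !mxE /= -invfM -expr2 sqr_sqrtr ?ltW //.
  by rewrite mulVf ?gt_eqF.
have Aw : A *m w = r *: w.
  have AE : A *m v^T = r *: v^T.
    by rewrite -[A]As -trmx_mul Hv; apply/matrixP => i j; rewrite !mxE.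
  by rewrite /w -scalemxAr AE !scalerA mulrC.
have [K [KT KK Kw]] := reflection_exists ww.
have [B [BT Be AB]] : exists B : 'M[R]_(1 + n), [/\ B^T = B,
    B *m delta_mx 0 0 = r *: delta_mx 0 0 :> 'cV[R]_(1 + n) & A = K *m B *m K].
  exists (K *m A *m K); split.
  - by rewrite !trmx_mul As KT mulmxA.
  - rewrite -[delta_mx 0 0]Kw mulmxA -(mulmxA _ K K) KK mulmx1 -mulmxA Aw.
    by rewrite -scalemxAr.
  - by rewrite !mulmxA KK mul1mx -mulmxA KK mulmx1.
have l0 : lshift n (0 : 'I_1) = (0 : 'I_n.+1) by apply/val_inj.
have B0 i : B i (lshift n 0) = r *+ (i == lshift n 0).
  have := congr1 (fun m : 'cV[R]_(1 + n) => m i 0) Be.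
  rewrite -colE !mxE l0 => ->; rewrite eqxx andbT.
  by case: eqP => _; rewrite ?mulr1 ?mulr0.
have BE : B = block_mx r%:M 0 0 (drsubmx B).
  rewrite -[LHS]submxK; congr block_mx; apply/matrixP => i j; rewrite !mxE !ord1.
  - by rewrite B0 eqxx.
  - by rewrite -[B]BT mxE B0 eq_sym eq_lrshift.
  - by rewrite B0 eq_sym eq_lrshift.
have B'T : (drsubmx B)^T = drsubmx B by rewrite -[in RHS]BT; apply/matrixP => i j; rewrite !mxE.
have [k' [d' [kk' E']]] := IH _ B'T.
pose L : 'M[R]_(1 + n) := block_mx 1%:M 0 0 k'.
have LL : L^T *m L = 1%:M.
  rewrite /L tr_block_mx !trmx0 trmx1 mulmx_block !mulmx0 !mul0mx !addr0 !add0r mulmx1.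
  by rewrite kk' -scalar_mx_block.
exists (K *m L), (row_mx r%:M d'); split.
  by rewrite trmx_mul -mulmxA (mulmxA K^T) KT KK mul1mx LL.
have DE : diag_mx (row_mx r%:M d') = block_mx r%:M 0 0 (diag_mx d') :> 'M[R]_(1 + n).
  rewrite diag_mx_row; congr block_mx.
  by apply/matrixP => i j; rewrite !mxE !ord1.
have LD : L *m block_mx r%:M 0 0 (diag_mx d') *m L^T = B.
  rewrite [RHS]BE E' /L tr_block_mx !trmx0 trmx1 !mulmx_block.
  by rewrite !mulmx0 !mul0mx !addr0 !add0r mulmx1 !mul1mx !mul0mx.
rewrite [X in _ *m X *m _]DE AB trmx_mul KT -LD; by rewrite !mulmxA.
Qed.

Lemma special_diagonalizable n (A : 'M[R]_n) : A^T = A ->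
  exists (k : 'M[R]_n) (d : 'rV[R]_n),
    [/\ k^T *m k = 1%:M, \det k = 1 & A = k *m diag_mx d *m k^T].
Proof.
move=> /symmetric_diagonalizable[k [d [kk E]]].
case: n A k d kk E => [|n] A k d kk E.
  by exists 1%:M, 0; split; rewrite ?det1 //; apply/matrixP; case.
have /eqP : \det k ^+ 2 = 1 by rewrite expr2 -{1}det_tr -det_mulmx kk det1.
rewrite sqrf_eq1 => /orP[/eqP k1|/eqP k1]; first by exists k, d.
(* A sign change in the first column of [k] repairs the determinant; diagonal matrices commute with
   it, so the diagonalization survives. *)
pose s : 'rV[R]_n.+1 := \row_i (-1) ^+ (i == 0).
have ss : diag_mx s *m diag_mx s = 1%:M.
  rewrite mulmx_diag; apply/matrixP => i j; rewrite !mxE.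
  by rewrite -expr2 sqrr_sign.
exists (k *m diag_mx s), d; split.
- by rewrite trmx_mul tr_diag_mx -mulmxA (mulmxA k^T) kk mul1mx.
- rewrite det_mulmx k1 det_diag big_ord_recl mxE big1 ?mulr1 ?mulrNN ?mulr1 // => i _.
  by rewrite mxE.
- rewrite trmx_mul tr_diag_mx E !mulmxA; congr (_ *m _); rewrite -!mulmxA; congr (_ *m _).
  rewrite !mulmx_diag; congr (diag_mx _); apply/matrixP => i j; rewrite (ord1 i) !mxE.
  by case: (j == 0); rewrite ?expr1 ?expr0; ring.
Qed.

End RealSpectral.

(** * Newton's identities *)

Section NewtonRecursion.
Variables (L : comNzRingType) (iv : nat -> L) (c : nat -> L).

(* The elementary symmetric functions [e_k; ...; e_0] determined by the power
   sums [c] through Newton's identities; [iv k] stands for [1 / (k + 1)]. *)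
Fixpoint newton_seq k : seq L :=
  if k is k'.+1 then
    (iv k' * \sum_(m < k'.+1) (-1) ^+ m * c m.+1 * (newton_seq k')`_m) :: newton_seq k'
  else [:: 1].

Definition newton k : L := (newton_seq k)`_0.

Definition newton_identity (e p : nat -> L) k : Prop :=
  k.+1%:R * e k.+1 = \sum_(m < k.+1) (-1) ^+ m * p m.+1 * e (k - m)%N.

Lemma newton_seqE k m : (m <= k)%N -> (newton_seq k)`_m = newton (k - m).
Proof.
elim: k m => [|k IH] [|m] //= mk.
by rewrite IH // subSS.
Qed.

Lemma newtonS k : newton k.+1 = iv k * \sum_(m < k.+1) (-1) ^+ m * c m.+1 * newton (k - m).
Proof.
rewrite /newton /=; congr (_ * _); apply: eq_bigr => m _.
by rewrite newton_seqE // -ltnS.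
Qed.

Lemma newton_unique (e : nat -> L) n : e 0%N = 1 ->
  (forall k, (k < n)%N -> iv k * k.+1%:R = 1) ->
  (forall k, (k < n)%N -> newton_identity e c k) ->
  forall k, (k <= n)%N -> e k = newton k.
Proof.
move=> e0 Hiv He; elim/ltn_ind => -[|k] IH kn //.
rewrite newtonS -[LHS]mul1r -[X in X * e _](Hiv k kn) -mulrA He //; congr (_ * _).
apply: eq_bigr => m _; rewrite IH ?ltnS ?leq_subr //.
exact: leq_trans (leq_subr _ _) (ltnW kn).
Qed.

(** As [e 0 = 1], the last term of the identity is [p k.+1] up to sign, so strong induction recovers
    the power sums from the [e k] without division. *)
Lemma power_sums_unique (e p : nat -> L) n : e 0%N = 1 ->
  (forall k, (k < n)%N -> newton_identity e c k) ->
  (forall k, (k < n)%N -> newton_identity e p k) ->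
  forall k, (k < n)%N -> p k.+1 = c k.+1.
Proof.
move=> e0 Hc Hp; elim/ltn_ind => k IH kn.
have := Hp k kn; rewrite /newton_identity (Hc k kn) !big_ord_recr /= subnn e0 !mulr1.
rewrite [X in _ = X + _](eq_bigr (fun m : 'I_k => (-1) ^+ m * c m.+1 * e (k - m)%N)); last first.
  by move=> m _; rewrite IH // (ltn_trans _ kn).
by move=> /addrI /(can_inj (signrMK k)).
Qed.

End NewtonRecursion.

Lemma rmorph_newton (L L' : comNzRingType) (f : {rmorphism L -> L'}) iv c k :
  f (newton iv c k) = newton (f \o iv) (f \o c) k.
Proof.
elim/ltn_ind: k => -[|k] IH; first by rewrite /newton /= rmorph1.
rewrite !newtonS rmorphM rmorph_sum /=; congr (_ * _); apply: eq_bigr => m _.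
by rewrite !rmorphM rmorphXn rmorphN1 IH // ltnS leq_subr.
Qed.

Lemma deriv_prod_nat (L : comNzRingType) (I : eqType) (s : seq I) (F : I -> {poly L}) : uniq s ->
  (\prod_(i <- s) F i)^`() = \sum_(i <- s) (F i)^`() * \prod_(j <- s | j != i) F j.
Proof.
elim: s => [|i s IH] /=; first by rewrite !big_nil derivC.
move=> /andP[si us]; rewrite !big_cons derivM IH // eqxx /= mulr_sumr.
congr (_ * _ + _).
  rewrite [LHS]big_seq [RHS]big_seq_cond; apply: eq_bigl => j.
  by case js: (j \in s) => //=; apply/esym; apply: contraNneq si => <-.
apply: eq_big_seq => j js.
rewrite big_cons; case: eqP => [ij|_]; first by rewrite ij js in si.
by rewrite mulrCA.
Qed.

Section Newton.
Variables (F : fieldType) (n : nat).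
Implicit Type x : 'I_n -> F.

Definition elsym x k : F := (\prod_i (1 + x i *: 'X))`_k.
Definition psum x k : F := \sum_i x i ^+ k.

Lemma elsym0 x : elsym x 0 = 1.
Proof.
rewrite /elsym -horner_coef0 horner_prod big1 // => i _.
by rewrite !hornerE.
Qed.

(** Logarithmic differentiation of the generating function: its derivative is the sum of the
    [x i *: fi i], where [fi i] is [f] divided by [1 + x i *: 'X], and this quotient is expanded as
    a geometric series ([fik]). *)
Lemma newton_elsym x k : newton_identity (elsym x) (psum x) k.
Proof.
rewrite /newton_identity /elsym; set f := \prod_i _.
pose fi i := \prod_(j | j != i) (1 + x j *: 'X).
have ffi i : f = (1 + x i *: 'X) * fi i by rewrite /f (bigD1 i).
have fik i m : (fi i)`_m = \sum_(l < m.+1) (- x i) ^+ l * f`_(m - l).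
  elim: m => [|m IH].
    rewrite big_ord1 expr0 mul1r subn0 (ffi i) coef0M coefD coefZ coefX mulr0 addr0 coef1.
    by rewrite mul1r.
  rewrite big_ord_recl expr0 mul1r subn0.
  have -> : f`_m.+1 = (fi i)`_m.+1 + x i * (fi i)`_m.
    by rewrite (ffi i) mulrDl mul1r coefD -scalerAl coefZ coefXM.
  rewrite IH -addrA -[LHS]addr0; congr (_ + _); apply/esym.
  rewrite mulr_sumr -big_split big1 //= => l _.
  by rewrite /bump /= add1n subSS exprS mulrA -mulrDl mulNr subrr mul0r.
have -> : k.+1%:R * f`_k.+1 = (f^`())`_k by rewrite coef_deriv mulr_natl.
rewrite /f deriv_prod_nat ?index_enum_uniq // coef_sum.
under [RHS]eq_bigr do rewrite /psum mulr_sumr mulr_suml.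
rewrite exchange_big /=; apply: eq_bigr => i _.
rewrite derivD derivC add0r derivZ derivX alg_polyC mul_polyC coefZ -/(fi i) fik mulr_sumr.
apply: eq_bigr => l _; rewrite -/f mulrA (exprNn (x i)); congr (_ * _).
by rewrite exprS mulrCA.
Qed.

Lemma elsym_mesym x k : meval x (mesym n F k) = elsym x k.
Proof.
rewrite /elsym.
have -> : \prod_i (1 + x i *: 'X) = \prod_i (x i *: 'X + 1) :> {poly F}.
  by apply: eq_bigr => i _; rewrite addrC.
rewrite bigA_distr coef_sum /mesym raddf_sum /= big_mkcond; apply: eq_bigr => J _.
have -> : \prod_i (if i \in J then x i *: 'X else 1) = (\prod_(i in J) x i) *: 'X^#|J| :> {poly F}.
  rewrite -big_mkcond /= scaler_prod; congr (_ *: _).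
  by rewrite big_const iter_mulr_1.
rewrite coefZ coefXn eq_sym; case: eqP => _; last by rewrite mulr0.
by rewrite mulr1 rmorph_prod; apply: eq_bigr => i _; rewrite /= mevalXU.
Qed.

End Newton.

(** * Power sums and polynomials invariant under SO_n *)

Section PowerSums.
Variable R : realType.
Local Notation C := R[i].

Let iv (k : nat) : C := k.+1%:R^-1.
Let ivP k : iv k * k.+1%:R = 1.
Proof. by rewrite /iv mulVf // pnatr_eq0. Qed.

(** Newton's recursion turns the prescribed [c] into [e]. The monic polynomial with coefficients
    [(-1) ^+ k * e k] splits over [R[i]], and Newton's identities lead back from its roots to
    [c]. *)
Lemma exists_power_sums n (c : nat -> C) :
  exists y : 'I_n -> C, forall k, (k < n)%N -> psum y k.+1 = c k.+1.
Proof.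
pose e := newton iv c.
have He k : newton_identity e c k by rewrite /newton_identity /e newtonS mulrA (mulrC k.+1%:R) ivP mul1r.
pose g : {poly C} := \sum_(k < n.+1) ((-1) ^+ k * e k) *: 'X^(n - k).
have gE (k : 'I_n.+1) : g`_(n - k) = (-1) ^+ k * e k.
  rewrite /g coef_sum (bigD1 k) //= coefZ coefXn eqxx mulr1 big1 ?addr0 // => j jk.
  rewrite coefZ coefXn; case: eqP => [E|]; last by rewrite mulr0.
  have jn : (j <= n)%N by rewrite -ltnS.
  have kn : (k <= n)%N by rewrite -ltnS.
  by case/eqP: jk; apply: val_inj; rewrite /= -(subKn jn) -E subKn.
have sg : (size g <= n.+1)%N.
  apply: (leq_trans (size_sum _ _ _)); apply/bigmax_leqP => k _.
  by apply: (leq_trans (size_scale_leq _ _)); rewrite size_polyXn ltnS leq_subr.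
have gn : g`_n = 1 by have := gE ord0; rewrite /= subn0 expr0 mul1r.
have sgE : size g = n.+1.
  apply/eqP; rewrite eqn_leq sg ltnNge; apply/negP => sg'.
  by have := gn; rewrite nth_default // => /esym/eqP; rewrite oner_eq0.
have lg : lead_coef g = 1 by rewrite lead_coefE sgE.
have [rs Hrs] := closed_field_poly_normal g; rewrite lg scale1r in Hrs.
have srs : size rs == n.
  by have := sgE; rewrite Hrs size_prod_XsubC => -[->].
pose cs := Tuple srs; pose y := tnth cs.
exists y.
have ey k : (k <= n)%N -> elsym y k = e k.
  move=> kn; rewrite -ltnS in kn.
  have := mroots_coeff cs (Ordinal kn); rewrite /= -Hrs (gE (Ordinal kn)) elsym_mesym.
  by move=> /(can_inj (signrMK k)).
apply: (@power_sums_unique _ c (elsym y)); first exact: elsym0.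
  move=> k kn; rewrite /newton_identity ey // He; apply: eq_bigr => m _.
  by rewrite ey // (leq_trans (leq_subr _ _)) // ltnW.
by move=> k _; apply: newton_elsym.
Qed.

Lemma meval_eq_fun N (p : mpoly N C) (v w : 'I_N -> C) : v =1 w -> meval v p = meval w p.
Proof. exact: meval_eq. Qed.

(** Subtracting the mean parametrizes the hyperplane of sum zero by free variables, so that
    identities on the hyperplane become identities of polynomials. *)
Definition centered N (i : 'I_N) : mpoly N C :=
  mpolyX C (mnm1 i) - mpolyC N (N%:R^-1) * \sum_j mpolyX C (mnm1 j).

Lemma meval_centered N (x : 'I_N -> C) i :
  meval x (centered i) = x i - N%:R^-1 * \sum_j x j.
Proof.
rewrite /centered mevalB mevalM mevalC mevalXU raddf_sum.
by congr (_ - _ * _); apply: eq_bigr => j _; rewrite /= mevalXU.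
Qed.

Lemma sum_centered N (x : 'I_N -> R) : (0 < N)%N ->
  \sum_i (x i - N%:R^-1 * \sum_j x j) = 0.
Proof.
move=> N0; rewrite sumrB sumr_const card_ord -[X in _ - X]mulr_natl mulrA divff ?mul1r ?subrr //.
by rewrite pnatr_eq0 -lt0n.
Qed.

Lemma psum_real N (x : 'I_N -> R) k : psum (fun i => (x i)%:C) k = (psum x k)%:C.
Proof. by rewrite /psum rmorph_sum; apply: eq_bigr => i _; rewrite rmorphXn. Qed.

Lemma centered_real N (x : 'I_N -> R) i :
  meval (fun i => (x i)%:C) (centered i) = (x i - N%:R^-1 * \sum_j x j)%:C.
Proof.
rewrite meval_centered rmorphB rmorphM rmorph_sum fmorphV; congr (_ - _^-1 * _).
by rewrite raddfMn.
Qed.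

(** Vanishing at real points of sum zero is turned into the polynomial identity [P = 0], which is
    then evaluated at complex points of sum zero: there the remaining power sums take all values. *)
Lemma centered_psum_independent n (p : mpoly n C) :
  (forall x : 'I_n.+1 -> R, \sum_i x i = 0 ->
     meval (fun i : 'I_n => (psum x i.+2)%:C) p = 0) -> p = 0.
Proof.
move=> H.
pose T : n.-tuple (mpoly n.+1 C) := [tuple \sum_l (@centered n.+1 l) ^+ i.+2 | i < n].
pose P := comp_mpoly T p.
have PE x : meval x P = meval (fun i : 'I_n => psum (fun l => meval x (centered l)) i.+2) p.
  rewrite /P comp_mpoly_meval; apply: meval_eq_fun => i.
  rewrite tnth_mktuple raddf_sum; apply: eq_bigr => l _.
  by rewrite /= rmorphXn.
have P0 : P = 0.
  apply: mpoly_real_eq0 => x; rewrite PE -(H _ (sum_centered x (ltn0Sn n))).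
  apply: meval_eq_fun => i; rewrite -psum_real; apply: eq_bigr => l _.
  by rewrite centered_real.
apply: mpoly_real_eq0 => c.
(* [cc] prescribes 0 for the first power sum; the guard is there because [k.-2] also sends 1 to
   0. *)
pose cc k : C := if insub k.-2 is Some i then (if (1 < k)%N then (c (i : 'I_n))%:C else 0) else 0.
have [y Hy] := @exists_power_sums n.+1 cc.
have y0 : \sum_i y i = 0.
  have := Hy 0%N (ltn0Sn n); rewrite /psum /cc /=.
  by under eq_bigr do rewrite expr1; move=> ->; case: insub.
rewrite -(meval0 y) -P0 PE; apply: meval_eq_fun => i.
transitivity (psum y i.+2); last first.
  by apply: eq_bigr => l _; rewrite meval_centered y0 mulr0 subr0.
by rewrite Hy ?ltnS // /cc /= valK.
Qed.

Definition center_mpoly N (q : mpoly N C) : mpoly N C := comp_mpoly [tuple centered i | i < N] q.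

Lemma meval_center N (q : mpoly N C) (x : 'I_N -> R) :
  meval (fun i => (x i)%:C) (center_mpoly q) =
  meval (fun i => (x i - N%:R^-1 * \sum_j x j)%:C) q.
Proof.
rewrite /center_mpoly comp_mpoly_meval; apply: meval_eq_fun => i.
by rewrite tnth_mktuple centered_real.
Qed.

Lemma meval_msym N (s : 'S_N) (p : mpoly N C) v :
  meval v (msym s p) = meval (v \o s) p.
Proof.
rewrite /msym /mmap raddf_sum mevalE; apply: eq_bigr => m _.
rewrite /= mevalM mevalC; congr (_ * _); rewrite /mmap1 rmorph_prod.
by apply: eq_bigr => i _; rewrite rmorphXn /= mevalXU.
Qed.

Section Chevalley.
Variables (n r : nat) (S : 'M[R]_n.+1 -> C) (q : mpoly n.+1 C).
Hypothesis Sdiag : forall x : 'I_n.+1 -> R, \sum_i x i = 0 ->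
  S (diag_mx (\row_i x i)) = meval (fun i => (x i)%:C) q.
Hypothesis Sinv : forall k A, k^T *m k = 1%:M -> \det k = 1 -> ssym A ->
  S (k *m A *m k^T) = S A.
Hypothesis Shom : forall (t : R) A, ssym A -> S (t *: A) = (t ^+ r)%:C * S A.

Lemma ssym_diag (x : 'I_n.+1 -> R) : \sum_i x i = 0 -> ssym (diag_mx (\row_i x i)).
Proof.
move=> x0; split; first exact: tr_diag_mx.
by rewrite mxtrace_diag -[RHS]x0; apply: eq_bigr => i _; rewrite mxE.
Qed.

(** A permutation matrix may have determinant -1. A sign at index 0 corrects this and commutes with
    diagonal matrices. *)
Lemma special_perm (s : 'S_n.+1) : exists k : 'M[R]_n.+1,
  [/\ k^T *m k = 1%:M, \det k = 1 & forall x : 'I_n.+1 -> R,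
   k *m diag_mx (\row_i x i) *m k^T = diag_mx (\row_i x (s i))].
Proof.
pose w : 'rV[R]_n.+1 := \row_i (-1) ^+ ((i == 0) && odd_perm s).
have ww : diag_mx w *m diag_mx w = 1%:M.
  by rewrite mulmx_diag; apply/matrixP => i j; rewrite !mxE -expr2 sqrr_sign.
exists (perm_mx s *m diag_mx w); split.
- rewrite trmx_mul tr_diag_mx -mulmxA (mulmxA _ (perm_mx s)) tr_perm_mx -perm_mxM.
  by rewrite mulVg perm_mx1 mul1mx.
- rewrite det_mulmx det_perm det_diag big_ord_recl mxE eqxx /= big1 ?mulr1.
    by rewrite -expr2 sqrr_sign.
  by move=> i _; rewrite mxE.
- move=> x; rewrite trmx_mul tr_diag_mx tr_perm_mx -!mulmxA.
  rewrite (mulmxA (diag_mx (\row_i x i))) (mulmxA (diag_mx w)).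
  have -> : diag_mx w *m (diag_mx (\row_i x i) *m diag_mx w) = diag_mx (\row_i x i).
    rewrite !mulmx_diag; congr (diag_mx _); apply/matrixP => i j; rewrite (ord1 i) !mxE.
    by rewrite mulrCA -expr2 sqrr_sign mulr1.
  rewrite mulmxA -row_permE -col_permE; apply/matrixP => i j.
  by rewrite !mxE (inj_eq perm_inj).
Qed.

Lemma meval_q1 (x : 'I_n.+1 -> R) : meval (fun i => (x i)%:C) (center_mpoly q) =
  S (diag_mx (\row_i (x i - n.+1%:R^-1 * \sum_j x j))).
Proof. by rewrite meval_center Sdiag //; exact: sum_centered. Qed.

(** [q] is determined only on the hyperplane of sum zero and need not be symmetric. Its restriction
    to the hyperplane is, by invariance of [S] and [special_perm], and [center_mpoly q] extends this
    restriction constantly along (1, ..., 1). *)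
Lemma q1_symmetric s : msym s (center_mpoly q) = center_mpoly q.
Proof.
apply: subr0_eq; apply: mpoly_real_eq0 => x.
rewrite mevalB; apply/eqP; rewrite subr_eq0; apply/eqP.
apply: (etrans (meval_msym _ _ _)).
apply: (etrans (meval_q1 (x \o s))); apply: (etrans _ (esym (meval_q1 x))).
have -> : \sum_j (x \o s) j = \sum_j x j by rewrite [RHS](reindex_inj (@perm_inj _ s)).
have [k [k1 k2 k3]] := special_perm s.
rewrite -(k3 (fun i => x i - n.+1%:R^-1 * \sum_j x j)) Sinv //.
by apply: ssym_diag; apply: sum_centered.
Qed.

Definition elementary_in_psums (k : nat) : mpoly n.+1 C :=
  newton (fun k => mpolyC n.+1 (iv k))
    (fun m => if insub m.-1 is Some i then mpolyX C (mnm1 i) else 0) k.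

Lemma meval_elementary (x : 'I_n.+1 -> C) k : (k <= n.+1)%N ->
  meval (fun i : 'I_n.+1 => psum x i.+1) (elementary_in_psums k) = elsym x k.
Proof.
move=> kn; rewrite /elementary_in_psums rmorph_newton /=.
symmetry; apply: (@newton_unique _ _ _ (elsym x) n.+1) => //; first exact: elsym0.
- by move=> l _; rewrite /= mevalC ivP.
move=> l ln; have := newton_elsym x l; rewrite /newton_identity => ->.
apply: eq_bigr => m _; congr (_ * _ * _); rewrite /=.
have mn : (m < n.+1)%N by apply: leq_trans ln; rewrite ltn_ord.
by rewrite (insubT (fun m => (m < n.+1)%N) mn) mevalXU.
Qed.

(** The degree in [A] of the product of the [\tr (A ^+ i.+2) ^+ m i], hence a bound for the order of
    the corresponding monomial in the Maass-Selberg operators. *)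
Definition weight (m : multinom n) : nat := (\sum_(i < n) i.+2 * m i)%N.

(** A restriction theorem of Chevalley type. Homogeneity of [S] allows keeping only the monomials of
    weight [r]; this bounds the order of the operator later built from [P]. *)
Lemma invariant_polynomial : exists P : mpoly n C,
  (forall m, m \in msupp P -> weight m = r) /\
  forall A, ssym A -> S A = meval (fun i : 'I_n => (\tr (A ^+ i.+2))%:C) P.
Proof.
have /issymP/sym_fundamental[t [tE _]] := q1_symmetric.
(* [P0] is written in the power sums p_1, p_2, ...; [P1] sets p_1 to 0 and renumbers, so that its
   variable [j] stands for p_(j+2). *)
pose P0 := comp_mpoly [tuple elementary_in_psums i.+1 | i < n.+1] t.
pose P1 := comp_mpoly [tuple (if unlift ord0 i is Some j then mpolyX C (mnm1 j) else 0 : mpoly n C) | i < n.+1] P0.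
have S1 (x : 'I_n.+1 -> R) : \sum_i x i = 0 ->
    S (diag_mx (\row_i x i)) = meval (fun i : 'I_n => (psum x i.+2)%:C) P1.
  move=> x0.
  have -> : S (diag_mx (\row_i x i)) = meval (fun i => (x i)%:C) (center_mpoly q).
    by rewrite meval_q1 x0 mulr0; congr (S (diag_mx _)); apply/matrixP => i j; rewrite !mxE subr0.
  have psE (l : 'I_n.+1) : meval (fun i : 'I_n => (psum x i.+2)%:C)
      (if unlift ord0 l is Some j then mpolyX C (mnm1 j) else 0) =
      psum (fun i => (x i)%:C) l.+1.
    rewrite psum_real; case: unliftP => [j ->|->]; first exact: mevalXU.
    rewrite meval0 /psum; under eq_bigr do rewrite expr1.
    by rewrite x0.
  have elE (i : 'I_n.+1) : meval (fun i => (x i)%:C) (mesym n.+1 C i.+1) =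
      meval (fun i : 'I_n.+1 => psum (fun i => (x i)%:C) i.+1) (elementary_in_psums i.+1).
    by rewrite elsym_mesym meval_elementary.
  rewrite -tE; apply: (etrans (comp_mpoly_meval _ _ _)).
  apply: (etrans _ (esym (comp_mpoly_meval _ _ _))).
  apply: (etrans _ (esym (comp_mpoly_meval _ _ _))).
  apply: meval_eq_fun => i; rewrite !tnth_mktuple elE.
  by apply: meval_eq_fun => l; rewrite tnth_mktuple psE.
pose P : mpoly n C := \sum_(m <- msupp P1 | weight m == r) mcoeff m P1 *: mpolyX C m.
exists P; split.
  move=> m; rewrite mcoeff_msupp; apply: contraNeq => wm.
  rewrite /P.
  rewrite (raddf_sum (mcoeff m)).
  apply/eqP; apply: big1 => m' /eqP wm'.
  rewrite /= mcoeffZ mcoeffX; case: eqP => [E|]; last by rewrite mulr0.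
  by rewrite -E wm' eqxx in wm.
move=> A [As At]; have [k [d [kk k1 E]]] := special_diagonalizable As.
have kk' : k *m k^T = 1%:M by apply: mulmx1C.
pose x i := d 0 i.
have dx : d = \row_i x i by apply/matrixP => i j; rewrite (ord1 i) mxE.
have AX m : A ^+ m = k *m diag_mx (\row_i x i ^+ m) *m k^T.
  elim: m => [|m IH].
    rewrite expr0; have -> : diag_mx (\row_i x i ^+ 0) = 1%:M.
      by apply/matrixP => i j; rewrite !mxE.
    by rewrite mulmx1 kk'.
  rewrite exprS IH -[_ * _]/(_ *m _) {1}E !mulmxA -(mulmxA _ k^T k) kk mulmx1.
  rewrite -(mulmxA k (diag_mx d)) mulmx_diag; congr (_ *m diag_mx _ *m _).
  by apply/matrixP => i j; rewrite !mxE exprS.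
have trA m : \tr (A ^+ m) = psum x m.
  rewrite AX mxtrace_mulC mulmxA kk mul1mx mxtrace_diag.
  by apply: eq_bigr => i _; rewrite mxE.
have x0 : \sum_i x i = 0.
  have E1 := trA 1%N; rewrite expr1 At /psum in E1; rewrite [RHS]E1.
  by apply: eq_bigr => i _; rewrite expr1.
have SE : S A = S (diag_mx (\row_i x i)).
  rewrite E {1}dx; exact: (Sinv kk k1 (ssym_diag x0)).
rewrite SE.
have -> : meval (fun i : 'I_n => (\tr (A ^+ i.+2))%:C) P = meval (fun i : 'I_n => (psum x i.+2)%:C) P.
  by apply: meval_eq_fun => i; rewrite trA.
pose v (i : 'I_n) : C := (psum x i.+2)%:C.
(* Along the line through the diagonal matrix both sides are polynomials in the scaling factor;
   their coefficients of degree [r] are compared. *)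
pose Q : {poly C} := \sum_(m <- msupp P1) (mcoeff m P1 * \prod_i v i ^+ m i) *: 'X^(weight m)
   - (S (diag_mx (\row_i x i))) *: 'X^r.
have Q0 : Q = 0.
  apply: poly_real_eq0 => u.
  rewrite /Q hornerD hornerN hornerZ hornerXn horner_sum; apply/eqP; rewrite subr_eq0.
  have ux0 : \sum_i (u * x i) = 0 by rewrite -mulr_sumr x0 mulr0.
  have : S (diag_mx (\row_i (u * x i))) = (u ^+ r)%:C * S (diag_mx (\row_i x i)).
    rewrite -Shom; last exact: ssym_diag.
    by congr S; apply/matrixP => i j; rewrite !mxE mulrnAr.
  rewrite (S1 _ ux0) mevalE => E2.
  apply/eqP; rewrite [RHS]mulrC -(rmorphXn (real_complex R)).
  apply: (etrans _ E2).
  apply: eq_bigr => m _.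
  rewrite hornerZ hornerXn -mulrA; congr (_ * _).
  rewrite /weight expr_sum -big_split; apply: eq_bigr => i _ /=.
  rewrite exprM -exprMn /v mulrC; congr (_ ^+ _).
  have -> : psum (fun i => u * x i) i.+2 = u ^+ i.+2 * psum x i.+2.
    by rewrite /psum mulr_sumr; apply: eq_bigr => l _; rewrite exprMn.
  by rewrite rmorphM rmorphXn.
have := congr1 (fun Q : {poly C} => Q`_r) Q0.
rewrite /Q coef0 coefB coefZ coefXn eqxx mulr1 => /eqP; rewrite subr_eq0 => /eqP <-.
rewrite coef_sum /P raddf_sum [RHS]big_mkcond; apply: eq_bigr => m _ /=.
rewrite coefZ coefXn eq_sym; case: eqP => _; last by rewrite mulr0.
by rewrite mulr1 mevalZ mevalX.
Qed.

End Chevalley.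
End PowerSums.

(** * Functions of class C^k on matrices *)

Section Differentials.
Variables (R : realType) (V W : normedModType R).

Lemma differentiable_intro (F : V -> W) (x : V) (L : {linear V -> W}) :
  continuous L ->
  (forall e, 0 < e -> \forall h \near (0 : V), `|F (h + x) - F x - L h| <= e * `|h|) ->
  differentiable F x /\ 'd F x = L :> (V -> W).
Proof.
move=> cL H.
have E : F \o shift x = cst (F x) + L +o_ (0 : V) id.
  apply/eqaddoP => e e0; near=> h.
  rewrite (_ : (F \o shift x - (cst (F x) + L)) h = F (h + x) - F x - L h).
    by near: h; exact: H.
  by rewrite !fctE /= opprD addrA.
have dL := diff_unique cL E.
split=> //; apply/diff_locallyP; rewrite dL; split=> //.
Unshelve. all: by end_near. Qed.

Lemma differentiable_elim (F : V -> W) (x : V) : differentiable F x ->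
  forall e, 0 < e ->
  \forall h \near (0 : V), `|F (h + x) - F x - 'd F x h| <= e * `|h|.
Proof.
move=> /diff_locally /eqaddoP H e e0; near=> h.
rewrite (_ : _ - _ = (F \o shift x - (cst (F x) + 'd F x)) h).
  by near: h; exact: H.
by rewrite !fctE /= opprD addrA.
Unshelve. all: by end_near. Qed.

Lemma near_eq_differentiable (F G : V -> W) (x : V) :
  (\forall y \near x, F y = G y) -> differentiable F x -> differentiable G x.
Proof.
move=> FG dF.
have [] // := @differentiable_intro G x ('d F x).
  exact: diff_continuous.
move=> e e0.
have FG0 : \forall h \near (0 : V), F (h + x) = G (h + x).
  by have := FG; rewrite (near_shift (0 : V) x) subr0.
near=> h.
rewrite -(near FG0 h)// -(nbhs_singleton FG).
by near: h; exact: differentiable_elim.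
Unshelve. all: by end_near. Qed.

End Differentials.

Section CkBasics.
Variables (R : realType) (n : nat).
Implicit Types (U : set 'M[R]_n) (F G : 'M[R]_n -> R).

Lemma Ck_le k U F : Ck k.+1 U F -> Ck k U F.
Proof.
elim: k U F => [|k IH] U F /= [dF HF].
  by move=> x Ux; apply: differentiable_continuous; apply: dF.
by split=> // v; apply: IH; apply: HF.
Qed.

Lemma Ck_ext k U F G : open U -> (forall x, U x -> F x = G x) ->
  Ck k U F -> Ck k U G.
Proof.
move=> oU; elim: k F G => [|k IH] F G FG /=.
  move=> cF x Ux.
  have nFG : \forall y \near x, F y = G y.
    by apply: filterS (open_nbhs_nbhs (conj oU Ux)) => y; apply: FG.
  have := cF x Ux; rewrite /prop_for /continuous_at (FG x Ux).
  by apply: cvg_trans; apply: (near_eq_cvg nFG).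
move=> [dF HF]; split=> [x Ux|v].
  apply: near_eq_differentiable (dF x Ux).
  by apply: filterS (open_nbhs_nbhs (conj oU Ux)) => y; apply: FG.
apply: IH (HF v) => x Ux.
apply: near_eq_derive.
by apply: filterS (open_nbhs_nbhs (conj oU Ux)) => y; apply: FG.
Qed.

Lemma Ck_sub k U U' F : U' `<=` U -> Ck k U F -> Ck k U' F.
Proof.
move=> sU; elim: k F => [|k IH] F /=; first by move=> H x /sU; apply: H.
by move=> [dF HF]; split=> [x /sU|v]; [apply: dF | apply: IH].
Qed.

Lemma Ck_local k U F : open U ->
  (forall x, U x -> exists U', [/\ open U', U' x & Ck k U' F]) -> Ck k U F.
Proof.
move=> oU; elim: k F => [|k IH] F H /=.
  by move=> x /H[U' [oU' U'x]]; apply.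
split=> [x /H[U' [oU' U'x []]] + _|v]; first exact.
apply: IH => x /H[U' [oU' U'x [_ HF]]]; by exists U'; split=> //; apply: HF.
Qed.

Lemma Ck_cst k U (c : R) : Ck k U (fun=> c).
Proof.
elim: k c => [|k IH] c /=; first by move=> x _; apply: cst_continuous.
split=> [x _|v]; first exact: differentiable_cst.
by rewrite (_ : 'D_v _ = fun=> 0) //; apply/funext => x; rewrite derive_cst.
Qed.

Lemma derive_coord (v x : 'M[R]_n) i j : 'D_v (fun X : 'M[R]_n => X i j) x = v i j.
Proof.
rewrite (_ : 'D_v _ x = ('D_v id x) i j); first by rewrite derive_id.
by rewrite derive_mx ?mxE//; exact: derivable_id.
Qed.

Lemma Ck_coord k U i j : Ck k U (fun X => X i j).
Proof.
case: k => [|k] /=; first by move=> x _; apply: differentiable_continuous (differentiable_coord _ _ _).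
split=> [x _|v]; first exact: differentiable_coord.
rewrite (_ : 'D_v _ = fun=> v i j); first exact: Ck_cst.
by apply/funext => x; rewrite derive_coord.
Qed.

Lemma Ck_diff k U F x : Ck k.+1 U F -> U x -> differentiable F x.
Proof. by move=> [] H _; apply: H. Qed.

Lemma Ck_D k U F G : open U -> Ck k U F -> Ck k U G -> Ck k U (fun x => F x + G x).
Proof.
move=> oU; elim: k F G => [|k IH] F G /=.
  by move=> cF cG x Ux; apply: continuousD; [apply: cF|apply: cG].
move=> [dF HF] [dG HG]; split=> [x Ux|v].
  by apply: differentiableD; [apply: dF|apply: dG].
apply: (Ck_ext oU _ (IH _ _ (HF v) (HG v))) => x Ux.
by rewrite -[RHS]/('D_v (F + G) x) deriveD //; apply: diff_derivable; [apply: dF|apply: dG].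
Qed.

Lemma Ck_M k U F G : open U -> Ck k U F -> Ck k U G -> Ck k U (fun x => F x * G x).
Proof.
move=> oU; elim: k F G => [|k IH] F G.
  by move=> cF cG x Ux; apply: continuousM; [apply: cF|apply: cG].
move=> CF CG; have [dF HF] := CF; have [dG HG] := CG; split=> [x Ux|v].
  by apply: differentiableM; [apply: dF|apply: dG].
have C1 := IH _ _ (HF v) (Ck_le CG).
have C2 := IH _ _ (Ck_le CF) (HG v).
apply: (Ck_ext oU _ (Ck_D oU C1 C2)) => x Ux.
rewrite -[RHS]/('D_v (F * G) x) deriveM; last 2 first.
  by apply: diff_derivable; apply: dF.
  by apply: diff_derivable; apply: dG.
by rewrite addrC; congr (_ + _); rewrite [RHS]mulrC.
Qed.

Lemma Ck_sum k U (I : Type) (r : seq I) (P : pred I) (F : I -> 'M[R]_n -> R) :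
  open U -> (forall i, P i -> Ck k U (F i)) ->
  Ck k U (fun x => \sum_(i <- r | P i) F i x).
Proof.
move=> oU HF; elim: r => [|i r IH].
  by apply: (Ck_ext oU _ (Ck_cst k U 0)) => x _; rewrite big_nil.
case Pi: (P i).
  by apply: (Ck_ext oU _ (Ck_D oU (HF i Pi) IH)) => x _; rewrite big_cons Pi.
by apply: (Ck_ext oU _ IH) => x _; rewrite big_cons Pi.
Qed.

Lemma Ck_prod k U (I : Type) (r : seq I) (P : pred I) (F : I -> 'M[R]_n -> R) :
  open U -> (forall i, P i -> Ck k U (F i)) ->
  Ck k U (fun x => \prod_(i <- r | P i) F i x).
Proof.
move=> oU HF; elim: r => [|i r IH].
  by apply: (Ck_ext oU _ (Ck_cst k U 1)) => x _; rewrite big_nil.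
case Pi: (P i).
  by apply: (Ck_ext oU _ (Ck_M oU (HF i Pi) IH)) => x _; rewrite big_cons Pi.
by apply: (Ck_ext oU _ IH) => x _; rewrite big_cons Pi.
Qed.

Lemma derive_comp_real (p : R -> R) (l : R) F x v : is_derive (F x) 1 p l ->
  differentiable F x ->
  differentiable (fun y => p (F y)) x /\ 'D_v (fun y => p (F y)) x = l * 'D_v F x.
Proof.
move=> dp dF.
have dP : differentiable p (F x).
  by apply/derivable1_diffP; case: dp.
have dC : differentiable (p \o F) x by apply: differentiable_comp.
split=> //.
rewrite -[LHS]/('D_v (p \o F) x) deriveE // diff_comp //.
rewrite [LHS]/('d p (F x) ('d F x v)).
have E w : 'd p (F x) w = w * 'D_1 p (F x).
  by rewrite deriveE // -[w in LHS]mulr1 -linearZ.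
apply: (etrans (E _)); rewrite [in RHS]deriveE // [LHS]mulrC; congr (_ * _).
by case: dp.
Qed.

Lemma derive_powR F (s : R) x v : 0 < F x -> differentiable F x ->
  differentiable (fun y => F y `^ s) x /\
  'D_v (fun y => F y `^ s) x = s * F x `^ (s - 1) * 'D_v F x.
Proof. by move=> Fx; exact: (@derive_comp_real (fun y => y `^ s) _ _ _ _ (is_derive1_powR s Fx)). Qed.

Lemma derive_expR_comp F x v : differentiable F x ->
  differentiable (fun y => expR (F y)) x /\
  'D_v (fun y => expR (F y)) x = expR (F x) * 'D_v F x.
Proof. exact: (derive_comp_real v (is_derive_expR (F x))). Qed.

Lemma Ck_expR k U F : open U -> Ck k U F -> Ck k U (fun x => expR (F x)).
Proof.
move=> oU; elim: k F => [|k IH] F CF.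
  move=> x Ux; apply: (@continuous_comp _ _ _ F expR); first exact: CF.
  exact: continuous_expR.
have [dF HF] := CF; split=> [x Ux|v].
  by have [] := derive_expR_comp 0 (dF x Ux).
apply: (Ck_ext oU _ (Ck_M oU (IH F (Ck_le CF)) (HF v))) => x Ux.
by have [_ ->] := derive_expR_comp v (dF x Ux).
Qed.

Lemma Ck_powR k U F (s : R) : open U -> (forall x, U x -> 0 < F x) ->
  Ck k U F -> Ck k U (fun x => F x `^ s).
Proof.
move=> oU; elim: k F s => [|k IH] F s F0 CF.
  move=> x Ux; apply: (@continuous_comp _ _ _ F (fun y : R => y `^ s)); first exact: CF.
  apply: differentiable_continuous; apply/derivable1_diffP.
  have dp := is_derive1_powR s (F0 x Ux).
  by case: dp.
have [dF HF] := CF; split=> [x Ux|v].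
  by have [] := derive_powR s 0 (F0 x Ux) (dF x Ux).
have C1 := Ck_M oU (Ck_M oU (Ck_cst k U s) (IH _ (s - 1) F0 (Ck_le CF))) (HF v).
apply: (Ck_ext oU _ C1) => x Ux.
by have [_ ->] := derive_powR s v (F0 x Ux) (dF x Ux).
Qed.

Lemma Ck_V k U F : open U -> (forall x, U x -> 0 < F x) ->
  Ck k U F -> Ck k U (fun x => (F x)^-1).
Proof.
move=> oU F0 CF; apply: (Ck_ext oU _ (Ck_powR (-1) oU F0 CF)) => x Ux.
by rewrite powR_inv1 // ltW // F0.
Qed.

End CkBasics.

Section Chain.
Variables (R : realType) (m n : nat).
Implicit Types (phi : 'M[R]_n -> 'M[R]_m) (G : 'M[R]_m -> R).

Lemma differentiable_mx phi x :
  (forall i j, differentiable (fun y => phi y i j) x) -> differentiable phi x.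
Proof.
move=> H.
rewrite (_ : phi = \sum_(i < m) \sum_(j < m) (fun y => phi y i j *: (delta_mx i j : 'M[R]_m))).
  apply: differentiable_sum => i; apply: differentiable_sum => j.
  exact: differentiableZl.
apply/funext => y; rewrite [LHS]matrix_sum_delta fct_sumE.
by apply: eq_bigr => i _; rewrite fct_sumE.
Qed.

Lemma continuous_mx (T : topologicalType) p q (f : T -> 'M[R]_(p, q)) x :
  (forall i j, {for x, continuous (fun y => f y i j)}) -> {for x, continuous f}.
Proof.
move=> H; apply/cvgrPdist_le => e e0; near=> y.
rewrite /Num.Def.normr/= mx_normrE (bigmax_le _ (ltW e0))//= => i _.
rewrite !mxE/=.
move: i; near: y; apply: filter_forall => /= i.
by have /cvgrPdist_le := H i.1 i.2; apply.
Unshelve. all: by end_near. Qed.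

Lemma derive_linear_coord p (F : 'M[R]_p -> R) x w : differentiable F x ->
  'D_w F x = \sum_i \sum_j w i j * 'D_(delta_mx i j) F x.
Proof.
move=> dF; rewrite deriveE // [in LHS](matrix_sum_delta w) linear_sum /=.
apply: eq_bigr => i _; rewrite linear_sum /=; apply: eq_bigr => j _.
by rewrite linearZ /= -deriveE.
Qed.

Lemma derive_comp_mx phi G x v : 
  (forall i j, differentiable (fun y => phi y i j) x) -> differentiable G (phi x) ->
  differentiable (G \o phi) x /\ 'D_v (G \o phi) x = 'D_('D_v phi x) G (phi x).
Proof.
move=> H dG; have dphi := differentiable_mx H.
have dC : differentiable (G \o phi) x by apply: differentiable_comp.
split=> //; rewrite !deriveE // diff_comp //.
Qed.

Lemma derive_mxE phi x v i j : differentiable phi x ->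
  ('D_v phi x) i j = 'D_v (fun y => phi y i j) x.
Proof. by move=> H; rewrite derive_mx ?mxE //; apply: diff_derivable. Qed.

Lemma derive_comp_coord phi G x v : 
  (forall i j, differentiable (fun y => phi y i j) x) -> differentiable G (phi x) ->
  'D_v (G \o phi) x =
    \sum_i \sum_j 'D_v (fun y => phi y i j) x * 'D_(delta_mx i j) G (phi x).
Proof.
move=> H dG; have [_ ->] := derive_comp_mx v H dG.
rewrite derive_linear_coord //; apply: eq_bigr => i _; apply: eq_bigr => j _.
by rewrite derive_mxE //; apply: differentiable_mx.
Qed.

Lemma Ck_comp k (U : set 'M[R]_n) (U' : set 'M[R]_m) phi G :
  open U -> (forall x, U x -> U' (phi x)) ->
  (forall i j, Ck k U (fun y => phi y i j)) -> Ck k U' G -> Ck k U (G \o phi).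
Proof.
move=> oU UU'; elim: k G => [|k IH] G.
  move=> Hphi HG x Ux; apply: continuous_comp; last exact: HG (UU' _ Ux).
  by apply: continuous_mx => i j; apply: Hphi.
move=> Hphi [dG HG].
have dphi i j x : U x -> differentiable (fun y => phi y i j) x.
  by move=> Ux; have [] := Hphi i j => + _; apply.
split=> [x Ux|v].
  by have [] := @derive_comp_mx phi G x 0 (fun i j => dphi i j x Ux) (dG _ (UU' _ Ux)).
have C1 : Ck k U (fun x => \sum_i \sum_j 'D_v (fun y => phi y i j) x *
       ('D_(delta_mx i j) G \o phi) x).
  apply: Ck_sum => // i _; apply: Ck_sum => // j _; apply: Ck_M => //.
    by have [] := Hphi i j => _; apply.
  apply: IH (HG _) => i' j'; apply: Ck_le; exact: Hphi.
apply: (Ck_ext oU _ C1) => x Ux.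
by rewrite derive_comp_coord // => *; [apply: dphi | apply: dG; apply: UU'].
Qed.

End Chain.

Lemma continuous_near_le (R : realType) (T : topologicalType) (f : T -> R) (x : T) (e : R) :
  {for x, continuous f} -> 0 < e -> \forall y \near x, `|f x - f y| <= e.
Proof. by move=> /cvgrPdist_le /[apply]. Qed.

(** * Symmetry of second derivatives *)

Section Schwarz.
Variables (R : realType) (V : normedModType R).

Lemma derivable_line (F : V -> R) (x v : V) (t : R) : differentiable F (x + t *: v) ->
  is_derive t 1 (fun s : R => F (x + s *: v)) ('D_v F (x + t *: v)).
Proof.
move=> dF.
have E : (fun h => h^-1 *: (((fun s : R => F (x + s *: v)) \o shift t) (h *: 1) - F (x + t *: v)))
   = (fun h => h^-1 *: ((F \o shift (x + t *: v)) (h *: v) - F (x + t *: v))).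
  apply/funext => h /=; congr (_ *: (F _ - _)).
  by rewrite [h *: 1]mulr1 scalerDl addrCA.
have dv : derivable F (x + t *: v) v by apply: diff_derivable.
split; first by rewrite /derivable E.
by rewrite /derive E.
Qed.

(** The mean value theorem is applied along [v] to the increment of [F] in direction [w], then along
    [w] to ['D_v F]. *)
Lemma second_difference (F : V -> R) (x v w : V) (s : R) : 0 < s ->
  (forall a b, 0 <= a <= s -> 0 <= b <= s ->
     differentiable F (x + a *: v + b *: w) /\
     differentiable ('D_v F) (x + a *: v + b *: w)) ->
  exists a b, [/\ 0 <= a <= s, 0 <= b <= s &
    F (x + s *: v + s *: w) - F (x + s *: v) - (F (x + s *: w) - F x) =
    s * s * 'D_w ('D_v F) (x + a *: v + b *: w)].
Proof.
move=> s0 H.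
have ss : 0 <= s <= s by rewrite lexx ltW.
have s00 : 0 <= (0 : R) <= s by rewrite lexx ltW.
pose phi (a : R) := F (x + s *: w + a *: v) - F (x + a *: v).
pose dphi (a : R) := 'D_v F (x + s *: w + a *: v) - 'D_v F (x + a *: v).
have dphiP a : 0 <= a <= s -> is_derive a 1 phi (dphi a).
  move=> ha; apply: is_deriveB; apply: derivable_line.
    by have [] := H a s ha ss; rewrite addrAC.
  by have [] := H a 0 ha s00; rewrite scale0r addr0.
have itvW (f df : R -> R) : (forall a, 0 <= a <= s -> is_derive a 1 f (df a)) ->
    exists2 a, 0 <= a <= s & f s - f 0 = df a * s.
  move=> Hf.
  have [|||a] := @MVT_segment R f df 0 s; first exact: ltW.
  - by move=> a; rewrite in_itv /= => /andP[a0 a1]; apply: Hf; rewrite !ltW.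
  - apply: derivable_within_continuous => a; rewrite in_itv /= => ha.
    by have [] := Hf a ha.
  - by rewrite in_itv /= subr0 => ha E; exists a.
have [a ha E1] := itvW _ _ dphiP.
pose psi (b : R) := 'D_v F (x + a *: v + b *: w).
have [b hb E2] := itvW psi (fun b => 'D_w ('D_v F) (x + a *: v + b *: w))
  (fun b hb => derivable_line (proj2 (H a b ha hb))).
exists a, b; split=> //.
have -> : F (x + s *: v + s *: w) - F (x + s *: v) - (F (x + s *: w) - F x) = phi s - phi 0.
  by rewrite /phi scale0r !addr0 [x + s *: w + _]addrAC.
rewrite E1 /dphi [x + s *: w + _]addrAC.
have -> : 'D_v F (x + a *: v + s *: w) - 'D_v F (x + a *: v) = psi s - psi 0.
  by rewrite /psi scale0r addr0.
by rewrite E2 mulrC mulrA mulrAC.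
Qed.

(** The second difference is symmetric in [v] and [w], so the two mixed derivatives agree at two
    points near [x]; continuity brings both points to [x]. *)
Lemma derive_swap (F : V -> R) (U : set V) (x v w : V) : open U -> U x ->
  (forall y, U y -> differentiable F y) ->
  (forall y, U y -> differentiable ('D_v F) y) ->
  (forall y, U y -> differentiable ('D_w F) y) ->
  {for x, continuous ('D_w ('D_v F))} -> {for x, continuous ('D_v ('D_w F))} ->
  'D_w ('D_v F) x = 'D_v ('D_w F) x.
Proof.
move=> oU Ux dF dvF dwF cP cQ.
pose p : R := 'D_w ('D_v F) x; pose q : R := 'D_v ('D_w F) x.
suff : `|p - q| <= 0 by rewrite normr_le0 subr_eq0 => /eqP.
apply/ler_addgt0Pr => e e0; rewrite add0r.
have e20 : 0 < e / 2 by rewrite divr_gt0.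
have n1 : \forall y \near x, U y by apply: open_nbhs_nbhs (conj oU Ux).
have n2 := continuous_near_le cP e20; have n3 := continuous_near_le cQ e20.
have [d d0 Hd] := (nbhs_ballP x _).1 (filterI n1 (filterI n2 n3)).
rewrite /= in d0.
have K0 : 0 < `|v| + `|w| + 1 by rewrite ltr_wpDl // addr_ge0.
(* This side length keeps the whole parallelogram inside the ball of radius [d]; the summand 1
   excludes division by zero when [v = w = 0]. *)
pose s := d / 2 / (`|v| + `|w| + 1).
have s0 : 0 < s by rewrite !divr_gt0.
have Hs a b : 0 <= a <= s -> 0 <= b <= s -> ball x d (x + a *: v + b *: w).
  move=> /andP[a0 a1] /andP[b0 b1]; rewrite -ball_normE /= -addrA opprD addNKr normrN.
  apply: (@le_lt_trans _ _ (s * (`|v| + `|w| + 1))); last first.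
    by rewrite /s divfK ?gt_eqF // ltr_pdivrMr // ltr_pMr // ltr1n.
  apply: (le_trans (ler_normD _ _)); rewrite !normrZ !ger0_norm //.
  rewrite mulrDr mulr1 mulrDr -[leLHS]addr0; apply: lerD; last exact: ltW.
  by apply: lerD; apply: ler_wpM2r.
have Hs' a b : 0 <= a <= s -> 0 <= b <= s -> ball x d (x + b *: w + a *: v).
  by move=> ha hb; rewrite addrAC; apply: Hs.
have [|a [b [ha hb E1]]] := @second_difference F x v w s s0.
  move=> a b ha hb; have [Uy _] := Hd _ (Hs a b ha hb).
  by split; [apply: dF|apply: dvF].
have [|b' [a' [hb' ha' E2]]] := @second_difference F x w v s s0.
  move=> b' a' hb' ha'; have [Uy _] := Hd _ (Hs' a' b' ha' hb').
  by split; [apply: dF|apply: dwF].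
have E0 : F (x + s *: v + s *: w) - F (x + s *: v) - (F (x + s *: w) - F x) =
    F (x + s *: w + s *: v) - F (x + s *: w) - (F (x + s *: v) - F x).
  rewrite [x + s *: w + s *: v]addrAC.
  move: (F (x + s *: v)) (F (x + s *: w)) (F x) (F _) => p1 p2 p3 p4.
  by rewrite !opprB !addrA [LHS]addrAC [RHS]addrAC; congr (_ + _); exact: addrAC.
have ss0 : s * s != 0 by rewrite mulf_neq0 // gt_eqF.
have EE := mulfI ss0 (etrans (esym E1) (etrans E0 E2)).
have [_ [P1 _]] := Hd _ (Hs a b ha hb).
have [_ [_ Q1]] := Hd _ (Hs' a' b' ha' hb').
rewrite -EE in Q1; move: P1 Q1; rewrite -/p -/q.
set r : R := 'D_w _ _; move=> P1 Q1.
rewrite (splitr e) -(subrKA r); apply: (le_trans (ler_normD _ _)).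
apply: lerD; first exact: P1.
rewrite distrC; exact: Q1.
Qed.

End Schwarz.

Lemma Ck_swap (R : realType) n (U : set 'M[R]_n) (F : 'M[R]_n -> R) x v w :
  open U -> U x -> Ck 2 U F -> 'D_w ('D_v F) x = 'D_v ('D_w F) x.
Proof.
move=> oU Ux [dF HF]; apply: (@derive_swap _ _ F U) => //.
- by have [] := HF v.
- by have [] := HF w.
- by have [_ /(_ w)] := HF v; apply.
- by have [_ /(_ v)] := HF w; apply.
Qed.

(** * The matrix exponential *)

Section ExpSeries.
Variable R : realType.
Implicit Types (u w : nat -> R).

(** The entries of a matrix exponential have this form, which reduces matrix series to real ones. *)
Definition expsum u : R := limn (series (fun k => (k`!%:R)^-1 * u k)).

Lemma cvg_expsum u (C r : R) : 0 <= r -> 0 <= C -> (forall k, `|u k| <= C * r ^+ k) ->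
  cvgn (series (fun k => (k`!%:R)^-1 * u k)) /\ `|expsum u| <= C * expR r.
Proof.
move=> r0 C0 Hu.
have f0 k : 0 <= (k`!%:R : R)^-1 by rewrite invr_ge0.
have v0 k : 0 <= C * exp_coeff r k.
  by rewrite /exp_coeff /= mulr_ge0 // mulr_ge0 ?exprn_ge0.
have cv : cvgn (series (fun k => C * exp_coeff r k)).
  rewrite (_ : series _ = C *: series (exp_coeff r)).
    by apply: is_cvgZr; exact: is_cvg_series_exp_coeff.
  by apply/funext => k; rewrite /series /= -mulr_sumr.
have le k : `|(k`!%:R)^-1 * u k| <= C * exp_coeff r k.
  rewrite normrM ger0_norm // /exp_coeff /= [r ^+ k / _]mulrC mulrCA.
  by apply: ler_wpM2l.
have cn : cvgn [normed series (fun k => (k`!%:R)^-1 * u k)].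
  by apply: (series_le_cvg _ v0 le cv) => k; exact: normr_ge0.
split; first exact: normed_cvg.
apply: (le_trans (lim_series_norm cn)).
have -> : C * expR r = limn (series (fun k => C * exp_coeff r k)).
  rewrite (_ : series _ = C *: series (exp_coeff r)).
    by rewrite limZr //; exact: is_cvg_series_exp_coeff.
  by apply/funext => k; rewrite /series /= -mulr_sumr.
apply: ler_lim => //; apply: nearW => k.
by apply: ler_sum => i _; exact: le.
Qed.

Lemma expsum_lin (a : R) u w (C r C' r' : R) : 0 <= r -> 0 <= C -> 0 <= r' -> 0 <= C' ->
  (forall k, `|u k| <= C * r ^+ k) -> (forall k, `|w k| <= C' * r' ^+ k) ->
  expsum (fun k => a * u k + w k) = a * expsum u + expsum w.
Proof.
move=> r0 C0 r0' C0' Hu Hw.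
have [cu _] := cvg_expsum r0 C0 Hu; have [cw _] := cvg_expsum r0' C0' Hw.
rewrite /expsum -[a * limn _]/(a *: limn _) -limZr // -limD //; last exact: is_cvgZr.
congr (limn _); apply/funext => k; rewrite !fctE /series /=.
rewrite -[_ *: _]/(a * _) mulr_sumr -big_split; apply: eq_bigr => i _ /=.
by rewrite mulrDr mulrCA.
Qed.

End ExpSeries.

Section MatrixBounds.
Variables (R : realType) (n : nat).
Implicit Types X V Y : 'M[R]_n.

(** Maximal row sums are submultiplicative, unlike the maximum of the entries, which is the norm on
    matrices. *)
Definition rowbound X (r : R) := forall i, \sum_j `|X i j| <= r.

Lemma rowbound_mul X Y r c : 0 <= c -> rowbound X r -> (forall i j, `|Y i j| <= c) ->
  forall i j, `|(X *m Y) i j| <= r * c.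
Proof.
move=> c0 HX HY i j; rewrite mxE; apply: (le_trans (ler_norm_sum _ _ _)).
apply: (@le_trans _ _ (\sum_l `|X i l| * c)).
  by apply: ler_sum => l _; rewrite normrM; apply: ler_wpM2l.
by rewrite -mulr_suml; apply: ler_wpM2r.
Qed.

Lemma rowbound_norm X : rowbound X (n%:R * `|X|).
Proof.
move=> i; apply: (@le_trans _ _ (\sum_(j < n) `|X|)).
  apply: ler_sum => j _.
  rewrite [leRHS]/Num.Def.normr/= mx_normrE.
  exact: (le_bigmax _ (fun p => `|X p.1 p.2|) (i, j)).
by rewrite sumr_const card_ord mulr_natl.
Qed.

(* [dpow X V k] is the derivative of [X ^+ k] at [X] in the direction [V]. *)
Fixpoint dpow X V k : 'M[R]_n :=
  if k is k'.+1 then X * dpow X V k' + V * X ^+ k' else 0.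

Variables (X V : 'M[R]_n) (r s : R).
Hypotheses (r1 : 1 <= r) (s0 : 0 <= s).
Hypotheses (HX : rowbound X r) (HV : rowbound V s).

Let r0 : 0 <= r. Proof. exact: le_trans r1. Qed.

Lemma expmx_bound k i j : `|(X ^+ k) i j| <= r ^+ k.
Proof.
elim: k i j => [|k IH] i j.
  rewrite expr0 mxE; case: (i == j); first by rewrite normr1.
  by rewrite normr0 ler01.
rewrite !exprS; apply: rowbound_mul => //; exact: exprn_ge0.
Qed.

Lemma ler_expX2 k : r ^+ k <= (2 * r) ^+ k.
Proof. by apply: lerXn2r; rewrite ?nnegrE ?mulr_ge0 // ler_peMl // ler1n. Qed.

Lemma dpow_bound k i j : `|(dpow X V k) i j| <= s * (2 * r) ^+ k.
Proof.
elim: k i j => [|k IH] i j /=; first by rewrite mxE normr0 mulr_ge0 // exprn_ge0 // mulr_ge0.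
have P0 : 0 <= (2 * r) ^+ k by rewrite exprn_ge0 // mulr_ge0.
rewrite mxE; apply: (le_trans (ler_normD _ _)).
have A1 := rowbound_mul (mulr_ge0 s0 P0) HX IH i j.
have A2 := rowbound_mul (exprn_ge0 k r0) HV (expmx_bound k) i j.
apply: (le_trans (lerD A1 A2)); rewrite exprS.
have -> : s * (2 * r * (2 * r) ^+ k) = r * (s * (2 * r) ^+ k) + s * (r * (2 * r) ^+ k) by ring.
rewrite lerD2l; apply: ler_wpM2l => //.
by apply: (le_trans (ler_expX2 k)); rewrite ler_peMl.
Qed.

Hypothesis HXV : rowbound (X + V) r.

Lemma expmx_diff_bound k i j : `|((X + V) ^+ k - X ^+ k) i j| <= s * (2 * r) ^+ k.
Proof.
elim: k i j => [|k IH] i j /=.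
  by rewrite !expr0 subrr mxE normr0 mulr_ge0 // exprn_ge0 // mulr_ge0.
have P0 : 0 <= (2 * r) ^+ k by rewrite exprn_ge0 // mulr_ge0.
have -> : (X + V) ^+ k.+1 - X ^+ k.+1 = X * ((X + V) ^+ k - X ^+ k) + V * (X + V) ^+ k.
  by rewrite !exprS mulrDl mulrBr addrAC.
have HE i' j' : `|((X + V) ^+ k) i' j'| <= r ^+ k.
  elim: {IH P0} k i' j' => [|k IH] i' j'.
    rewrite expr0 mxE; case: (i' == j'); first by rewrite normr1.
    by rewrite normr0 ler01.
  by rewrite !exprS; apply: rowbound_mul => //; exact: exprn_ge0.
rewrite mxE; apply: (le_trans (ler_normD _ _)).
have A1 := rowbound_mul (mulr_ge0 s0 P0) HX IH i j.
have A2 := rowbound_mul (exprn_ge0 k r0) HV HE i j.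
apply: (le_trans (lerD A1 A2)); rewrite exprS.
have -> : s * (2 * r * (2 * r) ^+ k) = r * (s * (2 * r) ^+ k) + s * (r * (2 * r) ^+ k) by ring.
rewrite lerD2l; apply: ler_wpM2l => //.
by apply: (le_trans (ler_expX2 k)); rewrite ler_peMl.
Qed.

(** The remainder satisfies a recursion fed by the first differences. The constants 2 and 4 absorb
    the factors polynomial in [k], so that the bounds stay geometric, as [cvg_expsum] asks, and
    quadratic in [s]. *)
Lemma dpow_taylor k i j :
  `|((X + V) ^+ k - X ^+ k - dpow X V k) i j| <= s ^+ 2 * (4 * r) ^+ k.
Proof.
elim: k i j => [|k IH] i j /=.
  by rewrite !expr0 subrr subr0 mxE normr0 mulr_ge0 // ?exprn_ge0 // mulr_ge0.
have P0 : 0 <= (2 * r) ^+ k by rewrite exprn_ge0 // mulr_ge0.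
have P1 : 0 <= (4 * r) ^+ k by rewrite exprn_ge0 // mulr_ge0.
have -> : (X + V) ^+ k.+1 - X ^+ k.+1 - (X * dpow X V k + V * X ^+ k) =
   X * ((X + V) ^+ k - X ^+ k - dpow X V k) + V * ((X + V) ^+ k - X ^+ k).
  rewrite !exprS mulrDl !mulrBr.
  move: (X * _ ^+ k) (V * _ ^+ k) (X * X ^+ k) (V * X ^+ k) (X * dpow _ _ _).
  by move=> a b c d e; apply/matrixP => i' j'; rewrite !mxE; ring.
rewrite mxE; apply: (le_trans (ler_normD _ _)).
have A1 := rowbound_mul (mulr_ge0 (exprn_ge0 2 s0) P1) HX IH i j.
have A2 := rowbound_mul (mulr_ge0 s0 P0) HV (expmx_diff_bound k) i j.
apply: (le_trans (lerD A1 A2)); rewrite [(4 * r) ^+ k.+1]exprS.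
have le24 : (2 * r) ^+ k <= (4 * r) ^+ k.
  by apply: lerXn2r; rewrite ?nnegrE ?mulr_ge0 //; apply: ler_wpM2r; rewrite // ler_nat.
have -> : s ^+ 2 * (4 * r * (4 * r) ^+ k) =
   r * (s ^+ 2 * (4 * r) ^+ k) + s * (s * (3 * r * (4 * r) ^+ k)) by ring.
rewrite lerD2l; do 2 apply: ler_wpM2l => //.
apply: (le_trans le24); rewrite ler_peMl // mulr_ege1 // ler1n //.
Qed.

Lemma block_pow k : (block_mx X V 0 X : 'M[R]_(n + n)) ^+ k =
  block_mx (X ^+ k) (dpow X V k) 0 (X ^+ k).
Proof.
elim: k => [|k IH] /=; first by rewrite !expr0 -[1 in RHS]/(1%:M : 'M[R]_n) -scalar_mx_block.
rewrite exprS IH -[_ * _]/(_ *m _) mulmx_block !exprS.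
by rewrite mulmx0 addr0 mul0mx mulmx0 mul0mx addr0 add0r.
Qed.

End MatrixBounds.

Section MatrixExponential.
Variables (R : realType).

Lemma cvg_mx p q (u : nat -> 'M[R]_(p, q)) (L : 'M[R]_(p, q)) :
  (forall i j, (fun k => u k i j) @ \oo --> L i j) -> u @ \oo --> L.
Proof.
move=> H; apply/cvgrPdist_le => e e0; near=> k.
rewrite /Num.Def.normr/= mx_normrE (bigmax_le _ (ltW e0))//= => i _.
rewrite !mxE/=.
move: i; near: k; apply: filter_forall => /= i.
by have /cvgrPdist_le := H i.1 i.2; apply.
Unshelve. all: by end_near. Qed.

Lemma rowbound_exists n (X : 'M[R]_n) : exists2 r, 1 <= r & rowbound X r.
Proof.
exists (1 + n%:R * `|X|); first by rewrite lerDl mulr_ge0.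
by move=> i; apply: (le_trans (rowbound_norm X i)); rewrite lerDr.
Qed.

Lemma mexpE n (X : 'M[R]_n) i j : mexp X i j = expsum (fun k => (X ^+ k) i j).
Proof.
have [r r1 HX] := rowbound_exists X.
have r0 : 0 <= r by apply: le_trans r1.
rewrite /mexp; set L : 'M[R]_n := \matrix_(i, j) expsum (fun k => (X ^+ k) i j).
rewrite (_ : limn _ = L); first by rewrite mxE.
apply: cvg_lim => //; apply: cvg_mx => i' j'; rewrite mxE.
rewrite (_ : (fun k => _) = series (fun k => (k`!%:R)^-1 * (X ^+ k) i' j')).
  have H k : `|(X ^+ k) i' j'| <= 1 * r ^+ k by rewrite mul1r; apply: expmx_bound.
  by have [] := cvg_expsum r0 ler01 H.
by apply/funext => k; rewrite /series /= summxE; apply: eq_bigr => l _; rewrite mxE.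
Qed.

Lemma dpow_linear n (X : 'M[R]_n) k : linear (dpow X ^~ k).
Proof.
move=> a V W; elim: k => [|k IH] /=; first by rewrite scaler0 addr0.
by rewrite IH -![_ * _]/(_ *m _) mulmxDr mulmxDl -scalemxAr -scalemxAl scalerDr addrACA.
Qed.

(* The powers of [[X, V], [0, X]] carry the derivatives of the powers of [X] in
   their upper right block, so that the exponential is again an exponential after
   differentiation; smoothness follows by induction. *)
Lemma derive_mexp n (X V : 'M[R]_n) i j :
  differentiable (fun Y : 'M[R]_n => mexp Y i j) X /\
  'D_V (fun Y : 'M[R]_n => mexp Y i j) X =
    mexp (block_mx X V 0 X) (lshift n i) (rshift n j).
Proof.
have [r0 r01 HX0] := rowbound_exists X.
have r00 : 0 <= r0 by apply: le_trans r01.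
pose L V := expsum (fun k => (dpow X V k) i j).
have dE k W : `|(dpow X W k) i j| <= n%:R * `|W| * (2 * r0) ^+ k.
  by apply: dpow_bound => //; rewrite ?mulr_ge0 //; exact: rowbound_norm.
have Llin : linear L.
  move=> a V1 V2; rewrite /L.
  rewrite (_ : (fun k => _) = fun k => a * (dpow X V1 k) i j + (dpow X V2 k) i j); last first.
    by apply/funext => k; rewrite dpow_linear !mxE.
  apply: (expsum_lin a _ _ _ _ (fun k => dE k V1) (fun k => dE k V2)); rewrite ?mulr_ge0 //.
pose LM := GRing.isLinear.Build _ _ _ _ _ Llin.
pose LL : {linear 'M[R]_n -> R} := HB.pack L LM.
have cL : continuous LL.
  rewrite (_ : (LL : _ -> _) = fun V : 'M[R]_n => \sum_i \sum_j V i j * L (delta_mx i j)).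
    move=> V'.
    suff /(_ V' I) : Ck 0 setT (fun V : 'M[R]_n => \sum_i \sum_j V i j * L (delta_mx i j)) by [].
    apply: Ck_sum openT _ => i' _; apply: Ck_sum openT _ => j' _.
    by apply: Ck_M openT _ _; [exact: Ck_coord | exact: Ck_cst].
  apply/funext => V'; rewrite [in LHS](matrix_sum_delta V') linear_sum.
  apply: eq_bigr => i' _; rewrite linear_sum; apply: eq_bigr => j' _.
  by rewrite linearZ.
(* One row bound that holds for [X] and for all [X + h] with [h] of norm at most 1. *)
pose r := 1 + n%:R * (`|X| + 1).
have r1 : 1 <= r by rewrite lerDl mulr_ge0 ?addr_ge0.
have rr0 : 0 <= r by apply: le_trans r1.
have HX : rowbound X r.
  move=> k; apply: (le_trans (rowbound_norm X k)); rewrite /r.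
  by rewrite ler_wpDl // ler_wpM2l // lerDl.
have [] := @differentiable_intro _ _ _ (fun Y : 'M[R]_n => mexp Y i j) X LL cL.
  move=> e e0.
  (* The Taylor remainder is at most [K] times the squared norm of [h]; adding 1 makes [K] positive
     also for [n = 0]. *)
  pose K := n%:R ^+ 2 * expR (4 * r) + 1.
  have K0 : 0 < K by rewrite ltr_wpDl // mulr_ge0 // ?exprn_ge0 // expR_ge0.
  have n1 : \forall h \near (0 : 'M[R]_n), `|h| <= 1 by exact: (nbhs0_le ltr01).
  have n2 : \forall h \near (0 : 'M[R]_n), `|h| <= e / K by exact: (nbhs0_le (divr_gt0 e0 K0)).
  apply: filterS (filterI n1 n2) => h [h1 h2].
  have Hh := rowbound_norm h.
  have Hhh : rowbound (X + h) r.
    move=> k; apply: (le_trans (rowbound_norm _ k)); rewrite /r.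
    rewrite ler_wpDl // ler_wpM2l //; apply: (le_trans (ler_normD _ _)).
    by rewrite lerD2l.
  have nh0 : 0 <= n%:R * `|h| by rewrite mulr_ge0.
  have B k := dpow_taylor r1 nh0 HX Hh Hhh k i j.
  have r40 : 0 <= 4 * r by rewrite mulr_ge0.
  have [_ S] := cvg_expsum r40 (exprn_ge0 2 nh0) B.
  have E : mexp (h + X) i j - mexp X i j - L h =
      expsum (fun k => ((X + h) ^+ k - X ^+ k - dpow X h k) i j).
    have B1 k : `|((X + h) ^+ k) i j| <= 1 * r ^+ k by rewrite mul1r; apply: expmx_bound.
    have B2 k : `|(X ^+ k) i j| <= 1 * r ^+ k by rewrite mul1r; apply: expmx_bound.
    have E1 : expsum (fun k => ((X + h) ^+ k - X ^+ k) i j) = mexp (h + X) i j - mexp X i j.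
      rewrite !mexpE [h + X]addrC.
      have := expsum_lin (-1) rr0 ler01 rr0 ler01 B2 B1.
      rewrite mulN1r [- _ + _]addrC => <-; congr expsum; apply/funext => k.
      by rewrite !mxE mulN1r [RHS]addrC.
    have B3 k : `|((X + h) ^+ k - X ^+ k) i j| <= n%:R * `|h| * (2 * r) ^+ k.
      exact: expmx_diff_bound.
    have r20 : 0 <= 2 * r by rewrite mulr_ge0.
    have r200 : 0 <= 2 * r0 by rewrite mulr_ge0.
    have := expsum_lin (-1) r200 nh0 r20 nh0 (fun k => dE k h) B3.
    rewrite E1 mulN1r [- _ + _]addrC => <-; congr expsum; apply/funext => k.
    by rewrite mulN1r [LHS]addrC !mxE.
  rewrite [LL h]/(L h) E; apply: (le_trans S).
  rewrite exprMn -mulrA [`|h| ^+ 2 * _]mulrC mulrA expr2 mulrA.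
  apply: ler_wpM2r => //.
  apply: (@le_trans _ _ (K * `|h|)); last by rewrite mulrC -ler_pdivlMr.
  by apply: ler_wpM2r => //; rewrite /K lerDl.
move=> dF dE'; split=> //; rewrite deriveE // dE' [LHS]/(L V) /L mexpE.
congr expsum; apply/funext => k.
by rewrite block_pow block_mxEur.
Qed.

Lemma Ck_mexp k n (i j : 'I_n) : Ck k setT (fun X : 'M[R]_n => mexp X i j).
Proof.
elim: k n i j => [|k IH] n i j.
  move=> x _; have [dm _] := derive_mexp x 0 i j; exact: differentiable_continuous.
split=> [x _|V]; first by have [] := derive_mexp x 0 i j.
have := @Ck_comp R (n + n) n k setT setT (fun X => block_mx X V 0 X) _ openT (fun _ _ => I) _ (IH _ (lshift n i) (rshift n j)).
rewrite (_ : _ \o _ = 'D_V (fun X : 'M[R]_n => mexp X i j)); last first.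
  by apply/funext => x; have [_ ->] := derive_mexp x V i j.
apply => i' j'.
have [i1 ->|i1 ->] := split_ordP i'; have [j1 ->|j1 ->] := split_ordP j'.
- apply: (Ck_ext openT _ (Ck_coord k setT i1 j1)) => x _; by rewrite block_mxEul.
- apply: (Ck_ext openT _ (Ck_cst k setT (V i1 j1))) => x _; by rewrite block_mxEur.
- apply: (Ck_ext openT _ (Ck_cst k setT 0)) => x _; by rewrite block_mxEdl mxE.
- apply: (Ck_ext openT _ (Ck_coord k setT i1 j1)) => x _; by rewrite block_mxEdr.
Qed.

Lemma derive_mexp0 n (V : 'M[R]_n) i j :
  'D_V (fun Y : 'M[R]_n => mexp Y i j) 0 = V i j.
Proof.
have [_ ->] := derive_mexp 0 V i j; rewrite mexpE /expsum.
rewrite (_ : series _ = fun k => (if (1 < k)%N then V i j else 0)); last first.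
  apply/funext => k; rewrite /series /=; elim: k => [|k IH].
    by rewrite big_geq.
  rewrite big_nat_recr //= IH block_pow block_mxEur.
  case: k {IH} => [|[|k]] /=.
  - by rewrite mxE mulr0 addr0.
  - by rewrite mul0r add0r expr0 mulr1 (_ : (1`!%:R : R)^-1 = 1) ?invr1 // mul1r add0r.
  - by rewrite mul0r add0r exprS mul0r mulr0 mxE mulr0 addr0.
apply: cvg_lim => //.
apply: cvg_near_cst; exists 2%N => // k /= hk.
by rewrite hk.
Qed.

Lemma mexp0 n : mexp (0 : 'M[R]_n) = 1%:M.
Proof.
apply/matrixP => i j; rewrite mexpE /expsum.
rewrite (_ : series _ = fun k => (if (0 < k)%N then (1%:M : 'M[R]_n) i j else 0)); last first.
  apply/funext => k; rewrite /series /=; elim: k => [|k IH].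
    by rewrite big_geq.
  rewrite big_nat_recr //= IH.
  case: k {IH} => [|k] /=; first by rewrite expr0 fact0 invr1 mul1r add0r.
  by rewrite exprS mul0r [(0 : 'M[R]_n) i j]mxE mulr0 addr0.
apply: cvg_lim => //.
apply: cvg_near_cst; exists 1%N => // k /= hk.
by rewrite hk.
Qed.

Lemma mexp_conj n (k l X : 'M[R]_n) : l *m k = 1%:M ->
  mexp (k *m X *m l) = k *m mexp X *m l.
Proof.
move=> lk.
have Ek m : (k *m X *m l) ^+ m = k *m X ^+ m *m l.
  elim: m => [|m IH]; first by rewrite !expr0 mulmx1; apply/esym; exact: mulmx1C.
  rewrite !exprS IH -![_ * _]/(_ *m _) !mulmxA.
  by rewrite -(mulmxA (k *m X) l k) lk mulmx1.
have [r r1 HX] := rowbound_exists X.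
have r0 : 0 <= r by apply: le_trans r1.
apply/matrixP => i j; rewrite mexpE.
have cE i1 j1 : expsum (fun m => (X ^+ m) i1 j1) = mexp X i1 j1 by rewrite mexpE.
have Hb i1 j1 m : `|(X ^+ m) i1 j1| <= 1 * r ^+ m by rewrite mul1r; apply: expmx_bound.
(* An entry of the conjugate is a finite combination of entries of [X ^+ m]. The geometric bound is
   carried through the induction because [expsum_lin] needs it. *)
have sumE (T : Type) (s : seq T) (c : T -> R) (f g : T -> 'I_n) :
    (exists2 C, 0 <= C & forall m, `|\sum_(t <- s) c t * (X ^+ m) (f t) (g t)| <= C * r ^+ m) /\
    expsum (fun m => \sum_(t <- s) c t * (X ^+ m) (f t) (g t)) =
    \sum_(t <- s) c t * mexp X (f t) (g t).
  elim: s => [|t s [[C C0 HC] IH]].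
    split.
      by exists 0 => // m; rewrite big_nil normr0 mul0r.
    have Z m : `|(0 : R)| <= 0 * r ^+ m by rewrite normr0 mul0r.
    have [_] := cvg_expsum r0 (lexx 0) Z.
    rewrite mul0r normr_le0 => /eqP H0; rewrite big_nil.
    by under eq_fun do rewrite big_nil.
  split.
    exists (`|c t| + C) => [|m]; first exact: addr_ge0.
    rewrite big_cons; apply: (le_trans (ler_normD _ _)); rewrite mulrDl lerD //.
    by rewrite normrM; apply: ler_wpM2l => //; rewrite -[leRHS]mul1r.
  under eq_fun do rewrite big_cons.
  rewrite (expsum_lin (c t) r0 ler01 r0 C0 (Hb _ _) HC) IH cE.
  by rewrite big_cons.
have [_ S] := sumE _ (index_enum ('I_n * 'I_n)%type) (fun p => k i p.1 * l p.2 j) fst snd.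
have E (Y : 'M[R]_n) : (k *m Y *m l) i j = \sum_p k i p.1 * l p.2 j * Y p.1 p.2.
  rewrite -(pair_big xpredT xpredT (fun p q => k i p * l q j * Y p q)) /=.
  rewrite exchange_big /= mxE; apply: eq_bigr => q _; rewrite mxE mulr_suml.
  by apply: eq_bigr => p _; rewrite mulrAC.
rewrite E -S; congr expsum; apply/funext => m.
by rewrite Ek E.
Qed.

Lemma mexp_diag n (d : 'rV[R]_n) : mexp (diag_mx d) = diag_mx (map_mx expR d).
Proof.
have E m : (diag_mx d) ^+ m = diag_mx (map_mx (fun x => x ^+ m) d).
  elim: m => [|m IH].
    by apply/matrixP => i j; rewrite expr0 !mxE expr0.
  rewrite exprS IH -[_ * _]/(_ *m _) mulmx_diag; congr (diag_mx _).
  by apply/matrixP => i j; rewrite (ord1 i) !mxE exprS.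
apply/matrixP => i j; rewrite mexpE.
under eq_fun do rewrite E !mxE.
rewrite !mxE; case: (i == j); rewrite ?mulr1n ?mulr0n /expsum /expR.
  congr (limn (series _)); apply/funext => m; rewrite /exp_coeff /=.
  by rewrite mulr1n mulrC.
rewrite (_ : series _ = cst 0); first exact: lim_cst.
apply/funext => k; rewrite /series /=; apply: big1 => l _; by rewrite mulr0n mulr0.
Qed.

End MatrixExponential.

(** * Left-invariant differential operators *)

Section PointwiseDerivatives.
Variables (R : realType) (V : normedModType R).
Implicit Types (F G : V -> R) (x v : V).

Lemma derive_mul v F G x : differentiable F x -> differentiable G x ->
  differentiable (fun y => F y * G y) x /\
  'D_v (fun y => F y * G y) x = 'D_v F x * G x + F x * 'D_v G x.
Proof.
move=> dF dG; split; first exact: differentiableM.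
rewrite -[LHS]/('D_v (F * G) x) deriveM; last 2 first.
  exact: diff_derivable.
  exact: diff_derivable.
by rewrite addrC; congr (_ + _); rewrite [LHS]mulrC.
Qed.

Lemma derive_add v F G x : differentiable F x -> differentiable G x ->
  'D_v (fun y => F y + G y) x = 'D_v F x + 'D_v G x.
Proof.
by move=> dF dG; rewrite -[LHS]/('D_v (F + G) x) deriveD //; exact: diff_derivable.
Qed.

Lemma derive_sub v F G x : differentiable F x -> differentiable G x ->
  'D_v (fun y => F y - G y) x = 'D_v F x - 'D_v G x.
Proof.
by move=> dF dG; rewrite -[LHS]/('D_v (F - G) x) deriveB //; exact: diff_derivable.
Qed.

End PointwiseDerivatives.

Section ComplexCalculus.
Variables (R : realType) (n : nat).
Local Notation M := 'M[R]_n.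
Implicit Types (U : set M) (f g h : M -> R[i]) (v w x : M).

Definition csmooth U h : Prop :=
  (forall k, Ck k U (fun x => complex.Re (h x))) /\
  (forall k, Ck k U (fun x => complex.Im (h x))).

Lemma csmooth_ext U f g : open U -> (forall x, U x -> f x = g x) -> csmooth U f -> csmooth U g.
Proof.
move=> oU fg [Hr Hi]; split=> k.
  by apply: (Ck_ext oU _ (Hr k)) => x /fg ->.
by apply: (Ck_ext oU _ (Hi k)) => x /fg ->.
Qed.

Lemma csmooth_sub U U' h : U' `<=` U -> csmooth U h -> csmooth U' h.
Proof. by move=> sU [Hr Hi]; split=> k; apply: Ck_sub sU _. Qed.

Lemma csmooth_real U (a : M -> R) : (forall k, Ck k U a) -> csmooth U (fun x => (a x)%:C).
Proof. by move=> Ha; split=> k; [apply: Ha | apply: Ck_cst]. Qed.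

Lemma csmooth_cst U (c : R[i]) : csmooth U (fun=> c).
Proof. by split=> k; apply: Ck_cst. Qed.

Lemma csmoothD U f g : open U -> csmooth U f -> csmooth U g -> csmooth U (fun x => f x + g x).
Proof.
move=> oU [fr fi] [gr gi]; split=> k.
  apply: (Ck_ext oU _ (Ck_D oU (fr k) (gr k))) => x _.
  by case: (f x) (g x) => a b [c d].
apply: (Ck_ext oU _ (Ck_D oU (fi k) (gi k))) => x _.
by case: (f x) (g x) => a b [c d].
Qed.

Lemma csmoothM U f g : open U -> csmooth U f -> csmooth U g -> csmooth U (fun x => f x * g x).
Proof.
move=> oU [fr fi] [gr gi]; split=> k.
  apply: (Ck_ext oU _ (Ck_D oU (Ck_M oU (fr k) (gr k))
      (Ck_M oU (Ck_cst k U (-1)) (Ck_M oU (fi k) (gi k))))) => x _.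
  by case: (f x) (g x) => a b [c d] /=; rewrite mulN1r.
apply: (Ck_ext oU _ (Ck_D oU (Ck_M oU (fr k) (gi k)) (Ck_M oU (fi k) (gr k)))) => x _.
by case: (f x) (g x) => a b [c d] /=.
Qed.

Lemma csmooth_sum U (I : Type) (r : seq I) (F : I -> M -> R[i]) : open U ->
  (forall i, csmooth U (F i)) -> csmooth U (fun x => \sum_(i <- r) F i x).
Proof.
move=> oU HF; elim: r => [|i r IH].
  by apply: (csmooth_ext oU _ (csmooth_cst U 0)) => x _; rewrite big_nil.
by apply: (csmooth_ext oU _ (csmoothD oU (HF i) IH)) => x _; rewrite big_cons.
Qed.

Lemma csmoothX U f m : open U -> csmooth U f -> csmooth U (fun x => f x ^+ m).
Proof.
move=> oU Hf; elim: m => [|m IH]; first exact: csmooth_cst.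
by apply: (csmooth_ext oU _ (csmoothM oU Hf IH)) => x _; rewrite exprS.
Qed.

Lemma csmooth_cderive U v h : csmooth U h -> csmooth U (cderive v h).
Proof. by move=> [Hr Hi]; split=> k; [have [_ /(_ v)] := Hr k.+1 | have [_ /(_ v)] := Hi k.+1]. Qed.

Section AtPoint.
Variables (U : set M) (x : M).
Hypotheses (oU : open U) (Ux : U x).

Lemma cderive_ext v f g : (forall y, U y -> f y = g y) -> cderive v f x = cderive v g x.
Proof.
move=> fg; rewrite /cderive; congr (_ +i* _); apply: near_eq_derive.
  by apply: filterS (open_nbhs_nbhs (conj oU Ux)) => y /fg ->.
by apply: filterS (open_nbhs_nbhs (conj oU Ux)) => y /fg ->.
Qed.

Lemma csmooth_diff h : csmooth U h ->
  differentiable (fun x => complex.Re (h x)) x /\ differentiable (fun x => complex.Im (h x)) x.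
Proof. by move=> [Hr Hi]; split; [apply: Ck_diff (Hr 1%N) Ux | apply: Ck_diff (Hi 1%N) Ux]. Qed.

Lemma cderive_cst v (c : R[i]) : cderive v (fun=> c) x = 0.
Proof. by rewrite /cderive !derive_cst. Qed.

Lemma cderiveD v f g : csmooth U f -> csmooth U g ->
  cderive v (fun y => f y + g y) x = cderive v f x + cderive v g x.
Proof.
move=> /csmooth_diff [fr fi] /csmooth_diff [gr gi]; rewrite /cderive.
have -> : (fun y => complex.Re (f y + g y)) = (fun y => complex.Re (f y) + complex.Re (g y)).
  by apply/funext => y; case: (f y) (g y) => a b [c d].
have -> : (fun y => complex.Im (f y + g y)) = (fun y => complex.Im (f y) + complex.Im (g y)).
  by apply/funext => y; case: (f y) (g y) => a b [c d].
by rewrite !derive_add.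
Qed.

Lemma cderiveM v f g : csmooth U f -> csmooth U g ->
  cderive v (fun y => f y * g y) x = cderive v f x * g x + f x * cderive v g x.
Proof.
move=> /csmooth_diff [fr fi] /csmooth_diff [gr gi]; rewrite /cderive.
have [rr rrE] := derive_mul v fr gr; have [ii iiE] := derive_mul v fi gi.
have [ri riE] := derive_mul v fr gi; have [ir irE] := derive_mul v fi gr.
have -> : (fun y => complex.Re (f y * g y)) =
    (fun y => complex.Re (f y) * complex.Re (g y) - complex.Im (f y) * complex.Im (g y)).
  by apply/funext => y; case: (f y) (g y) => a b [c d].
have -> : (fun y => complex.Im (f y * g y)) =
    (fun y => complex.Re (f y) * complex.Im (g y) + complex.Im (f y) * complex.Re (g y)).
  by apply/funext => y; case: (f y) (g y) => a b [c d].
rewrite derive_sub // derive_add // rrE iiE riE irE.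
move: ('D_v _ x) ('D_v _ x) ('D_v _ x) ('D_v _ x) (f x) (g x) => a b c d [e1 e2] [f1 f2].
by apply/eqP; rewrite eq_complex /=; apply/andP; split; apply/eqP; ring.
Qed.

Lemma cderiveZ v (c : R[i]) g : csmooth U g ->
  cderive v (fun y => c * g y) x = c * cderive v g x.
Proof.
by move=> Hg; rewrite cderiveM ?cderive_cst ?mul0r ?add0r //; exact: csmooth_cst.
Qed.

Lemma cderive_sum v (I : Type) (r : seq I) (F : I -> M -> R[i]) :
  (forall i, csmooth U (F i)) ->
  cderive v (fun y => \sum_(i <- r) F i y) x = \sum_(i <- r) cderive v (F i) x.
Proof.
move=> HF; elim: r => [|i r IH].
  rewrite [RHS]big_nil -[RHS](cderive_cst v 0).
  by apply: cderive_ext => y _; rewrite big_nil.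
rewrite big_cons -IH -cderiveD //; last exact: csmooth_sum.
by apply: cderive_ext => y _; rewrite big_cons.
Qed.

Lemma cderive_coord v h : csmooth U h ->
  cderive v h x = \sum_(k : 'I_n * 'I_n) (v k.1 k.2)%:C * cderive (delta_mx k.1 k.2) h x.
Proof.
move=> /csmooth_diff [hr hi]; rewrite {1}/cderive !derive_linear_coord //.
rewrite !pair_big /=.
elim/big_rec3: _ => // k a b c _ <-.
by apply/eqP; rewrite eq_complex /= !mul0r subr0 addr0 !eqxx.
Qed.

Lemma cderive_linear (I : Type) (r : seq I) (a : I -> R) (v : I -> M) h : csmooth U h ->
  cderive (\sum_(i <- r) a i *: v i) h x = \sum_(i <- r) (a i)%:C * cderive (v i) h x.
Proof.
move=> Hh; rewrite cderive_coord //.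
under [RHS]eq_bigr do rewrite (cderive_coord _ Hh) mulr_sumr.
rewrite exchange_big /=; apply: eq_bigr => k _.
rewrite summxE rmorph_sum mulr_suml; apply: eq_bigr => i _ /=.
by rewrite mxE rmorphM mulrA.
Qed.

Lemma cderive_swap v w h : csmooth U h ->
  cderive w (cderive v h) x = cderive v (cderive w h) x.
Proof.
move=> [Hr Hi].
exact: (congr2 (@Complex R) (Ck_swap v w oU Ux (Hr 2)) (Ck_swap v w oU Ux (Hi 2))).
Qed.

End AtPoint.

Lemma cderive_line x v x' v' f g :
  (\forall t \near (0 : R), f (t *: v + x) = g (t *: v' + x')) ->
  cderive v f x = cderive v' g x'.
Proof.
move=> fg; have fg0 : f x = g x' by have := nbhs_singleton fg; rewrite !scale0r !add0r.
rewrite /cderive /derive; congr (_ +i* _); congr (lim _).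
  rewrite eqEsubset; split; apply: near_eq_cvg; apply: cvg_within;
  by apply: filterS fg => t /= E; rewrite E fg0.
rewrite eqEsubset; split; apply: near_eq_cvg; apply: cvg_within;
by apply: filterS fg => t /= E; rewrite E fg0.
Qed.

End ComplexCalculus.

Section ComplexChain.
Variables (R : realType) (n : nat).
Local Notation M := 'M[R]_n.

Lemma csmooth_comp (U U' : set M) (phi : M -> M) (h : M -> R[i]) :
  open U -> (forall x, U x -> U' (phi x)) ->
  (forall k i j, Ck k U (fun y => phi y i j)) -> csmooth U' h -> csmooth U (h \o phi).
Proof.
move=> oU UU' Hphi [Hr Hi]; split=> k.
  exact: (Ck_comp oU UU' (Hphi k) (Hr k)).
exact: (Ck_comp oU UU' (Hphi k) (Hi k)).
Qed.

Lemma cderive_comp (U U' : set M) (phi : M -> M) (h : M -> R[i]) x v :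
  (forall i j, Ck 1 U (fun y => phi y i j)) -> csmooth U' h -> U x -> U' (phi x) ->
  cderive v (h \o phi) x = cderive ('D_v phi x) h (phi x).
Proof.
move=> Hphi Hh Ux U'x; have [hr hi] := csmooth_diff U'x Hh.
have dphi i j : differentiable (fun y => phi y i j) x by apply: Ck_diff (Hphi i j) Ux.
rewrite /cderive; congr (_ +i* _).
  by have [_] := derive_comp_mx v dphi hr.
by have [_] := derive_comp_mx v dphi hi.
Qed.

End ComplexChain.

Lemma derive_scalar_linear (R : realType) (V : normedModType R) (L : V -> R) v x :
  (forall (a : R) u w, L (a *: u + w) = a * L u + L w) -> 'D_v L x = L v.
Proof.
move=> HL; rewrite /derive; apply: cvg_lim => //.
apply: cvg_near_cst; near=> t.
have t0 : t != 0 by near: t; exact: nbhs_dnbhs_neq.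
by rewrite /= HL addrK -[_ *: _]/(_ * _) mulKf.
Unshelve. all: by end_near. Qed.

Section LeftInvariantFields.
Variables (R : realType) (n : nat).
Local Notation M := 'M[R]_n.
Implicit Types (h f g : M -> R[i]) (A B x : M) (w : seq M).

Definition detpos : set M := [set x | 0 < \det x].

Lemma Ck_det k (U : set M) p (phi : M -> 'M[R]_p) : open U ->
  (forall i j, Ck k U (fun x => phi x i j)) -> Ck k U (fun x => \det (phi x)).
Proof.
move=> oU H; apply: Ck_sum => // s _; apply: Ck_M => //; first exact: Ck_cst.
by apply: Ck_prod => // i _; apply: H.
Qed.

Lemma open_detpos : open detpos.
Proof.
apply: (@open_comp _ _ (fun x : M => \det x) [set r | 0 < r]); last exact: open_gt.
move=> x _; have := @Ck_det 0 setT n id openT (fun i j => Ck_coord 0 setT i j).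
by move=> /(_ x I).
Qed.
Local Notation oO := open_detpos.

Lemma detpos_unit x : detpos x -> x \in unitmx.
Proof. by move=> Dx; rewrite unitmxE unitfE gt_eqF. Qed.

Lemma detposM x y : detpos x -> detpos y -> detpos (x *m y).
Proof. by rewrite /detpos /= det_mulmx => ? ?; apply: mulr_gt0. Qed.

Lemma near_line (U : set M) v x : open U -> U x -> \forall t \near (0 : R), U (t *: v + x).
Proof.
move=> oU Ux.
have C : (fun t : R => t *: v + x) @ (0 : R) --> x.
  rewrite -[X in _ --> X](_ : 0 *: v + x = x); last by rewrite scale0r add0r.
  by apply: cvgD; [apply: cvgZr_tmp; exact: cvg_id | exact: cvg_cst].
exact: (C U (open_nbhs_nbhs (conj oU Ux))).
Qed.

Definition lder A h : M -> R[i] := fun x => cderive (x *m A) h x.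
(** The head of [w] is the outermost derivation; the last letter is the one that acts on [h]
    directly. *)
Definition wder w h : M -> R[i] := foldr lder h w.

Lemma wder_cat w1 w2 h : wder (w1 ++ w2) h = wder w1 (wder w2 h).
Proof. by rewrite /wder foldr_cat. Qed.

Lemma lder_ext A f g x : (forall y, detpos y -> f y = g y) -> detpos x ->
  lder A f x = lder A g x.
Proof. by move=> fg Dx; apply: cderive_ext oO Dx _ _ _ fg. Qed.

Lemma wder_ext w f g x : (forall y, detpos y -> f y = g y) -> detpos x ->
  wder w f x = wder w g x.
Proof. by move=> fg; elim: w x => [|A w IH] x Dx /=; [exact: fg | exact: lder_ext]. Qed.

Lemma lderE A h x : csmooth detpos h -> detpos x -> lder A h x =
  \sum_(k : 'I_n * 'I_n) ((x *m A) k.1 k.2)%:C * cderive (delta_mx k.1 k.2) h x.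
Proof. by move=> Hh Dx; apply: cderive_coord Dx _ _ Hh. Qed.

Lemma Ck_mulmxr k (U : set M) A i j : open U -> Ck k U (fun x => (x *m A) i j).
Proof.
move=> oU; have H : Ck k U (fun x => \sum_l x i l * A l j).
  by apply: Ck_sum => // l _; apply: Ck_M => //; [exact: Ck_coord | exact: Ck_cst].
by apply: (Ck_ext oU _ H) => x _; rewrite mxE.
Qed.

Lemma Ck_mulmxl k (U : set M) A i j : open U -> Ck k U (fun x => (A *m x) i j).
Proof.
move=> oU; have H : Ck k U (fun x => \sum_l A i l * x l j).
  by apply: Ck_sum => // l _; apply: Ck_M => //; [exact: Ck_cst | exact: Ck_coord].
by apply: (Ck_ext oU _ H) => x _; rewrite mxE.
Qed.

Lemma csmooth_lder A h : csmooth detpos h -> csmooth detpos (lder A h).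
Proof.
move=> Hh; apply: (csmooth_ext oO (fun x Dx => esym (lderE A Hh Dx))).
apply: csmooth_sum oO _ => k; apply: csmoothM oO _ _; last exact: csmooth_cderive.
by apply: csmooth_real => m; apply: Ck_mulmxr oO.
Qed.

Lemma csmooth_wder w h : csmooth detpos h -> csmooth detpos (wder w h).
Proof. by move=> Hh; elim: w => [|A w IH] //=; apply: csmooth_lder. Qed.

Lemma lder_sum A (I : Type) (r : seq I) (c : I -> R[i]) (F : I -> M -> R[i]) x :
  (forall i, csmooth detpos (F i)) -> detpos x ->
  lder A (fun y => \sum_(i <- r) c i * F i y) x = \sum_(i <- r) c i * lder A (F i) x.
Proof.
move=> HF Dx; rewrite /lder (cderive_sum oO Dx).
  by apply: eq_bigr => i _; apply: cderiveZ Dx _ _ _ (HF i).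
by move=> i; apply: csmoothM oO _ _ => //; exact: csmooth_cst.
Qed.

Lemma wder_sum w (I : Type) (r : seq I) (c : I -> R[i]) (F : I -> M -> R[i]) x :
  (forall i, csmooth detpos (F i)) -> detpos x ->
  wder w (fun y => \sum_(i <- r) c i * F i y) x = \sum_(i <- r) c i * wder w (F i) x.
Proof.
move=> HF; elim: w x => [|A w IH] x Dx //=.
rewrite (lder_ext A IH Dx) lder_sum // => i; exact: csmooth_wder.
Qed.

Lemma wder0 w x : detpos x -> wder w (fun=> 0) x = 0.
Proof.
move=> Dx; have := @wder_sum w unit [::] (fun=> 0) (fun _ _ => 0) x (fun=> csmooth_cst _ _) Dx.
rewrite [RHS]big_nil => E; rewrite -[RHS]E.
by apply: wder_ext => // y _; rewrite big_nil.
Qed.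

Lemma lder_linear (I : Type) (r : seq I) (a : I -> R) (v : I -> M) h x :
  csmooth detpos h -> detpos x ->
  lder (\sum_(i <- r) a i *: v i) h x = \sum_(i <- r) (a i)%:C * lder (v i) h x.
Proof.
move=> Hh Dx; rewrite /lder mulmx_sumr.
under [X in cderive X]eq_bigr do rewrite -scalemxAr.
exact: (cderive_linear Dx _ _ _ Hh).
Qed.

Lemma wder_linear w1 w2 (I : Type) (r : seq I) (a : I -> R) (v : I -> M) h x :
  csmooth detpos h -> detpos x ->
  wder (w1 ++ (\sum_(i <- r) a i *: v i) :: w2) h x =
  \sum_(i <- r) (a i)%:C * wder (w1 ++ v i :: w2) h x.
Proof.
move=> Hh Dx; rewrite wder_cat /=.
have H2 := csmooth_wder w2 Hh.
rewrite (wder_ext w1 (fun y Dy => lder_linear r a v H2 Dy) Dx).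
rewrite wder_sum // => [|i]; last exact: csmooth_lder.
by apply: eq_bigr => i _; rewrite wder_cat.
Qed.

Lemma cderive_mulmxr v A x i j : cderive v (fun y : M => ((y *m A) i j)%:C) x = ((v *m A) i j)%:C.
Proof.
rewrite /cderive /= derive_cst; congr (_ +i* _).
apply: (derive_scalar_linear (L := fun y : M => (y *m A) i j)) => a u w.
by rewrite mulmxDl -scalemxAl !mxE.
Qed.

(** Both compositions split into a second-order part, the same for both orders by symmetry of second
    derivatives, and a first-order part that comes from differentiating the coefficient linear in
    [x]. The first-order parts differ by the bracket. *)
Lemma lder_comm A B h x : csmooth detpos h -> detpos x ->
  lder A (lder B h) x = lder B (lder A h) x + lder (A *m B - B *m A) h x.
Proof.
move=> Hh Dx.
pose S C D := \sum_(k : 'I_n * 'I_n) \sum_(l : 'I_n * 'I_n)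
      ((x *m D) k.1 k.2)%:C * ((x *m C) l.1 l.2)%:C *
      cderive (delta_mx l.1 l.2) (cderive (delta_mx k.1 k.2) h) x.
have E C D : lder C (lder D h) x = lder (C *m D) h x + S C D.
  rewrite (lder_ext C (fun y Dy => lderE D Hh Dy) Dx) /lder (cderive_sum oO Dx); last first.
    move=> k; apply: csmoothM oO _ _; last exact: csmooth_cderive.
    by apply: csmooth_real => m; apply: Ck_mulmxr oO.
  rewrite mulmxA (cderive_coord Dx (x *m C *m D) Hh) -big_split; apply: eq_bigr => k _ /=.
  rewrite (cderiveM Dx); last exact: csmooth_cderive; last first.
    by apply: csmooth_real => m; apply: Ck_mulmxr oO.
  rewrite cderive_mulmxr (cderive_coord Dx (x *m C)); last exact: csmooth_cderive.
  by congr (_ + _); rewrite mulr_sumr; apply: eq_bigr => l _; rewrite mulrA.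
have EL : lder (A *m B) h x = lder (B *m A) h x + lder (A *m B - B *m A) h x.
  have := lder_linear (index_enum bool) (fun=> 1) (fun b => if b then B *m A else A *m B - B *m A) Hh Dx.
  rewrite !big_bool /= !scale1r [in lder _ _ _]addrC subrK => ->.
  by rewrite !mul1r.
have SS : S A B = S B A.
  rewrite /S exchange_big; apply: eq_bigr => k _; apply: eq_bigr => l _ /=.
  by rewrite (cderive_swap oO Dx _ _ Hh) (mulrC ((x *m B) _ _)%:C).
rewrite (E A B) (E B A) EL SS; exact: addrAC.
Qed.

Lemma wder_swap w1 A B w2 h x : csmooth detpos h -> detpos x ->
  wder (w1 ++ A :: B :: w2) h x =
  wder (w1 ++ B :: A :: w2) h x + wder (w1 ++ (A *m B - B *m A) :: w2) h x.
Proof.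
move=> Hh Dx; rewrite !wder_cat.
change (wder w1 (lder A (lder B (wder w2 h))) x =
  wder w1 (lder B (lder A (wder w2 h))) x + wder w1 (lder (A *m B - B *m A) (wder w2 h)) x).
move: (wder w2 h) (csmooth_wder w2 Hh) => g Hg.
pose F (b : bool) := if b then lder B (lder A g) else lder (A *m B - B *m A) g.
have HF b : csmooth detpos (F b) by case: b; do !apply: csmooth_lder.
transitivity (wder w1 (fun y => \sum_(b : bool) 1 * F b y) x).
  by apply: wder_ext => // y Dy; rewrite big_bool !mul1r; apply: lder_comm.
by rewrite wder_sum // big_bool !mul1r.
Qed.

Lemma wder_left (k : M) w h x : csmooth detpos h -> detpos k -> detpos x ->
  wder w (fun y => h (k *m y)) x = wder w h (k *m x).
Proof.
move=> Hh Dk; elim: w x => [|A w IH] x Dx //=.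
rewrite (lder_ext A IH Dx) /lder.
have Ek v y : 'D_v (fun z : M => k *m z) y = k *m v.
  apply/matrixP => i j; rewrite derive_mxE.
    apply: (derive_scalar_linear (L := fun z : M => (k *m z) i j)) => a u u'.
    by rewrite mulmxDr -scalemxAr !mxE.
  apply: differentiable_mx => i' j'.
  by apply: Ck_diff (Ck_mulmxl 1 k i' j' openT) _.
have := @cderive_comp R n detpos detpos (fun z => k *m z) (wder w h) x (x *m A).
rewrite Ek mulmxA => <- //; first by move=> i j; apply: Ck_mulmxl oO.
- exact: csmooth_wder.
- exact: detposM.
Qed.

(** Right translation conjugates the letters; this is the origin of the action of SO_n on
    symbols. *)
Lemma wder_right (k : M) w h x : csmooth detpos h -> detpos k -> detpos x ->
  wder w (fun y => h (y *m k)) x = wder [seq invmx k *m A *m k | A <- w] h (x *m k).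
Proof.
move=> Hh Dk; elim: w x => [|A w IH] x Dx //=.
rewrite (lder_ext A IH Dx) /lder.
have Ek v y : 'D_v (fun z : M => z *m k) y = v *m k.
  apply/matrixP => i j; rewrite derive_mxE.
    apply: (derive_scalar_linear (L := fun z : M => (z *m k) i j)) => a u u'.
    by rewrite mulmxDl -scalemxAl !mxE.
  apply: differentiable_mx => i' j'.
  by apply: Ck_diff (Ck_mulmxr 1 k i' j' openT) _.
set w' := [seq _ | _ <- w].
have := @cderive_comp R n detpos detpos (fun z => z *m k) (wder w' h) x (x *m A).
rewrite Ek !mulmxA (mulmxK (detpos_unit Dk)) => <- //.
- by move=> i j; apply: Ck_mulmxr oO.
- exact: csmooth_wder.
- exact: detposM.
Qed.

End LeftInvariantFields.
Arguments detpos {R n}.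

(** * Spherical functions and symbols *)

Section InvariantFunctions.
Variables (R : realType) (n : nat).
Local Notation M := 'M[R]_n.+1.
Local Notation N := n.+1.
Implicit Types (h : M -> R[i]) (A B x y k : M) (w : seq M).
Local Notation oO := (@open_detpos R n.+1).

(* Smooth functions of [x x^T] up to positive scalars: these are the lifts of
   the smooth functions on SL_n / SO_n to the group of matrices with [det > 0]. *)
Definition spherical h : Prop := csmooth detpos h /\
  forall x y (c : R), detpos x -> detpos y -> 0 < c ->
    x *m x^T = c *: (y *m y^T) -> h x = h y.

(** Skew matrices plus scalars: the directions tangent to the fibres of [x |-> x *m x^T] taken up to
    positive factors. *)
Definition vertical A : Prop := exists s : R, A + A^T = s%:M.

(** The orthogonal projection onto [ssym] for the trace form; its kernel consists of the vertical
    matrices. *)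
Definition sympart A : M := 2^-1 *: (A + A^T) - (N%:R^-1 * \tr A)%:M.

Lemma sympart_linear : linear sympart.
Proof.
move=> a A B; rewrite /sympart; apply/matrixP => i j.
by rewrite mxtraceD mxtraceZ !mxE; case: (i == j); rewrite ?mulr1n ?mulr0n; ring.
Qed.
HB.instance Definition _ := GRing.isLinear.Build R M M _ sympart sympart_linear.

Lemma trace_scalar (s : R) : \tr (s%:M : M) = N%:R * s.
Proof. by rewrite mxtrace_scalar mulr_natl. Qed.

Lemma ssym_sympart A : ssym (sympart A).
Proof.
split.
  by apply/matrixP => i j; rewrite !mxE [A j i + _]addrC [j == i]eq_sym.
rewrite /sympart raddfB /= mxtraceZ mxtraceD mxtrace_tr trace_scalar mulrA divff ?pnatr_eq0 //.
by rewrite mul1r; field.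
Qed.

Lemma sympart_id A : ssym A -> sympart A = A.
Proof.
move=> [As At]; rewrite /sympart As At mulr0 raddf0 subr0.
by apply/matrixP => i j; rewrite !mxE; field.
Qed.

Lemma vertical_sympart A : vertical (A - sympart A).
Proof.
exists (2 * (N%:R^-1 * \tr A)); rewrite /sympart.
move: (N%:R^-1 * _) => c; apply/matrixP => i j.
by rewrite !mxE eq_sym; case: (i == j); rewrite ?mulr1n ?mulr0n; field.
Qed.

(** The projection is self-adjoint, so replacing letters by their [sympart] does not affect symbols
    on [ssym]. *)
Lemma trace_sympart A B : ssym B -> \tr (sympart A *m B) = \tr (A *m B).
Proof.
move=> [Bs Bt]; rewrite /sympart mulmxBl mul_scalar_mx raddfB /= mxtraceZ Bt mulr0 subr0.
rewrite -scalemxAl mxtraceZ mulmxDl mxtraceD -[\tr (A^T *m B)]mxtrace_tr trmx_mul trmxK Bs.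
by rewrite [\tr (B *m A)]mxtrace_mulC; field.
Qed.

Lemma ssym_lin (a : R) A B : ssym A -> ssym B -> ssym (a *: A + B).
Proof.
move=> [As At] [Bs Bt]; split; first by rewrite linearD linearZ /= As Bs.
by rewrite mxtraceD mxtraceZ At Bt mulr0 addr0.
Qed.

Lemma lder_scalar (a : R) h x : spherical h -> detpos x -> lder a%:M h x = 0.
Proof.
move=> [Hh Hi] Dx.
rewrite /lder mul_mx_scalar -(cderive_cst x (a *: x) (h x)).
apply: cderive_line.
have D1 : \forall t \near (0 : R), 0 < 1 + t * a.
  have C : (fun t : R => 1 + t * a) @ (0 : R) --> (1 + 0 * a : R).
    by apply: cvgD; [exact: cvg_cst | apply: cvgM; [exact: cvg_id | exact: cvg_cst]].
  rewrite mul0r addr0 in C.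
  have H := cvgr_gt _ C; apply: H; exact: ltr01.
apply: filterS (D1) => t t0.
have -> : t *: (a *: x) + x = (1 + t * a) *: x by rewrite scalerA scalerDl scale1r addrC.
apply: (Hi _ _ ((1 + t * a) ^+ 2)) => //.
- by rewrite /detpos /= detZ mulr_gt0 // exprn_gt0.
- exact: exprn_gt0.
- by rewrite linearZ /= -scalemxAl -scalemxAr scalerA.
Qed.

(** As [A] is skew, [1 + t *: A] and [1 - t *: A] are transposes of each other and commute, so [h]
    takes the same values along [v] and [- v]. The derivative equals its own opposite. *)
Lemma lder_skew A h x : A^T = - A -> spherical h -> detpos x -> lder A h x = 0.
Proof.
move=> AT [Hh Hi] Dx.
pose v := x *m A.
have E : cderive v h x = cderive (- v) h x.
  apply: cderive_line.
  have n1 := near_line v oO Dx; have n2 := near_line (- v) oO Dx.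
  apply: filterS (filterI n1 n2) => t [Dp Dm].
  apply: (Hi _ _ 1) => //; rewrite scale1r.
  have -> : t *: v + x = x *m (1%:M + t *: A) by rewrite mulmxDr mulmx1 -scalemxAr addrC.
  have -> : t *: - v + x = x *m (1%:M - t *: A).
    by rewrite mulmxBr mulmx1 -scalemxAr addrC scalerN.
  have Aij i j : A j i = - A i j by have := congr1 (fun m : M => m i j) AT; rewrite !mxE.
  have T1 : (1%:M + t *: A)^T = 1%:M - t *: A.
    by apply/matrixP => i j; rewrite !mxE Aij mulrN eq_sym.
  have T2 : (1%:M - t *: A)^T = 1%:M + t *: A.
    by apply/matrixP => i j; rewrite !mxE Aij mulrN opprK eq_sym.
  rewrite !trmx_mul T1 T2 -!mulmxA; congr (_ *m _); rewrite !mulmxA; congr (_ *m _).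
  rewrite mulmxBr mulmx1 mulmxDl mul1mx opprD addrA addrK.
  by rewrite mulmxDr mulmx1 mulmxBl mul1mx addrA subrK.
have E2 : cderive (- v) h x = - cderive v h x.
  have := @cderive_linear R N detpos x Dx unit [:: tt] (fun=> -1) (fun=> v) h Hh.
  by rewrite !big_seq1 scaleN1r => ->; rewrite rmorphN1 mulN1r.
move: E; rewrite E2 -/v /lder -/v => E.
have /eqP : cderive v h x *+ 2 = 0 by rewrite mulr2n {1}E addNr.
by rewrite mulrn_eq0 => /eqP.
Qed.

Lemma lder_vertical A h x : vertical A -> spherical h -> detpos x -> lder A h x = 0.
Proof.
move=> [s As] Sh Dx; have Hh := Sh.1.
pose K := A - (s / 2)%:M.
have KT : K^T = - K.
  apply/matrixP => i j.
  have Aij : A j i = s *+ (i == j) - A i j.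
    have := congr1 (fun m : M => m i j) As; rewrite !mxE => <-.
    by rewrite addrAC subrr add0r.
  by rewrite !mxE Aij eq_sym; case: (i == j); rewrite ?mulr1n ?mulr0n; field.
have -> : A = \sum_(b : bool) (1 : R) *: (if b then K else (s / 2)%:M).
  by rewrite big_bool /= !scale1r /K subrK.
rewrite (lder_linear _ _ _ Hh Dx) big_bool /=.
by rewrite (lder_skew KT Sh Dx) (lder_scalar _ Sh Dx) !mulr0 addr0.
Qed.

Definition opsum (e : seq (R[i] * seq M)) h x : R[i] := \sum_(p <- e) p.1 * wder p.2 h x.

(** Being of order less than [r]. Agreement is asked on spherical functions only, which is why
    vertical letters can be discarded. *)
Definition low r (T : (M -> R[i]) -> M -> R[i]) : Prop :=
  exists e, (forall p, p \in e -> (size p.2 < r)%N) /\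
    forall h x, spherical h -> detpos x -> T h x = opsum e h x.

Lemma low_ext r T T' : (forall h x, spherical h -> detpos x -> T h x = T' h x) ->
  low r T -> low r T'.
Proof.
by move=> E [e [He1 He2]]; exists e; split=> // h x Sh Dx; rewrite -E // He2.
Qed.

Lemma low0 r : low r (fun _ _ => 0).
Proof. by exists [::]; split=> // h x _ _; rewrite /opsum big_nil. Qed.

Lemma lowD r T T' : low r T -> low r T' -> low r (fun h x => T h x + T' h x).
Proof.
move=> [e [e1 e2]] [e' [e1' e2']]; exists (e ++ e'); split.
  by move=> p; rewrite mem_cat => /orP[/e1|/e1'].
by move=> h x Sh Dx; rewrite e2 // e2' // /opsum big_cat.
Qed.

Lemma lowZ r (c : R[i]) T : low r T -> low r (fun h x => c * T h x).
Proof.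
move=> [e [e1 e2]]; exists [seq (c * p.1, p.2) | p <- e]; split.
  by move=> p /mapP[q qe ->]; apply: (e1 q).
move=> h x Sh Dx; rewrite e2 // /opsum big_map mulr_sumr.
by apply: eq_bigr => p _; rewrite mulrA.
Qed.

Lemma low_sum r (I : eqType) (s : seq I) (T : I -> (M -> R[i]) -> M -> R[i]) :
  (forall i, i \in s -> low r (T i)) -> low r (fun h x => \sum_(i <- s) T i h x).
Proof.
elim: s => [|i s IH] H.
  by apply: low_ext (low0 r) => h x _ _; rewrite big_nil.
have H1 : low r (T i) by apply: H; rewrite mem_head.
have H2 : low r (fun h x => \sum_(i <- s) T i h x).
  by apply: IH => j js; apply: H; rewrite inE js orbT.
by apply: low_ext (lowD H1 H2) => h x _ _; rewrite big_cons.
Qed.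

Lemma low_word r w : (size w < r)%N -> low r (wder w).
Proof.
move=> wr; exists [:: (1, w)]; split; first by move=> p; rewrite inE => /eqP ->.
by move=> h x _ _; rewrite /opsum big_seq1 mul1r.
Qed.

(** The letter [A] is moved to the right, each exchange costing a commutator word that is one letter
    shorter, until it acts on the spherical function itself and kills it. *)
Lemma low_vertical A w1 w2 : vertical A ->
  low (size w1 + size w2).+1 (wder (w1 ++ A :: w2)).
Proof.
move=> VA; elim: w2 w1 => [|B w2 IH] w1.
  apply: low_ext (low0 _) => h x Sh Dx; rewrite wder_cat.
  have E y : detpos y -> wder [:: A] h y = 0 by move=> Dy; apply: lder_vertical.
  by rewrite (wder_ext w1 E Dx) wder0.
have L1 := IH (w1 ++ [:: B]).
rewrite size_cat addn1 addSnnS -catA /= in L1.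
have L2 : low (size w1 + (size w2).+1).+1 (wder (w1 ++ (A *m B - B *m A) :: w2)).
  by apply: low_word; rewrite size_cat.
apply: low_ext (lowD L1 L2) => h x Sh Dx.
by rewrite (wder_swap w1 A B w2 Sh.1 Dx).
Qed.

Lemma low_swap A B w1 w2 : low (size w1 + size w2).+2
  (fun h x => wder (w1 ++ A :: B :: w2) h x - wder (w1 ++ B :: A :: w2) h x).
Proof.
have L : low (size w1 + size w2).+2 (wder (w1 ++ (A *m B - B *m A) :: w2)).
  by apply: low_word; rewrite size_cat /= addnS.
apply: low_ext L => h x Sh Dx.
by rewrite (wder_swap w1 A B w2 Sh.1 Dx) addrAC subrr add0r.
Qed.

Lemma low_trans r T1 T2 T3 : low r (fun h x => T1 h x - T2 h x) ->
  low r (fun h x => T2 h x - T3 h x) -> low r (fun h x => T1 h x - T3 h x).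
Proof.
move=> L1 L2; apply: low_ext (lowD L1 L2) => h x _ _.
exact: subrKA.
Qed.

Lemma low_refl r T : low r (fun h x => T h x - T h x).
Proof. by apply: low_ext (low0 r) => h x _ _; rewrite subrr. Qed.

Lemma low_move A w1 w2 w3 : low (size w1 + size w2 + size w3).+1
  (fun h x => wder (w1 ++ A :: w2 ++ w3) h x - wder (w1 ++ w2 ++ A :: w3) h x).
Proof.
elim: w2 w1 => [|B w2 IH] w1; first exact: low_refl.
have L1 := low_swap A B w1 (w2 ++ w3).
have L2 := IH (w1 ++ [:: B]).
rewrite size_cat addn1 -!catA /= in L2.
have EE : (size w1 + size (w2 ++ w3)).+2 = (size w1 + (size w2).+1 + size w3).+1.
  by rewrite size_cat !addnS !addSn addnA.
have EE' : ((size w1).+1 + size w2 + size w3).+1 = (size w1 + (size w2).+1 + size w3).+1.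
  by rewrite !addnS !addSn.
rewrite EE in L1; rewrite EE' in L2; exact: low_trans L1 L2.
Qed.

(** The prefix [w0] collects the letters already in place, so that the induction can run under
    it. *)
Lemma low_perm w0 w w' : perm_eq w w' ->
  low (size w0 + size w) (fun h x => wder (w0 ++ w) h x - wder (w0 ++ w') h x).
Proof.
elim: w w0 w' => [|A t IH] w0 w' pw.
  have -> : w' = [::] by apply: perm_small_eq; rewrite // perm_sym.
  exact: low_refl.
have Aw' : A \in w' by rewrite -(perm_mem pw) mem_head.
case/splitPr: Aw' pw => u v pw.
have pt : perm_eq t (u ++ v).
  rewrite -(perm_cons A); apply: perm_trans pw _.
  by rewrite -[A :: v]cat1s perm_catCA /= perm_refl.
have L1 := IH (w0 ++ [:: A]) _ pt; rewrite size_cat addn1 -!catA /= in L1.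
have L2 := low_move A w0 u v.
have Es : size t = (size u + size v)%N by rewrite (perm_size pt) size_cat.
rewrite -addnA -Es -addnS in L2; rewrite addSnnS in L1.
exact: low_trans L1 L2.
Qed.

End InvariantFunctions.

(** * Principal symbols *)

Section Symbols.
Variables (R : realType) (n : nat).
Local Notation M := 'M[R]_n.+1.
Local Notation N := n.+1.
Local Notation I := ('I_n.+1 * 'I_n.+1)%type.
Implicit Types (h : M -> R[i]) (A B x y : M) (w : seq M).
Local Notation oO := (@open_detpos R n.+1).

Definition symbasis (k : I) : M := sympart (delta_mx k.1 k.2).

Lemma sympart_coord A :
  sympart A = \sum_(k : I) (sympart A) k.1 k.2 *: symbasis k.
Proof.
rewrite -[LHS](sympart_id (ssym_sympart A)) [in LHS](matrix_sum_delta (sympart A)).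
rewrite pair_big /= linear_sum; apply: eq_bigr => k _.
by rewrite linearZ.
Qed.

(* The words in [symbasis] of the multilinear expansion of a word. *)
Fixpoint expand_word w : seq (R * seq I) :=
  if w is A :: t then
    [seq ((sympart A) k.1 k.2 * p.1, k :: p.2) | k <- index_enum I, p <- expand_word t]
  else [:: (1, [::])].

Lemma big_expand (V : nmodType) A t (F : R * seq I -> V) :
  \sum_(p <- expand_word (A :: t)) F p = \sum_(k : I) \sum_(p <- expand_word t)
     F ((sympart A) k.1 k.2 * p.1, k :: p.2).
Proof. by rewrite /= big_allpairs_dep. Qed.

Lemma size_expand w p : p \in expand_word w -> size p.2 = size w.
Proof.
elim: w p => [|A t IH] p; first by rewrite inE => /eqP ->.
by move=> /allpairsP[[k q] [_ /IH /= Hq ->]] /=; rewrite Hq.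
Qed.

Lemma expand_prod w (x : I -> R) :
  \sum_(p <- expand_word w) (p.1)%:C * \prod_(k <- p.2) (x k)%:C =
  \prod_(v <- w) (\sum_k (sympart v) k.1 k.2 * x k)%:C.
Proof.
elim: w => [|A t IH]; first by rewrite /= big_seq1 !big_nil mulr1.
rewrite big_expand big_cons -IH rmorph_sum mulr_suml; apply: eq_bigr => k _.
rewrite mulr_sumr; apply: eq_bigr => p _; rewrite big_cons /=.
by rewrite !rmorphM /=; move: (\prod_(_ <- _) _) => z; ring.
Qed.

Lemma low_expand w0 w : low (size w0 + size w) (fun h x =>
  wder (w0 ++ w) h x - \sum_(p <- expand_word w) (p.1)%:C * wder (w0 ++ map symbasis p.2) h x).
Proof.
elim: w w0 => [|A t IH] w0.
  by apply: low_ext (low0 _ _ _) => h x _ _; rewrite /= big_seq1 mul1r subrr.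
rewrite [size (A :: t)]/= addnS.
have L1 : low (size w0 + size t).+1 (wder (w0 ++ (A - sympart A) :: t)).
  by apply: low_vertical; exact: vertical_sympart.
have L2 (k : I) : low (size w0 + size t).+1 (fun h x => ((sympart A) k.1 k.2)%:C *
  (wder (w0 ++ symbasis k :: t) h x -
   \sum_(p <- expand_word t) (p.1)%:C * wder (w0 ++ symbasis k :: map symbasis p.2) h x)).
  apply: lowZ; have := IH (w0 ++ [:: symbasis k]); rewrite size_cat addn1 addSn.
  by apply: low_ext => h x _ _; rewrite -catA; congr (_ - _); apply: eq_bigr => p _; rewrite -catA.
have L3 := low_sum (s := index_enum I) (fun k _ => L2 k).
apply: low_ext (lowD L1 L3) => h x Sh Dx.
rewrite big_expand.
have EA : A = \sum_(b : bool) (1 : R) *: (if b then A - sympart A else sympart A).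
  by rewrite big_bool /= !scale1r subrK.
have EW : wder (w0 ++ A :: t) h x =
    wder (w0 ++ (A - sympart A) :: t) h x + wder (w0 ++ sympart A :: t) h x.
  by rewrite {1}EA (wder_linear _ _ _ _ _ Sh.1 Dx) big_bool /= !mul1r.
rewrite EW -addrA; congr (_ + _).
rewrite [in wder (w0 ++ sympart A :: t)]sympart_coord (wder_linear _ _ _ _ _ Sh.1 Dx).
rewrite -sumrB; apply: eq_bigr => k _; rewrite mulrBr; congr (_ - _).
rewrite mulr_sumr; apply: eq_bigr => p _.
by rewrite rmorphM /= mulrA.
Qed.

(** The trace form identifies SSym_n with its dual: a letter [v] becomes the linear form
    [\tr (v *m A)]. Shorter words have lower order and do not count. *)
Definition symb r (e : seq (R[i] * seq M)) A : R[i] :=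
  \sum_(p <- e | size p.2 == r) p.1 * \prod_(v <- p.2) (\tr (v *m A))%:C.

(** Arbitrary values [x] of the commuting variables come from a point of [ssym]. Vanishing of a
    symbol on [ssym] thus gives the identity that [commutative_collect] asks for. *)
Lemma trace_sympart_mul A (x : I -> R) : \sum_k (sympart A) k.1 k.2 * x k =
  \tr (A *m sympart (\matrix_(i, j) x (j, i))).
Proof.
set X := \matrix_(i, j) _.
have -> : \sum_k (sympart A) k.1 k.2 * x k = \tr (sympart A *m X).
  rewrite /mxtrace [RHS](eq_bigr (fun i => \sum_j (sympart A) i j * x (i, j))).
    by rewrite pair_big; apply: eq_bigr => -[i j] _.
  by move=> i _; rewrite mxE; apply: eq_bigr => j _; rewrite [X j i]mxE.
rewrite mxtrace_mulC -(trace_sympart X (ssym_sympart A)) mxtrace_mulC.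
by rewrite (trace_sympart A (ssym_sympart X)).
Qed.

(* Modulo shorter words, letters commute and only depend on their [sympart]. *)
Lemma low_symbol0 r (e : seq (R[i] * seq M)) :
  (forall p, p \in e -> (size p.2 <= r)%N) ->
  (forall A, ssym A -> symb r e A = 0) -> low r (opsum e).
Proof.
move=> He Hs.
pose T (p : R[i] * seq M) h x := if size p.2 == r then
  p.1 * \sum_(q <- expand_word p.2) (q.1)%:C * wder (map symbasis q.2) h x else 0.
have L1 p : p \in e -> low r (fun h x => p.1 * wder p.2 h x - T p h x).
  move=> pe; rewrite /T; case: eqP => [sp|/eqP sp].
    have := lowZ p.1 (low_expand [::] p.2); rewrite add0n sp.
    by apply: low_ext => h x _ _; rewrite mulrBr.
  have sp' : (size p.2 < r)%N by rewrite ltn_neqAle sp He.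
  by apply: low_ext (lowZ p.1 (low_word sp')) => h x _ _; rewrite subr0.
have L2 := low_sum L1.
pose ler : rel I := fun a b => (enum_rank a <= enum_rank b)%N.
have ler_tot : total ler by move=> a b; exact: leq_total.
have ler_tr : transitive ler by move=> a b c; exact: leq_trans.
have ler_anti : antisymmetric ler.
  by move=> a b /anti_leq /val_inj /enum_rank_inj.
(* Sorting makes [Phi] depend only on the multiset of letters; by [low_perm] the error is of lower
   order. *)
pose Phi h x (s : seq I) := wder (map symbasis (sort ler s)) h x.
pose e1 := flatten [seq [seq (p.1 * (q.1)%:C, q.2) | q <- expand_word p.2] | p <- e & size p.2 == r].
have big_e1 (F : R[i] * seq I -> R[i]) : \sum_(t <- e1) F t =
    \sum_(p <- e | size p.2 == r) \sum_(q <- expand_word p.2) F (p.1 * (q.1)%:C, q.2).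
  rewrite big_flatten /= big_map big_filter; apply: eq_bigr => p _.
  by rewrite big_map.
have TE h x : \sum_(p <- e) T p h x = \sum_(t <- e1) t.1 * wder (map symbasis t.2) h x.
  rewrite big_e1 [RHS]big_mkcond; apply: eq_bigr => p _; rewrite /T; case: ifP => // _.
  by rewrite mulr_sumr; apply: eq_bigr => q _; rewrite mulrA.
have se1 t : t \in e1 -> size t.2 = r.
  move=> /flatten_mapP[p]; rewrite mem_filter => /andP[/eqP sp _] /mapP[q /size_expand sq ->].
  by rewrite /= sq.
have L3 t : t \in e1 -> low r (fun h x => t.1 * (wder (map symbasis t.2) h x - Phi h x t.2)).
  move=> /se1 st; apply: lowZ.
  have pm : perm_eq (map symbasis t.2) (map symbasis (sort ler t.2)).
    by apply: perm_map; rewrite perm_sym perm_sort.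
  by have := low_perm [::] pm; rewrite add0n size_map st.
have L4 := low_sum L3.
have Z h x : \sum_(t <- e1) t.1 * Phi h x t.2 = 0.
  apply: commutative_collect => [y|s t st]; last first.
    by rewrite /Phi (elimT (perm_sortP ler_tot ler_tr ler_anti s t) st).
  rewrite big_e1 -[RHS](Hs _ (ssym_sympart (\matrix_(i, j) y (j, i)))) /symb.
  apply: eq_bigr => p _.
  rewrite [LHS](eq_bigr (fun q => p.1 * ((q.1)%:C * \prod_(k <- q.2) (y k)%:C))); last first.
    by move=> q _; rewrite mulrA.
  rewrite -mulr_sumr expand_prod; congr (_ * _).
  by apply: eq_bigr => v _; rewrite trace_sympart_mul.
apply: low_ext (lowD L2 L4) => h x Sh Dx.
rewrite sumrB TE /opsum.
under [X in _ + X]eq_bigr do rewrite mulrBr.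
by rewrite sumrB Z subr0 subrK.
Qed.

Lemma lderM A f g x : csmooth detpos f -> csmooth detpos g -> detpos x ->
  lder A (fun y => f y * g y) x = lder A f x * g x + f x * lder A g x.
Proof. by move=> Hf Hg Dx; apply: cderiveM Dx _ _ _ Hf Hg. Qed.

Lemma lderX A u m x : csmooth detpos u -> detpos x ->
  lder A (fun y => u y ^+ m.+1) x = m.+1%:R * u x ^+ m * lder A u x.
Proof.
move=> Hu Dx; elim: m => [|m IH].
  rewrite mulr1 mul1r; apply: lder_ext Dx => y _; exact: expr1.
have E : lder A (fun y => u y ^+ m.+2) x = lder A (fun y => u y * u y ^+ m.+1) x.
  by apply: lder_ext Dx => y _; exact: exprS.
rewrite E (lderM _ Hu (csmoothX m.+1 oO Hu) Dx) IH.
have -> : m.+2%:R = m.+1%:R + 1 :> R[i] by rewrite -addn1 natrD.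
move: (lder A u x) (u x) => a b; rewrite exprS.
by move: (m.+1%:R : R[i]) => c; ring.
Qed.

(** By Leibniz's rule each letter removes at most one factor [u]. Where [u] vanishes, something is
    left only for [j = 0]: the terms in which the letters hit distinct factors. *)
Lemma wder_power (u : M -> R[i]) w j : csmooth detpos u ->
  exists2 G, csmooth detpos G & forall x, detpos x ->
   wder w (fun y => u y ^+ (size w + j)) x =
   u x ^+ j * (((size w + j)`!%:R / j`!%:R) * \prod_(v <- w) lder v u x + u x * G x).
Proof.
move=> Hu; elim: w j => [|v t IH] j.
  exists (fun=> 0); first exact: csmooth_cst.
  move=> x Dx; rewrite [size _]/= add0n big_nil mulr1 mulr0 addr0 divff.
    by rewrite mulr1.
  by rewrite pnatr_eq0 -lt0n fact_gt0.
have [G HG E] := IH j.+1.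
pose K : R[i] := (size t + j.+1)`!%:R / j.+1`!%:R.
pose P x := \prod_(v <- t) lder v u x.
have HP : csmooth detpos P.
  rewrite /P; elim: t {IH G HG E K P} => [|a t IH].
    by apply: (csmooth_ext oO _ (csmooth_cst _ 1)) => x _; rewrite big_nil.
  apply: (csmooth_ext oO _ (csmoothM oO (csmooth_lder a Hu) IH)) => x _.
  by rewrite big_cons.
pose Q x := K * P x + u x * G x.
have HQ : csmooth detpos Q.
  apply: csmoothD oO _ _; apply: csmoothM oO _ _ => //; exact: csmooth_cst.
exists (fun x => j.+1%:R * lder v u x * G x + lder v Q x).
  apply: csmoothD oO _ _; last exact: csmooth_lder.
  apply: csmoothM oO _ _ => //; apply: csmoothM oO _ _; last exact: csmooth_lder.
  exact: csmooth_cst.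
move=> x Dx.
have E' y : detpos y -> wder t (fun y => u y ^+ (size t + j.+1)) y = u y ^+ j.+1 * Q y.
  by move=> Dy; rewrite (E y Dy).
rewrite /= addSnnS (lder_ext v E' Dx) (lderM _ (csmoothX j.+1 oO Hu) HQ Dx).
rewrite (lderX _ _ Hu Dx) big_cons -/(P x) /Q.
have -> : (size t + j.+1)`!%:R / j`!%:R = j.+1%:R * K :> R[i].
  have j0 : (j.+1%:R : R[i]) != 0 by rewrite pnatr_eq0.
  have f0 : (j`!%:R : R[i]) != 0 by rewrite pnatr_eq0 -lt0n fact_gt0.
  rewrite /K factS natrM; move: (_`!%:R) (j.+1%:R) (j`!%:R) j0 f0 => a b c b0 c0.
  by field; rewrite b0 c0.
move: (lder v _ x) (lder v u x) (P x) (G x) (u x) => a b c d f.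
by rewrite exprS; ring.
Qed.

End Symbols.

(** * Test functions that detect the symbol *)

Section TestFunctions.
Variables (R : realType) (n : nat).
Local Notation M := 'M[R]_n.+1.
Local Notation N := n.+1.
Implicit Types (h : M -> R[i]) (A B x y k : M) (w : seq M).
Local Notation oO := (@open_detpos R n.+1).

(* [test_fun A ^+ r] vanishes to order [r] at the identity, so words of length [< r]
   kill it there and those of length [r] give the symbol. *)
Definition qform A x : R := \tr (x *m x^T *m A).
(** Homogeneous of degree -2, it compensates the degree 2 of [qform A], as invariance under scaling
    demands. The square makes it a function of the determinant of [x *m x^T]. *)
Definition detfactor x : R := (\det x ^+ 2) `^ (- N%:R^-1).
Definition test_fun A x : R[i] := (qform A x * detfactor x)%:C.

Lemma Ck_qform (k : nat) U A : open U -> Ck k U (qform A).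
Proof.
move=> oU.
have H : Ck k U (fun x => \sum_i \sum_l (\sum_m x i m * x l m) * A l i).
  apply: Ck_sum => // i _; apply: Ck_sum => // l _; apply: Ck_M => //; last exact: Ck_cst.
  by apply: Ck_sum => // m _; apply: Ck_M => //; exact: Ck_coord.
apply: (Ck_ext oU _ H) => x _; apply: eq_bigr => i _; rewrite mxE.
apply: eq_bigr => l _; rewrite mxE; congr (_ * _).
by apply: eq_bigr => m _; rewrite mxE.
Qed.

Lemma Ck_detfactor (k : nat) : Ck k detpos detfactor.
Proof.
apply: Ck_powR oO _ _.
  by move=> x Dx; rewrite exprn_gt0.
have HD := Ck_det oO (fun i j => Ck_coord k detpos i j).
by apply: (Ck_ext oO _ (Ck_M oO HD HD)) => x _; rewrite expr2.
Qed.

Lemma csmooth_test_fun A : csmooth detpos (test_fun A).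
Proof.
apply: csmooth_real => k; apply: Ck_M oO _ _; last exact: Ck_detfactor.
exact: (Ck_qform _ _ oO).
Qed.

Lemma spherical_test_fun A : spherical (test_fun A).
Proof.
split; first exact: csmooth_test_fun.
move=> x y c Dx Dy c0 E; rewrite /test_fun; congr (_%:C).
have -> : qform A x = c * qform A y by rewrite /qform E -scalemxAl mxtraceZ.
have Ed : \det x ^+ 2 = c ^+ N * \det y ^+ 2.
  have := congr1 determinant E; rewrite detZ !det_mulmx !det_tr -!expr2; exact.
rewrite /detfactor Ed powRM ?exprn_ge0 ?ltW // -powR_mulrn ?ltW // -powRrM.
rewrite mulrN divff ?pnatr_eq0 // powR_inv1 ?ltW // -!mulrA mulrCA mulVKf //.
by rewrite gt_eqF.
Qed.

Lemma sphericalX h m : spherical h -> spherical (fun x => h x ^+ m).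
Proof.
move=> [Hh Hi]; split; first exact: csmoothX oO Hh.
by move=> x y c Dx Dy c0 E; rewrite (Hi x y c).
Qed.

Lemma derive_qform A Z : 'D_Z (qform A) (1%:M : M) = \tr ((Z + Z^T) *m A).
Proof.
rewrite /derive; apply: cvg_lim => //.
set b := \tr _; pose a := \tr (Z *m Z^T *m A).
have E : \forall t \near (0 : R)^',
    (fun t : R => t * a + b) t = t^-1 *: ((qform A \o shift (1%:M : M)) (t *: Z) - qform A 1%:M).
  near=> t.
  have t0 : t != 0 by near: t; exact: nbhs_dnbhs_neq.
  rewrite /= /qform trmx1 mulmx1 mul1mx.
  have -> : (t *: Z + 1%:M)^T = t *: Z^T + 1%:M.
    by apply/matrixP => i j; rewrite !mxE eq_sym.
  have -> : (t *: Z + 1%:M) *m (t *: Z^T + 1%:M) *m A =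
      (t * t) *: (Z *m Z^T *m A) + t *: ((Z + Z^T) *m A) + A.
    rewrite mulmxDl !mulmxDr !mulmx1 !mul1mx -!scalemxAl -!scalemxAr scalerA.
    by rewrite !mulmxDl -!scalemxAl !scalerDr !addrA mul1mx.
  rewrite (raddfD (mxtrace (n := N))) (raddfD (mxtrace (n := N))) /= !mxtraceZ addrK -[_ *: _]/(_ * _) -/a -/b.
  by rewrite -mulrA -mulrDr mulKf.
apply: cvg_trans; first exact: (near_eq_cvg E).
have C : (fun t : R => t * a + b) @ (0 : R) --> (0 * a + b : R).
  apply: cvgD; last exact: cvg_cst.
  by apply: cvgM; [exact: cvg_id | exact: cvg_cst].
rewrite mul0r add0r in C.
apply: cvg_within_filter; exact: C.
Unshelve. all: by end_near. Qed.

Lemma detpos1 : @detpos R n.+1 1%:M.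
Proof. by rewrite /detpos /= det1. Qed.

Lemma qform1 A : ssym A -> qform A 1%:M = 0.
Proof. by move=> [_ At]; rewrite /qform trmx1 mulmx1 mul1mx. Qed.

(** The derivative of [detfactor] drops out, being multiplied by [qform A 1%:M], the trace of
    [A]. *)
Lemma lder_test_fun A Z : ssym A -> lder Z (test_fun A) 1%:M = (2 * \tr (Z *m A))%:C.
Proof.
move=> Hs; have [As At] := Hs; rewrite /lder mul1mx /cderive /= derive_cst.
congr (_ +i* _).
have dq : differentiable (qform A) (1%:M : M) := Ck_diff (Ck_qform 1 A oO) detpos1.
have dd : differentiable detfactor (1%:M : M) := Ck_diff (Ck_detfactor 1) detpos1.
have [_ ->] := derive_mul Z dq dd.
rewrite derive_qform qform1 // mul0r addr0 /detfactor det1 expr1n powR1 mulr1.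
rewrite mulmxDl mxtraceD -[\tr (Z^T *m A)]mxtrace_tr trmx_mul trmxK As [\tr (A *m Z)]mxtrace_mulC.
by ring.
Qed.

(** The counterpart of [low_symbol0]: expressions of an operator are not unique, but its symbol is,
    and it can be read off at the identity. *)
Lemma symb_eq0 r (e : seq (R[i] * seq M)) :
  (forall p, p \in e -> (size p.2 <= r)%N) ->
  (forall h, spherical h -> opsum e h 1%:M = 0) ->
  forall A, ssym A -> symb r e A = 0.
Proof.
move=> He H A HA.
have u1 : test_fun A 1%:M = 0 by rewrite /test_fun qform1 // mul0r.
have := H _ (sphericalX r (spherical_test_fun A)).
rewrite /opsum => E0.
have E : \sum_(p <- e) p.1 * wder p.2 (fun x => test_fun A x ^+ r) 1%:M =
    (r`!%:R * 2 ^+ r) * symb r e A.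
  rewrite /symb [in RHS]big_mkcond mulr_sumr; apply: eq_big_seq => p pe.
  have [G HG EG] := wder_power p.2 (r - size p.2) (csmooth_test_fun A).
  have := EG _ detpos1; rewrite subnKC ?He // => ->.
  rewrite u1 mul0r addr0.
  case: eqP => [sp|/eqP sp]; last first.
    have rs : (0 < r - size p.2)%N by rewrite subn_gt0 ltn_neqAle sp He.
    by rewrite expr0n gtn_eqF // mul0r !mulr0.
  rewrite sp subnn expr0 mul1r fact0 divr1.
  have -> : \prod_(v <- p.2) lder v (test_fun A) 1%:M =
      2 ^+ r * \prod_(v <- p.2) (\tr (v *m A))%:C.
    rewrite -sp; elim: p.2 => [|v s IH]; first by rewrite !big_nil expr0 mulr1.
    rewrite !big_cons IH lder_test_fun // rmorphM /= exprS rmorph_nat.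
    by move: (\prod_(_ <- _) _) (2 ^+ _) => a b; ring.
  by move: (\prod_(_ <- _) _) (2 ^+ _) => a b; ring.
have /eqP := etrans (esym E) E0.
rewrite mulf_eq0 => /orP[|/eqP//].
by rewrite mulf_eq0 pnatr_eq0 expf_eq0 pnatr_eq0 andbF orbF -leqn0 leqNgt fact_gt0.
Qed.

Definition conj_expr k (e : seq (R[i] * seq M)) : seq (R[i] * seq M) :=
  [seq (p.1, [seq k^T *m v *m k | v <- p.2]) | p <- e].

Lemma wder_conj w h k x : spherical h -> k^T *m k = 1%:M -> \det k = 1 -> detpos x ->
  wder w h x = wder [seq k^T *m v *m k | v <- w] h (x *m k).
Proof.
move=> [Hh Hi] kk k1 Dx.
have Dk : detpos k by rewrite /detpos /= k1.
have kV : invmx k = k^T.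
  by rewrite -[LHS]mul1mx -kk mulmxK // detpos_unit.
have -> : wder w h x = wder w (fun y => h (y *m k)) x.
  apply: wder_ext Dx => y Dy; apply: (Hi _ _ 1) => //; first exact: detposM.
  by rewrite scale1r trmx_mul !mulmxA -(mulmxA y k) (mulmx1C kk) mulmx1.
by rewrite (wder_right _ Hh Dk Dx) kV.
Qed.

(** On spherical functions, [e] at the point [k^T] equals the expression with conjugated letters at
    the identity. So the conjugated expression minus [e] vanishes at the identity, and [symb_eq0]
    compares the symbols. *)
Lemma symb_invariant r (e : seq (R[i] * seq M)) :
  (forall p, p \in e -> (size p.2 <= r)%N) ->
  (forall h k, spherical h -> k^T *m k = 1%:M -> \det k = 1 ->
     opsum e h k = opsum e h 1%:M) ->
  forall k A, k^T *m k = 1%:M -> \det k = 1 -> ssym A ->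
     symb r e (k *m A *m k^T) = symb r e A.
Proof.
move=> He H k A kk k1 HA.
pose l := k^T; have kk' := mulmx1C kk.
have ll : l^T *m l = 1%:M by rewrite /l trmxK.
have l1 : \det l = 1 by rewrite /l det_tr.
pose e' := conj_expr k e ++ [seq (- p.1, p.2) | p <- e].
have := @symb_eq0 r e' _ _ A HA.
rewrite /symb big_cat !big_map /=.
have -> : \sum_(p <- e | size p.2 == r) - p.1 * \prod_(v <- p.2) (\tr (v *m A))%:C = - symb r e A.
  by rewrite /symb -sumrN; apply: eq_bigr => p _; rewrite mulNr.
have -> : \sum_(p <- e | size [seq k^T *m v *m k | v <- p.2] == r)
     p.1 * \prod_(v <- [seq k^T *m v *m k | v <- p.2]) (\tr (v *m A))%:C =
     symb r e (k *m A *m k^T).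
  rewrite /symb; apply: eq_big => p; first by rewrite size_map.
  move=> _; rewrite big_map; congr (_ * _); apply: eq_bigr => v _; congr (_%:C).
  by rewrite -!mulmxA mxtrace_mulC !mulmxA.
move=> /(_ _ _)/eqP; rewrite subr_eq0 => HH; apply/eqP; apply: HH.
  move=> p; rewrite mem_cat => /orP[|] /mapP[q qe ->] /=; first by rewrite size_map He.
  exact: He.
move=> h Sh; rewrite /opsum big_cat !big_map /=.
have -> : \sum_(p <- e) - p.1 * wder p.2 h 1%:M = - opsum e h 1%:M.
  by rewrite /opsum -sumrN; apply: eq_bigr => p _; rewrite mulNr.
have Dl : detpos l by rewrite /detpos /= l1.
have -> : \sum_(p <- e) p.1 * wder [seq k^T *m v *m k | v <- p.2] h 1%:M = opsum e h l.
  rewrite /opsum; apply: eq_bigr => p _; congr (_ * _).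
  by rewrite (wder_conj p.2 Sh kk k1 Dl) /l kk.
by rewrite H // subrr.
Qed.

End TestFunctions.

(** * The exponential chart *)

Section ExponentialChart.
Variables (R : realType) (n : nat).
Local Notation M := 'M[R]_n.+1.
Local Notation N := n.+1.
Local Notation I := ('I_n.+1 * 'I_n.+1)%type.
Implicit Types (f g : M -> R[i]) (A B x y h X Y v : M) (w : seq M).
Local Notation oO := (@open_detpos R n.+1).

Lemma Ck_invmx (k : nat) (U : set M) p (phi : M -> 'M[R]_p) : open U ->
  (forall x, U x -> 0 < \det (phi x)) ->
  (forall i j, Ck k U (fun x => phi x i j)) ->
  forall i j, Ck k U (fun x => (invmx (phi x)) i j).
Proof.
move=> oU HU Hphi i j.
have Hd := Ck_V oU HU (Ck_det oU Hphi).
have Hc : Ck k U (fun x => cofactor (phi x) j i).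
  apply: Ck_M => //; first exact: Ck_cst.
  apply: (@Ck_det _ _ k U _ (fun x => row' j (col' i (phi x)))) => // a b.
  by apply: (Ck_ext oU _ (Hphi (lift j a) (lift i b))) => x _; rewrite !mxE.
apply: (Ck_ext oU _ (Ck_M oU Hd Hc)) => x Ux.
by rewrite /invmx unitmxE unitfE gt_eqF ?HU // !mxE.
Qed.

Lemma Ck_mulmx (k : nat) (U : set M) p (phi psi : M -> 'M[R]_p) : open U ->
  (forall i j, Ck k U (fun x => phi x i j)) -> (forall i j, Ck k U (fun x => psi x i j)) ->
  forall i j, Ck k U (fun x => (phi x *m psi x) i j).
Proof.
move=> oU H1 H2 i j.
have H : Ck k U (fun x => \sum_l phi x i l * psi x l j).
  by apply: Ck_sum => // l _; apply: Ck_M.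
by apply: (Ck_ext oU _ H) => x _; rewrite mxE.
Qed.

Definition expdet : set M := [set X | 0 < \det (mexp X)].

Lemma open_expdet : open expdet.
Proof.
apply: (@open_comp _ _ (fun x : M => \det (mexp x)) [set r | 0 < r]); last exact: open_gt.
move=> x _; have H : forall i j, Ck 0 setT (fun X : M => mexp X i j) by move=> i j; apply: Ck_mexp.
by have := Ck_det openT H; move=> /(_ x Logic.I).
Qed.
Local Notation oE := open_expdet.

Lemma expdet0 : expdet 0.
Proof. by rewrite /expdet /= mexp0 det1. Qed.

Definition dmexp X v : M := 'D_v (@mexp R N) X.

Lemma differentiable_mexp X : differentiable (@mexp R N) X.
Proof. by apply: differentiable_mx => i j; have [] := derive_mexp X 0 i j. Qed.

Lemma dmexpE X v i j : dmexp X v i j = 'D_v (fun Y : M => mexp Y i j) X.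
Proof. by rewrite /dmexp derive_mxE //; exact: differentiable_mexp. Qed.

Lemma dmexp_linear X : linear (dmexp X).
Proof.
move=> a v w; rewrite /dmexp !deriveE; try exact: differentiable_mexp.
exact: linearP.
Qed.

(** The left logarithmic derivative of [mexp]: the derivative of the chart along [v] is the
    left-invariant field of [theta X v] ([cderive_chart]). *)
Definition theta X v : M := invmx (mexp X) *m dmexp X v.

Lemma theta_linear X : linear (theta X).
Proof. by move=> a v w; rewrite /theta dmexp_linear mulmxDr -scalemxAr. Qed.
HB.instance Definition _ X := GRing.isLinear.Build R M M _ (theta X) (theta_linear X).

Lemma Ck_theta (k : nat) v i j : Ck k expdet (fun X => theta X v i j).
Proof.
have sT : expdet `<=` setT by [].
have H1 : forall a b, Ck k expdet (fun X => invmx (mexp X) a b).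
  exact: (Ck_invmx oE (phi := @mexp R N) (fun x Ex => Ex) (fun a b => Ck_sub sT (Ck_mexp R k a b))).
have H2 a b : Ck k expdet (fun X => dmexp X v a b).
  have [_ /(_ v) H] := Ck_mexp R k.+1 a b.
  by apply: (Ck_ext oE _ (Ck_sub sT H)) => X _; rewrite dmexpE.
exact: (Ck_mulmx oE H1 H2).
Qed.

Lemma theta0 v : theta 0 v = v.
Proof.
rewrite /theta mexp0 invmx1 mul1mx; apply/matrixP => i j.
by rewrite dmexpE derive_mexp0.
Qed.

Definition chart f h : M -> R[i] := fun X => f (h *m mexp X).

Lemma detpos_chart h X : detpos h -> expdet X -> detpos (h *m mexp X).
Proof. exact: detposM. Qed.

Lemma Ck_chart_map (k : nat) h i j : Ck k setT (fun X => (h *m mexp X) i j).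
Proof.
apply: Ck_mulmx openT _ _ _ _ => {}i {}j; first exact: Ck_cst.
exact: Ck_mexp.
Qed.

Lemma csmooth_chart f h : csmooth detpos f -> detpos h -> csmooth expdet (chart f h).
Proof.
move=> Hf Dh; apply: (csmooth_comp (U' := detpos) oE _ _ Hf) => [x Ex|k i j].
  exact: detposM.
exact: (Ck_sub (@subsetT _ expdet) (Ck_chart_map k h i j)).
Qed.

Lemma cderive_chart f h X v : csmooth detpos f -> detpos h -> expdet X ->
  cderive v (chart f h) X = lder (theta X v) f (h *m mexp X).
Proof.
move=> Hf Dh EX.
have H i j : Ck 1 expdet (fun X => (h *m mexp X) i j) by apply: (Ck_sub (@subsetT _ expdet) (Ck_chart_map 1 h i j)).
transitivity (cderive ('D_v (fun X => h *m mexp X) X) f (h *m mexp X)).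
  exact: (cderive_comp v H Hf EX (detposM Dh EX)).
suff HD : 'D_v (fun X => h *m mexp X) X = h *m mexp X *m theta X v by rewrite HD.
rewrite /theta mulmxA mulmxK ?detpos_unit //.
apply/matrixP => i j; rewrite derive_mxE; last first.
  by apply: differentiable_mx => i' j'; apply: Ck_diff (H i' j') EX.
have [_ ->] : differentiable (fun y : M => (h *m mexp y) i j) X /\
    'D_v (fun y : M => (h *m mexp y) i j) X = (h *m dmexp X v) i j; last by [].
split; first exact: Ck_diff (H i j) EX.
pose L (Z : M) := (h *m Z) i j.
have dL Z : differentiable L Z by apply: (Ck_diff (Ck_mulmxl 1 h i j openT) Logic.I).
have [_ E] := derive_comp_mx v (fun a b => (derive_mexp X 0 a b).1) (dL (mexp X)).
rewrite -[LHS]/('D_v (L \o (fun X => mexp X)) X) E -/(dmexp X v).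
apply: derive_scalar_linear => a u u'.
by rewrite /L mulmxDr -scalemxAr !mxE.
Qed.

Lemma iderive_cons v vs f : iderive (v :: vs) f = cderive v (iderive vs f).
Proof. by []. Qed.

Lemma csmooth_iderive (U : set M) vs f : csmooth U f -> csmooth U (iderive vs f).
Proof. by move=> Hf; elim: vs => [|v vs IH] //=; apply: csmooth_cderive. Qed.

Lemma lder_delta A f x : csmooth detpos f -> detpos x -> lder A f x =
  \sum_(k : I) (A k.1 k.2)%:C * lder (delta_mx k.1 k.2) f x.
Proof.
move=> Hf Dx; rewrite [in LHS](matrix_sum_delta A) pair_big /=.
exact: lder_linear.
Qed.

(** A derivative along [v] either hits a coefficient or, by the chain rule, prepends the letter
    [theta X v]. As [theta 0 v = v], the words of full length reproduce at [X = 0] the symbol of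
    [vs]. *)
Lemma chart_to_words vs : exists (J : finType) (c : J -> M -> R) (w : J -> seq M),
  [/\ forall j, (size (w j) <= size vs)%N,
      forall j (k : nat), Ck k expdet (c j),
      forall f h X, csmooth detpos f -> detpos h -> expdet X ->
        iderive vs (chart f h) X = \sum_j (c j X)%:C * wder (w j) f (h *m mexp X) &
      forall A, symb (size vs) [seq ((c j 0)%:C, w j) | j <- index_enum J] A =
        \prod_(v <- vs) (\tr (v *m A))%:C].
Proof.
elim: vs => [|v vs [J [c [w [H1 H2 H3 H4]]]]].
  exists unit, (fun _ _ => 1), (fun=> [::]); split=> //.
  - by move=> _ k; apply: Ck_cst.
  - by move=> f h X _ _ _; rewrite (big_pred1 tt) ?mul1r => [|[]].
  - by move=> A; rewrite /symb big_map big_nil /= (big_pred1 tt) ?big_nil ?mulr1 => [|[]].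
(* [inl] differentiates a coefficient and keeps the word; [inr] prepends a matrix unit, so that the
   dependence of [theta X v] on [X] moves into the coefficient. *)
exists (J + (J * I))%type,
  (fun j => match j with inl j => 'D_v (c j) | inr p => fun X => c p.1 X * theta X v p.2.1 p.2.2 end),
  (fun j => match j with inl j => w j | inr p => delta_mx p.2.1 p.2.2 :: w p.1 end).
split.
- case=> [j|[j k]] /=; last by rewrite ltnS.
  by apply: leq_trans (H1 j) _.
- case=> [j|[j k]] l.
    by have [_ /(_ v)] := H2 j l.+1.
  by apply: Ck_M oE (H2 j l) (Ck_theta _ _ _ _).
- move=> f h X Hf Dh EX.
  rewrite iderive_cons (cderive_ext oE EX v (fun y Ey => H3 f h y Hf Dh Ey)).
  have Hw j : csmooth expdet (fun X => wder (w j) f (h *m mexp X)).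
    by apply: (@csmooth_chart (wder (w j) f) h _ Dh); apply: csmooth_wder.
  have Hc j : csmooth expdet (fun X => (c j X)%:C) by apply: csmooth_real.
  rewrite (cderive_sum oE EX); last by move=> j; apply: (csmoothM oE (Hc j) (Hw j)).
  rewrite big_sumType /= -(pair_big xpredT xpredT (fun j k =>
     (c j X * theta X v k.1 k.2)%:C * lder (delta_mx k.1 k.2) (wder (w j) f) (h *m mexp X))) /=.
  rewrite -big_split; apply: eq_bigr => j _ /=.
  rewrite (cderiveM EX _ (Hc j) (Hw j)); congr (_ * _ + _).
    by rewrite /cderive /= derive_cst.
  have Hwj := csmooth_wder (w j) Hf.
  rewrite [cderive _ _ _](cderive_chart v Hwj Dh EX).
  rewrite (lder_delta _ Hwj (detposM Dh EX)) mulr_sumr; apply: eq_bigr => k _.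
  by rewrite rmorphM /= mulrA.
- move=> A; rewrite /symb big_map big_sumType /= big1 ?add0r; last first.
    by move=> j /eqP E; have := H1 j; rewrite E ltnn.
  rewrite -(pair_big_dep xpredT (fun j k => size (delta_mx k.1 k.2 :: w j) == (size vs).+1) (fun j k =>
     (c j 0 * theta 0 v k.1 k.2)%:C * \prod_(u <- delta_mx k.1 k.2 :: w j) (\tr (u *m A))%:C)) /=.
  rewrite big_cons -H4 /symb big_map mulr_sumr [RHS]big_mkcond; apply: eq_bigr => j _ /=.
  rewrite eqSS; case: eqP => _; last by rewrite big_pred0.
  under eq_bigr do rewrite big_cons theta0.
  have -> : \tr (v *m A) = \sum_(k : I) v k.1 k.2 * \tr (delta_mx k.1 k.2 *m A).
    rewrite [in LHS](matrix_sum_delta v) pair_big /= mulmx_suml raddf_sum.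
    by apply: eq_bigr => k _; rewrite /= -scalemxAl mxtraceZ.
  rewrite rmorph_sum mulr_suml; apply: eq_bigr => k _.
  by rewrite !rmorphM /=; move: (\prod_(_ <- _) _) => z; ring.
Qed.

End ExponentialChart.

Arguments expdet {R n}.

(** * From words to derivatives in the chart *)

Section WordsInChart.
Variables (R : realType) (n : nat).
Local Notation M := 'M[R]_n.+1.
Local Notation N := n.+1.
Local Notation II := ('I_n.+1 * 'I_n.+1)%type.
Implicit Types (f g : M -> R[i]) (A B h X Y v : M) (w : seq M).
Local Notation oO := (@open_detpos R n.+1).
Local Notation oE := (@open_expdet R n).

(* At [X = 0] this is the identity; inverting it nearby expresses a symmetric
   direction at [h *m mexp X] through a derivative along [ssym] in the chart. *)
Definition adjusted X v : M := sympart (theta X (sympart v)) + (v - sympart v).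

Lemma adjusted_linear X : linear (adjusted X).
Proof.
move=> a u v; rewrite /adjusted !sympart_linear theta_linear sympart_linear.
have E (p q u' v' : M) : a *: p + q + ((a *: u + v) - (a *: u' + v')) =
    a *: (p + (u - u')) + (q + (v - v')).
  by apply/matrixP => i j; rewrite !mxE; ring.
exact: E.
Qed.
HB.instance Definition _ X := GRing.isLinear.Build R M M _ (adjusted X) (adjusted_linear X).

Lemma sympartK v : sympart (sympart v) = sympart v.
Proof. by apply: sympart_id; exact: ssym_sympart. Qed.

Lemma sympartD A B : sympart (A + B) = sympart A + sympart B.
Proof. exact: raddfD. Qed.

Lemma sympartB A B : sympart (A - B) = sympart A - sympart B.
Proof. exact: raddfB. Qed.

Lemma sympartZ (a : R) A : sympart (a *: A) = a *: sympart A.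
Proof. by rewrite -[a *: A]addr0 sympart_linear raddf0 addr0. Qed.

Lemma sympart_adjusted X v : sympart (adjusted X v) = sympart (theta X (sympart v)).
Proof. by rewrite /adjusted sympartD sympartB !sympartK subrr addr0. Qed.

Definition adjustment X : 'M[R]_(N * N) := lin_mx (adjusted X).

Definition chartdom : set M := expdet `&` [set X | 0 < \det (adjustment X)].

Lemma Ck_sympart (k : nat) U (Z : M -> M) : open U ->
  (forall i j, Ck k U (fun X => Z X i j)) -> forall i j, Ck k U (fun X => sympart (Z X) i j).
Proof.
move=> oU HZ i j.
have H : Ck k U (fun X => 2^-1 * (Z X i j + Z X j i) +
    (- N%:R^-1 * (i == j)%:R) * (\sum_l Z X l l)).
  apply: Ck_D => //; apply: Ck_M => //; try exact: Ck_cst.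
    exact: Ck_D.
  by apply: Ck_sum.
apply: (Ck_ext oU _ H) => X _; rewrite /sympart /mxtrace !mxE.
by case: (i == j); rewrite ?mulr1n ?mulr0n; ring.
Qed.

Lemma Ck_adjusted (k : nat) v i j : Ck k expdet (fun X => adjusted X v i j).
Proof.
have H := Ck_D oE (Ck_sympart oE (fun a b => Ck_theta k (sympart v) a b) i j)
  (Ck_cst k expdet ((v - sympart v) i j)).
by apply: (Ck_ext oE _ H) => X _; rewrite [RHS]mxE.
Qed.

Lemma Ck_adjustment (k : nat) a b : Ck k expdet (fun X => adjustment X a b).
Proof.
case/mxvec_indexP: b => i j.
apply: (Ck_ext oE _ (Ck_adjusted k (vec_mx (delta_mx 0 a)) i j)) => X _.
by rewrite -[LHS]mxvecE [RHS]mxE.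
Qed.

Lemma adjustment0 : adjustment 0 = 1%:M.
Proof.
apply/row_matrixP => a; rewrite rowE mul_rV_lin /= /adjusted theta0 sympartK.
by rewrite subrKC vec_mxK row1.
Qed.

Lemma open_chartdom : open chartdom.
Proof.
rewrite openE => X [EX DX].
have C : {for X, continuous (fun X => \det (adjustment X))}.
  exact: (Ck_det oE (Ck_adjustment 0)).
rewrite /interior; apply: filterI; first exact: (open_nbhs_nbhs (conj oE EX)).
exact: (C [set r | 0 < r] (open_nbhs_nbhs (conj (@open_gt R 0) DX))).
Qed.
Local Notation oC := open_chartdom.

Lemma chartdom0 : chartdom 0.
Proof. by split; [exact: expdet0 | rewrite /= adjustment0 det1]. Qed.

Lemma chartdom_expdet : chartdom `<=` expdet.
Proof. by move=> X []. Qed.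

(** The direction in [ssym] whose logarithmic derivative equals [A] modulo vertical matrices
    ([sympart_theta_chartdir]), obtained by inverting [adjusted X]. *)
Definition chartdir A X : M :=
  sympart (vec_mx (mxvec (sympart A) *m invmx (adjustment X))).

Lemma Ck_chartdir (k : nat) A i j : Ck k chartdom (fun X => chartdir A X i j).
Proof.
apply: (Ck_sympart oC) => {}i {}j.
have HI : forall a b, Ck k chartdom (fun X => invmx (adjustment X) a b).
  apply: (Ck_invmx oC (phi := adjustment)); first by move=> X [].
  by move=> a b; apply: (Ck_sub chartdom_expdet); exact: Ck_adjustment.
have H : Ck k chartdom (fun X => \sum_a mxvec (sympart A) 0 a *
    invmx (adjustment X) a (mxvec_index i j)).
  apply: Ck_sum oC _ => a _; apply: Ck_M oC _ _ => //; exact: Ck_cst.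
by apply: (Ck_ext oC _ H) => X _; rewrite !mxE.
Qed.

Lemma sympart_theta_chartdir A X : chartdom X -> sympart (theta X (chartdir A X)) = sympart A.
Proof.
move=> [_ DX]; rewrite /chartdir; set v := vec_mx _.
rewrite -sympart_adjusted -[RHS]sympartK; congr sympart.
apply: (can_inj mxvecK); rewrite -mul_vec_lin vec_mxK -/(adjustment X) mulmxKV //.
by rewrite unitmxE unitfE gt_eqF.
Qed.

(** Words have constant letters. A vertical matrix that varies with the point is therefore spread
    over fixed vertical matrices, and its entries become coefficients. *)
Lemma expand_sympart0 A : sympart A = 0 ->
  A = \sum_(k : II) A k.1 k.2 *: (delta_mx k.1 k.2 - symbasis R k).
Proof.
move=> A0; have E : A = \sum_(k : II) A k.1 k.2 *: delta_mx k.1 k.2.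
  by rewrite [LHS]matrix_sum_delta pair_big.
have E0 : \sum_(k : II) A k.1 k.2 *: symbasis R k = 0.
  rewrite -[RHS]A0 [in RHS]E (raddf_sum (@sympart R n)); apply: eq_bigr => k _.
  exact/esym/sympartZ.
transitivity (\sum_(k : II) A k.1 k.2 *: delta_mx k.1 k.2 - \sum_(k : II) A k.1 k.2 *: symbasis R k).
  by rewrite E0 subr0.
by rewrite -sumrB; apply: eq_bigr => k _; exact/esym/scalerBr.
Qed.

(** A chart direction accounts for [A] up to a vertical matrix. The vertical term stays, because [f]
    will be a derivative of a spherical function and need not be spherical. *)
Lemma lder_chartdir A f h X : csmooth detpos f -> detpos h -> chartdom X ->
  lder A f (h *m mexp X) =
    \sum_(k : II) (chartdir A X k.1 k.2)%:C * cderive (symbasis R k) (chart f h) X +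
    \sum_(k : II) ((A - theta X (chartdir A X)) k.1 k.2)%:C *
      lder (delta_mx k.1 k.2 - symbasis R k) f (h *m mexp X).
Proof.
move=> Hf Dh CX; have EX := chartdom_expdet CX; have Dx := detpos_chart Dh EX.
set v := chartdir A X; set K := A - theta X v.
have Hc := csmooth_chart Hf Dh.
have EA : A = \sum_(b : bool) (1 : R) *: (if b then theta X v else K).
  by rewrite big_bool /= !scale1r addrC subrK.
rewrite {1}EA (lder_linear _ _ _ Hf Dx) big_bool /= !mul1r.
rewrite -(cderive_chart v Hf Dh EX); congr (_ + _).
  rewrite -(cderive_linear EX (index_enum _) (fun k : II => v k.1 k.2) (fun k => symbasis R k) Hc).
  by rewrite /v /chartdir -sympart_coord.
rewrite -(lder_linear (index_enum _) (fun k : II => K k.1 k.2) (fun k => delta_mx k.1 k.2 - symbasis R k) Hf Dx).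
have K0 : sympart K = 0 by rewrite /K sympartB sympart_theta_chartdir // subrr.
by rewrite -(expand_sympart0 K0).
Qed.

(** Coefficients and directions depend neither on [f] nor on the base point [h], so that one
    expression serves all charts. *)
Definition chartable (T : (M -> R[i]) -> M -> M -> R[i]) : Prop :=
  exists (J : finType) (a : J -> M -> R[i]) (vs : J -> seq M),
  [/\ forall j v, v \in vs j -> ssym v, forall j, csmooth chartdom (a j) &
      forall f h Y, spherical f -> detpos h -> chartdom Y ->
        T f h Y = \sum_j a j Y * iderive (vs j) (chart f h) Y].

Lemma chartable_ext T T' : (forall f h Y, spherical f -> detpos h -> chartdom Y ->
  T f h Y = T' f h Y) -> chartable T -> chartable T'.
Proof.
move=> E [J [a [vs [H1 H2 H3]]]]; exists J, a, vs; split=> // f h Y Sf Dh CY.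
by rewrite -E // H3.
Qed.

Lemma chartable0 : chartable (fun _ _ _ => 0).
Proof.
exists void, (fun _ _ => 0), (fun=> [::]); split; [by case | by case |].
by move=> f h Y _ _ _; rewrite big_pred0 => [|[]].
Qed.

Lemma chartableD T T' : chartable T -> chartable T' -> chartable (fun f h Y => T f h Y + T' f h Y).
Proof.
move=> [J [a [vs [H1 H2 H3]]]] [J' [a' [vs' [H1' H2' H3']]]].
exists (J + J')%type, (fun j => match j with inl i => a i | inr i => a' i end),
  (fun j => match j with inl i => vs i | inr i => vs' i end); split; try by case.
by move=> f h Y Sf Dh CY; rewrite big_sumType /= H3 // H3'.
Qed.

Lemma chartableM T (b : M -> R[i]) : csmooth chartdom b -> chartable T ->
  chartable (fun f h Y => b Y * T f h Y).
Proof.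
move=> Hb [J [a [vs [H1 H2 H3]]]]; exists J, (fun j Y => b Y * a j Y), vs; split=> //.
  by move=> j; apply: csmoothM oC _ _.
move=> f h Y Sf Dh CY; rewrite H3 // mulr_sumr.
by apply: eq_bigr => j _; rewrite mulrA.
Qed.

Lemma chartable_sum (K : eqType) (s : seq K) T : (forall k, k \in s -> chartable (T k)) ->
  chartable (fun f h Y => \sum_(k <- s) T k f h Y).
Proof.
elim: s => [|k s IH] H.
  by apply: chartable_ext chartable0 => f h Y _ _ _; rewrite big_nil.
have H1 : chartable (T k) by apply: H; rewrite mem_head.
have H2 : chartable (fun f h Y => \sum_(k <- s) T k f h Y).
  by apply: IH => l ls; apply: H; rewrite inE ls orbT.
by apply: chartable_ext (chartableD H1 H2) => f h Y _ _ _; rewrite big_cons.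
Qed.

Lemma csmooth_iderive_chart vs f h : spherical f -> detpos h ->
  csmooth chartdom (iderive vs (chart f h)).
Proof.
move=> [Hf _] Dh; apply: csmooth_iderive; apply: (csmooth_sub chartdom_expdet).
exact: csmooth_chart.
Qed.

Lemma chartable_cderive T B : ssym B -> chartable T ->
  chartable (fun f h Y => cderive B (T f h) Y).
Proof.
move=> HB [J [a [vs [H1 H2 H3]]]].
exists (J + J)%type, (fun j => match j with inl i => cderive B (a i) | inr i => a i end),
  (fun j => match j with inl i => vs i | inr i => B :: vs i end); split.
- case=> j v; first exact: H1.
  by rewrite inE => /orP[/eqP -> //|]; exact: H1.
- by case=> j //; apply: csmooth_cderive.
- move=> f h Y Sf Dh CY.
  have Hi j := csmooth_iderive_chart (vs j) Sf Dh.
  rewrite (cderive_ext oC CY B (fun y Cy => H3 f h y Sf Dh Cy)).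
  rewrite (cderive_sum oC CY); last by move=> j; apply: (csmoothM oC (H2 j) (Hi j)).
  rewrite big_sumType /= -big_split; apply: eq_bigr => j _.
  by rewrite (cderiveM CY _ (H2 j) (Hi j)).
Qed.

(** Strong induction on the length: the first letter gives chart derivatives of a shorter word, plus
    words that start with a vertical letter, which [low_vertical] replaces by shorter ones. *)
Lemma chartable_wder w : chartable (fun f h Y => wder w f (h *m mexp Y)).
Proof.
have [m wm] := ubnP (size w); elim: m w wm => // m IH [|A w] /= wm.
  exists unit, (fun _ _ => 1), (fun=> [::]); split=> //.
    by move=> _; exact: csmooth_cst.
  by move=> f h Y _ _ _; rewrite (big_pred1 tt) ?mul1r => [|[]].
have L1 (k : II) : chartable (fun f h Y => (chartdir A Y k.1 k.2)%:C *
    cderive (symbasis R k) (chart (wder w f) h) Y).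
  apply: chartableM; first by apply: csmooth_real => l; exact: Ck_chartdir.
  by apply: (@chartable_cderive (fun f h => chart (wder w f) h)); [exact: ssym_sympart | exact: IH].
have Hk (k : II) : csmooth chartdom (fun Y => ((A - theta Y (chartdir A Y)) k.1 k.2)%:C).
  apply: csmooth_real => l.
  have H : Ck l chartdom (fun Y => A k.1 k.2 + -1 * \sum_(q : II)
      chartdir A Y q.1 q.2 * theta Y (delta_mx q.1 q.2) k.1 k.2).
    apply: Ck_D oC _ _; first exact: Ck_cst.
    apply: Ck_M oC _ _; first exact: Ck_cst.
    apply: Ck_sum oC _ => q _; apply: Ck_M oC _ _; first exact: Ck_chartdir.
    by apply: (Ck_sub chartdom_expdet); exact: Ck_theta.
  apply: (Ck_ext oC _ H) => Y _; rewrite [RHS]mxE [X in _ = _ + X]mxE mulN1r; congr (_ - _).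
  move: (chartdir A Y) => v; rewrite [in RHS](matrix_sum_delta v) pair_big /= linear_sum summxE.
  by apply: eq_bigr => q _; rewrite linearZ [RHS]mxE.
have L2 (k : II) : chartable (fun f h Y => ((A - theta Y (chartdir A Y)) k.1 k.2)%:C *
      lder (delta_mx k.1 k.2 - symbasis R k) (wder w f) (h *m mexp Y)).
  apply: chartableM => //.
  have [e [He1 He2]] := low_vertical [::] w (vertical_sympart (delta_mx k.1 k.2)).
  have L : chartable (fun f h Y => \sum_(p <- e) p.1 * wder p.2 f (h *m mexp Y)).
    apply: chartable_sum => p pe; apply: chartableM; first exact: csmooth_cst.
    by apply: IH; apply: leq_trans (He1 p pe) _.
  apply: chartable_ext L => f h Y Sf Dh CY.
  by rewrite -[RHS]/(wder ([::] ++ (delta_mx k.1 k.2 - sympart (delta_mx k.1 k.2)) :: w) f _) He2 //;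
    exact: detpos_chart Dh (chartdom_expdet CY).
have L := chartableD (chartable_sum (fun k (_ : k \in index_enum _) => L1 k))
  (chartable_sum (fun k (_ : k \in index_enum _) => L2 k)).
apply: chartable_ext L => f h Y [Hf _] Dh CY.
by rewrite [RHS](lder_chartdir A (csmooth_wder w Hf) Dh CY).
Qed.

Lemma chartable_opsum e : chartable (fun f h Y => opsum e f (h *m mexp Y)).
Proof.
apply: chartable_sum => p _; apply: chartableM; first exact: csmooth_cst.
exact: chartable_wder.
Qed.

End WordsInChart.

(** * Constant coefficient operators and traces of powers of d/dX *)

Section ConstantCoefficients.
Variables (R : realType) (n : nat).
Local Notation M := 'M[R]_n.+1.
Local Notation N := n.+1.
Local Notation II := ('I_n.+1 * 'I_n.+1)%type.
Implicit Types (f g H : M -> R[i]) (A B X Y v x : M).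

Section Near.
Variables (U : set M) (H : M -> R[i]).
Hypotheses (oU : open U) (HH : csmooth U H).

Lemma iderive_sum_coord vs x : U x -> (forall v, v \in vs -> ssym v) ->
  iderive vs H x = \sum_(q <- expand_word vs) (q.1)%:C * iderive (map (@symbasis R n) q.2) H x.
Proof.
elim: vs x => [|v t IH] x Ux Hs; first by rewrite /= big_seq1 mul1r.
have Hv : ssym v by apply: Hs; rewrite mem_head.
have Ht u : u \in t -> ssym u by move=> ut; apply: Hs; rewrite inE ut orbT.
have Hi s : csmooth U (iderive s H) by apply: csmooth_iderive.
rewrite big_expand iderive_cons (cderive_ext oU Ux v (fun y Uy => IH y Uy Ht)).
rewrite (cderive_sum oU Ux); last by move=> q; apply: (csmoothM oU (csmooth_cst _ _) (Hi _)).
rewrite exchange_big; apply: eq_bigr => q _ /=.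
rewrite (cderiveZ Ux _ _ (Hi _)).
rewrite -[in LHS](sympart_id Hv) [in LHS]sympart_coord.
rewrite (cderive_linear Ux _ _ _ (Hi _)) mulr_sumr; apply: eq_bigr => k _.
by rewrite rmorphM /= mulrA [(q.1)%:C * _]mulrC.
Qed.

Lemma iderive_move (u : seq M) A (v : seq M) x : U x -> iderive (u ++ A :: v) H x = iderive (A :: u ++ v) H x.
Proof.
elim: u x => [|B u IH] x Ux //.
rewrite [LHS](cderive_ext oU Ux B IH).
exact: (cderive_swap oU Ux A B (csmooth_iderive (u ++ v) HH)).
Qed.

Lemma iderive_perm s t x : U x -> perm_eq s t -> iderive s H x = iderive t H x.
Proof.
elim: s t x => [|A s IH] t x Ux ps.
  by have -> : t = [::] by apply: perm_small_eq; rewrite // perm_sym.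
have At : A \in t by rewrite -(perm_mem ps) mem_head.
case/splitPr: At ps => u v ps.
have pt : perm_eq s (u ++ v).
  rewrite -(perm_cons A); apply: perm_trans ps _.
  by rewrite -[A :: v]cat1s perm_catCA /= perm_refl.
rewrite (iderive_move u A v Ux); apply: (cderive_ext oU Ux A) => y Uy.
exact: IH.
Qed.

(** The analogue of [low_symbol0] for derivatives in a vector space: these commute exactly, so an
    expression with vanishing polynomial is zero without any terms of lower order. *)
Lemma iderive_symbol0 (e : seq (R[i] * seq M)) x : U x ->
  (forall p v, p \in e -> v \in p.2 -> ssym v) ->
  (forall A, ssym A -> \sum_(p <- e) p.1 * \prod_(v <- p.2) (\tr (v *m A))%:C = 0) ->
  \sum_(p <- e) p.1 * iderive p.2 H x = 0.
Proof.
move=> Ux He Hs.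
pose Phi (s : seq II) := iderive (map (@symbasis R n) s) H x.
pose e1 := flatten [seq [seq (p.1 * (q.1)%:C, q.2) | q <- expand_word p.2] | p <- e].
have big_e1 (F : R[i] * seq II -> R[i]) : \sum_(t <- e1) F t =
    \sum_(p <- e) \sum_(q <- expand_word p.2) F (p.1 * (q.1)%:C, q.2).
  by rewrite big_flatten /= big_map; apply: eq_bigr => p _; rewrite big_map.
have Z : \sum_(t <- e1) t.1 * Phi t.2 = 0.
  apply: commutative_collect => [y|s t st]; last first.
    by apply: (iderive_perm Ux); apply: perm_map.
  rewrite big_e1 -[RHS](Hs _ (ssym_sympart (\matrix_(i, j) y (j, i)))).
  apply: eq_bigr => p _.
  rewrite [LHS](eq_bigr (fun q => p.1 * ((q.1)%:C * \prod_(k <- q.2) (y k)%:C))); last first.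
    by move=> q _; rewrite mulrA.
  rewrite -mulr_sumr expand_prod; congr (_ * _).
  by apply: eq_bigr => v _; rewrite trace_sympart_mul.
rewrite -[RHS]Z big_e1; apply: eq_big_seq => p pe.
rewrite (iderive_sum_coord Ux (fun v => He p v pe)) mulr_sumr.
by apply: eq_bigr => q _; rewrite mulrA.
Qed.

End Near.

(** The direction whose derivative is the entry [dX i j], the factor 1/2 included; the trace form
    pairs it with a symmetric [A] to [A i j]. *)
Definition symunit (i j : 'I_n.+1) : M := 2^-1 *: (delta_mx i j + delta_mx j i).

Fixpoint power_words (k : nat) (i j : 'I_n.+1) : seq (seq M) :=
  if k is k'.+1 then
    flatten [seq [seq symunit i l :: s | s <- power_words k' l j] | l <- index_enum 'I_n.+1]
  else if i == j then [:: [::]] else [::].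

Definition trace_words (k : nat) : seq (seq M) :=
  flatten [seq power_words k i i | i <- index_enum 'I_n.+1].

Lemma big_power_words (V : nmodType) k i j (F : seq M -> V) :
  \sum_(s <- power_words k.+1 i j) F s =
  \sum_l \sum_(s <- power_words k l j) F (symunit i l :: s).
Proof. by rewrite big_flatten /= big_map; apply: eq_bigr => l _; rewrite big_map. Qed.

Lemma big_trace_words (V : nmodType) k (F : seq M -> V) :
  \sum_(s <- trace_words k) F s = \sum_i \sum_(s <- power_words k i i) F s.
Proof. by rewrite big_flatten /= big_map. Qed.

Lemma size_power_words k i j s : s \in power_words k i j -> size s = k.
Proof.
elim: k i j s => [|k IH] i j s /=; first by case: ifP => // _; rewrite inE => /eqP ->.
by move=> /flatten_mapP[l _] /mapP[t /IH <- ->].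
Qed.

Lemma size_trace_words k s : s \in trace_words k -> size s = k.
Proof. by move=> /flatten_mapP[i _]; exact: size_power_words. Qed.

Lemma symunit_sym i j : (symunit i j)^T = symunit i j.
Proof.
apply/matrixP => a b; rewrite !mxE; congr (_ * _).
by rewrite addrC; congr (_%:R + _%:R); rewrite andbC.
Qed.

Lemma symunit_diag l : symunit l l = delta_mx l l.
Proof. by apply/matrixP => a b; rewrite !mxE; field. Qed.

Lemma power_words_sym k i j s v : s \in power_words k i j -> v \in s -> v^T = v.
Proof.
elim: k i j s => [|k IH] i j s /=; first by case: ifP => // _; rewrite inE => /eqP ->.
move=> /flatten_mapP[l _] /mapP[t tk ->]; rewrite inE => /orP[/eqP ->|]; last exact: IH tk.
exact: symunit_sym.
Qed.

Lemma trace_words_sym k s v : s \in trace_words k -> v \in s -> v^T = v.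
Proof. by move=> /flatten_mapP[i _]; exact: power_words_sym. Qed.

Lemma trace_symunit A i j : A^T = A -> \tr (symunit i j *m A) = A i j.
Proof.
move=> As; have E a b : \tr (delta_mx a b *m A) = A b a.
  rewrite /mxtrace (bigD1 a) //= big1 ?addr0 => [|c ca].
    rewrite mxE (bigD1 b) //= big1 ?addr0 => [|c cb]; first by rewrite mxE !eqxx mul1r.
    by rewrite mxE eqxx (negbTE cb) mul0r.
  by rewrite mxE big1 // => d _; rewrite mxE (negbTE ca) mul0r.
have Aij : A j i = A i j by rewrite -{1}As mxE.
rewrite /symunit -scalemxAl mxtraceZ mulmxDl mxtraceD !E Aij; by field.
Qed.

Lemma power_words_symbol A k i j : A^T = A ->
  \sum_(s <- power_words k i j) \prod_(v <- s) (\tr (v *m A))%:C = ((A ^+ k) i j)%:C.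
Proof.
move=> As; elim: k i => [|k IH] i.
  rewrite /= expr0 mxE; case: eqP => _; first by rewrite big_seq1 big_nil.
  by rewrite big_nil.
rewrite big_power_words exprS -[A * _]/(A *m _) mxE rmorph_sum; apply: eq_bigr => l _.
rewrite rmorphM /= -IH mulr_sumr; apply: eq_bigr => s _.
by rewrite big_cons trace_symunit.
Qed.

Lemma trace_words_symbol A k : A^T = A ->
  \sum_(s <- trace_words k) \prod_(v <- s) (\tr (v *m A))%:C = (\tr (A ^+ k))%:C.
Proof.
by move=> As; rewrite big_trace_words rmorph_sum; apply: eq_bigr => i _; exact: power_words_symbol.
Qed.

Lemma opmx_pow_words U f k i j x : open U -> csmooth U f -> U x ->
  opmx_pow (@dX R N) k i j f x = \sum_(s <- power_words k i j) iderive s f x.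
Proof.
move=> oU Hf; elim: k i x => [|k IH] i x Ux.
  by rewrite /=; case: eqP => _; rewrite ?big_seq1 ?big_nil.
rewrite big_power_words /=; apply: eq_bigr => l _.
have Hi s : csmooth U (iderive s f) by apply: csmooth_iderive.
transitivity (cderive (symunit i l) (opmx_pow (@dX R N) k l j f) x).
  have Hk : csmooth U (opmx_pow (@dX R N) k l j f).
    by apply: (csmooth_ext oU (fun y Uy => esym (IH l y Uy))); apply: csmooth_sum.
  rewrite /dX; case: eqP => [->|_].
    by rewrite symunit_diag.
  have := cderive_linear Ux [:: tt] (fun=> 2^-1) (fun=> delta_mx i l + delta_mx l i) Hk.
  rewrite !big_seq1 -/(symunit i l) => ->; congr (_ * _).
  by rewrite fmorphV rmorph_nat.
rewrite (cderive_ext oU Ux _ (fun y Uy => IH l y Uy)).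
exact: (cderive_sum oU Ux _ _ Hi).
Qed.

Lemma opmx_trace_words U f k x : open U -> csmooth U f -> U x ->
  opmx_trace (opmx_pow (@dX R N) k) f x = \sum_(s <- trace_words k) iderive s f x.
Proof.
move=> oU Hf Ux; rewrite big_trace_words; apply: eq_bigr => i _.
exact: opmx_pow_words oU Hf Ux.
Qed.

End ConstantCoefficients.

(** * Lifts of functions on SL_n / SO_n *)

Section Cosets.
Variables (R : realType) (n : nat).
Local Notation M := 'M[R]_n.+1.
Local Notation N := n.+1.
Implicit Types (x y k g : M).

Lemma orthmx_quotient x y : x \in unitmx -> y \in unitmx ->
  orthmx (invmx x *m y) <-> x *m x^T = y *m y^T.
Proof.
move=> ux uy; have uxT : x^T \in unitmx by rewrite unitmx_tr.
have E : y *m y^T = x *m (invmx x *m y) *m (invmx x *m y)^T *m x^T.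
  by rewrite mulKVmx // trmx_mul trmx_inv -!mulmxA mulVmx // mulmx1.
split=> [/eqP/mulmx1C oxy|xy]; first by rewrite E -(mulmxA x) oxy mulmx1.
apply/eqP/mulmx1C.
have : x *m ((invmx x *m y) *m (invmx x *m y)^T) *m x^T = x *m 1%:M *m x^T.
  by rewrite mulmx1 xy E !mulmxA.
by move/(can_inj (mulmxK uxT))/(can_inj (mulKmx ux)).
Qed.

Lemma SPos_coset_val (g : SL R N) : SPos_coset (val g) = \pi_(SPos R N)%qT g.
Proof. by rewrite /SPos_coset valKd. Qed.

Lemma SPos_cosetP (z : SPos R N) : \det (val (repr z)) = 1 /\ z = SPos_coset (val (repr z)).
Proof. by split; [exact/eqP/(valP (repr z)) | rewrite SPos_coset_val reprK]. Qed.

Lemma SPos_coset_eq x y : \det x = 1 -> \det y = 1 ->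
  SPos_coset x = SPos_coset y <-> x *m x^T = y *m y^T.
Proof.
move=> /eqP dx /eqP dy.
have ux : x \in unitmx by rewrite unitmxE (eqP dx) unitr1.
have uy : y \in unitmx by rewrite unitmxE (eqP dy) unitr1.
have vx : val (insubd (@SL1 R N) x) = x by rewrite insubdK.
have vy : val (insubd (@SL1 R N) y) = y by rewrite insubdK.
rewrite -(orthmx_quotient ux uy) /SPos_coset; split.
  by move/eqP; rewrite eqmodE /= /spos_rel vx vy => /andP[].
move=> oxy; apply/eqP; rewrite eqmodE /= /spos_rel vx vy /sorthmx oxy.
by rewrite det_mulmx det_inv (eqP dx) (eqP dy) invr1 mul1r eqxx.
Qed.

Lemma Pos_coset_eq x y : x \in unitmx -> y \in unitmx ->
  Pos_coset x = Pos_coset y <-> x *m x^T = y *m y^T.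
Proof.
move=> ux uy; rewrite -(orthmx_quotient ux uy) /Pos_coset.
have vx : val (insubd (@GL1 R N) x) = x by rewrite insubdK.
have vy : val (insubd (@GL1 R N) y) = y by rewrite insubdK.
split; first by move/eqP; rewrite eqmodE /= /pos_rel vx vy.
by move=> oxy; apply/eqP; rewrite eqmodE /= /pos_rel vx vy.
Qed.

Definition normalize x : M := (\det x `^ (- N%:R^-1)) *: x.

Lemma det_normalize x : detpos x -> \det (normalize x) = 1.
Proof.
move=> Dx; rewrite /normalize detZ -powR_mulrn ?powR_ge0 // -powRrM mulNr mulVf ?pnatr_eq0 //.
by rewrite powR_inv1 ?(ltW Dx) // mulVf // gt_eqF.
Qed.

Lemma detpos_det1 x : \det x = 1 -> detpos x.
Proof. by move=> d1; rewrite /detpos /= d1. Qed.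

Lemma normalize_id x : \det x = 1 -> normalize x = x.
Proof. by move=> d1; rewrite /normalize d1 powR1 scale1r. Qed.

Lemma mulmx_tr_scale (a : R) x : (a *: x) *m (a *: x)^T = (a * a) *: (x *m x^T).
Proof. by rewrite (linearZ_LR (@trmx R N N)) /= -scalemxAl -scalemxAr scalerA. Qed.

Lemma normalize_eq x y (c : R) : detpos x -> detpos y -> 0 < c ->
  x *m x^T = c *: (y *m y^T) -> SPos_coset (normalize x) = SPos_coset (normalize y).
Proof.
move=> Dx Dy c0 E; have dx := det_normalize Dx; have dy := det_normalize Dy.
apply/(SPos_coset_eq dx dy).
pose a := \det x `^ (- N%:R^-1); pose b := \det y `^ (- N%:R^-1).
have a0 : 0 < a by exact: powR_gt0.
have b0 : 0 < b by exact: powR_gt0.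
pose s := a * a * c / (b * b).
have s0 : 0 < s by rewrite divr_gt0 ?mulr_gt0.
have E1 : normalize x *m (normalize x)^T = s *: (normalize y *m (normalize y)^T).
  rewrite /normalize -/a -/b !mulmx_tr_scale E !scalerA /s divfK //.
  by rewrite mulf_neq0 ?gt_eqF.
(* Determinants turn proportionality of the two products into [s ^+ N = 1], and a positive [s] must
   then be 1. *)
have := congr1 determinant E1; rewrite detZ !det_mulmx !det_tr dx dy !mulr1 => sN.
suff s1 : s = 1 by rewrite E1 s1 scale1r.
by apply/eqP; rewrite -(@eqrXn2 R N) ?ltW ?ltr01 // expr1n -sN.
Qed.

(** [x] may have negative determinant; whatever representative [xget] picks, the result is given by
    any [y] of positive determinant with the same product. *)
Lemma proj_coset x y : x \in unitmx -> detpos y -> x *m x^T = y *m y^T ->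
  Defs.proj (Pos_coset x) = SPos_coset (normalize y).
Proof.
move=> ux Dy E; rewrite /Defs.proj; set P := [set g : GL R N | _].
have uy := detpos_unit Dy.
have [Eg Dg] : P (xget (repr (Pos_coset x)) P).
  apply: xgetPex; exists (insubd (@GL1 R N) y); rewrite /P /=; split.
    exact/esym/(Pos_coset_eq ux uy).
  by rewrite insubdK.
move: (xget _ P) Eg Dg => g Eg Dg.
apply: (@normalize_eq (val g) y 1) => //; rewrite scale1r -E.
by apply/(Pos_coset_eq (valP g) ux); rewrite /Pos_coset valKd.
Qed.

End Cosets.

Section Lifts.
Variables (R : realType) (n : nat).
Local Notation M := 'M[R]_n.+1.
Local Notation N := n.+1.
Implicit Types (f : SPos R n.+1 -> R[i]) (x y k g A X Y : M) (h H : M -> R[i]).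
Local Notation oO := (@open_detpos R n.+1).

Definition lift_fun f : M -> R[i] := fun x => f (SPos_coset (normalize x)).

Lemma lift_funE f x : \det x = 1 -> lift_fun f x = f (SPos_coset x).
Proof. by move=> d1; rewrite /lift_fun normalize_id. Qed.

Lemma Ck_normalize (m : nat) i j : Ck m detpos (fun x => normalize x i j).
Proof.
have Hd : Ck m detpos (fun x : M => \det x `^ (- N%:R^-1)).
  by apply: (Ck_powR _ oO) => //; apply: (Ck_det oO) => a b; exact: Ck_coord.
by apply: (Ck_ext oO _ (Ck_M oO Hd (Ck_coord m detpos i j))) => x _; rewrite mxE.
Qed.

Lemma spherical_lift f : smooth f -> spherical (lift_fun f).
Proof.
move=> [Hr Hi]; split; last by move=> x y c Dx Dy c0 E; rewrite /lift_fun (normalize_eq Dx Dy c0 E).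
have K (F : M -> R) : smooth_real_on [set g : M | \det g = 1] F ->
    forall m, Ck m detpos (F \o @normalize R n).
  move=> HF m; apply: (Ck_local oO) => x Dx.
  have [U [G [oU Ux HG FG]]] := HF _ (det_normalize Dx).
  pose V := detpos `&` (@normalize R n) @^-1` U.
  have oV : open V.
    rewrite openE => y [Dy Uy]; rewrite /interior; apply: filterI.
      exact: (open_nbhs_nbhs (conj oO Dy)).
    have C : {for y, continuous (@normalize R n)}.
      by apply: continuous_mx => i j; exact: (Ck_normalize 0 i j).
    exact: (C U (open_nbhs_nbhs (conj oU Uy))).
  have sV : V `<=` detpos by move=> y [].
  exists V; split=> //.
  apply: (Ck_ext oV _ (Ck_comp (U' := U) (phi := @normalize R n) (G := G) oV _ _ (HG m))).
  - by move=> y [Dy Uy]; rewrite /= FG //; split=> //; exact: det_normalize.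
  - by move=> y [].
  - by move=> i j; exact: (Ck_sub sV (Ck_normalize m i j)).
by split=> m; [exact: (K _ Hr) | exact: (K _ Hi)].
Qed.

Lemma smooth_intro f h : csmooth detpos h ->
  (forall x, \det x = 1 -> f (SPos_coset x) = h x) -> smooth f.
Proof.
move=> [Hr Hi] E; split=> x Dx.
  exists detpos, (fun x => complex.Re (h x)); split=> //.
  - exact: oO.
  - exact: detpos_det1.
  - by move=> y [_ Dy]; rewrite E.
exists detpos, (fun x => complex.Im (h x)); split=> //.
- exact: oO.
- exact: detpos_det1.
- by move=> y [_ Dy]; rewrite E.
Qed.

Lemma spherical_scale h (c : R) x : spherical h -> 0 < c -> detpos x -> h (c *: x) = h x.
Proof.
move=> [_ Hi] c0 Dx; apply: (Hi _ _ (c * c)) => //; last exact: mulmx_tr_scale.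
  by rewrite /detpos /= detZ mulr_gt0 ?exprn_gt0.
exact: mulr_gt0.
Qed.

Lemma wder_scale w h (c : R) x : spherical h -> 0 < c -> detpos x ->
  wder w h (c *: x) = wder w h x.
Proof.
move=> Sh c0 Dx; have Dc : detpos (c%:M : M) by rewrite /detpos /= det_scalar exprn_gt0.
rewrite -mul_scalar_mx -(wder_left w Sh.1 Dc Dx); apply: wder_ext Dx => y Dy.
by rewrite mul_scalar_mx spherical_scale.
Qed.

Lemma opsum_normalize e h x : spherical h -> detpos x -> opsum e h (normalize x) = opsum e h x.
Proof.
move=> Sh Dx; rewrite /opsum; apply: eq_bigr => p _; congr (_ * _).
by apply: wder_scale => //; exact: powR_gt0.
Qed.

Lemma spherical_lift_exists h : spherical h -> exists2 f, smooth f &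
  forall x, detpos x -> lift_fun f x = h x.
Proof.
move=> [Hh Hi]; pose f (z : SPos R N) := h (val (repr z)).
have E x : \det x = 1 -> f (SPos_coset x) = h x.
  move=> d1; have [dr zr] := SPos_cosetP (SPos_coset x).
  apply: (Hi _ _ 1) => //; rewrite ?scale1r; try exact: detpos_det1.
  exact/esym/(SPos_coset_eq d1 dr).
exists f; first exact: smooth_intro Hh E.
move=> x Dx; rewrite /lift_fun E ?det_normalize //.
by apply: spherical_scale => //; exact: powR_gt0.
Qed.

Lemma SPos_fun_eq (T : Type) (F G : SPos R N -> T) :
  (forall x, \det x = 1 -> F (SPos_coset x) = G (SPos_coset x)) -> F = G.
Proof.
move=> E; apply/funext => z; have [d1 ->] := SPos_cosetP z; exact: E.
Qed.

Lemma translation_coset (g : SL R N) x : \det x = 1 ->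
  translation g (SPos_coset x) = SPos_coset (val g *m x).
Proof.
move=> d1; rewrite /translation; have [dr zr] := SPos_cosetP (SPos_coset x).
move: (val (repr _)) dr zr => r dr zr.
have dg : \det (val g) = 1 by exact/eqP/(valP g).
apply/SPos_coset_eq; rewrite ?det_mulmx ?dg ?dr ?d1 ?mul1r //.
rewrite !trmx_mul !mulmxA -(mulmxA (val g) r) -(mulmxA (val g) x).
by have -> : r *m r^T = x *m x^T by exact/esym/(SPos_coset_eq d1 dr).
Qed.

Lemma lift_translation f (g : SL R N) x : detpos x ->
  lift_fun (f \o translation g) x = lift_fun f (val g *m x).
Proof.
move=> Dx; have dg : \det (val g) = 1 by exact/eqP/(valP g).
rewrite /lift_fun /= translation_coset ?det_normalize // /normalize.
by rewrite det_mulmx dg mul1r -scalemxAr.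
Qed.

Lemma smooth_translation f (g : SL R N) : smooth f -> smooth (f \o translation g).
Proof.
move=> Hf; have dg : \det (val g) = 1 by exact/eqP/(valP g).
have Sh := (spherical_lift Hf).1.
apply: (@smooth_intro _ (fun x => lift_fun f (val g *m x))).
  apply: (csmooth_comp (U' := detpos) (phi := fun x => val g *m x) oO _ _ Sh).
    by move=> x Dx; apply: detposM => //; exact: detpos_det1.
  by move=> m i j; exact: (Ck_mulmxl _ _ _ _ oO).
move=> x d1; rewrite -lift_translation ?lift_funE //; exact: detpos_det1.
Qed.

End Lifts.

(** * The exponential chart on symmetric matrices *)

Section SymmetricExponential.
Variables (R : realType) (n : nat).
Local Notation M := 'M[R]_n.+1.
Local Notation N := n.+1.
Implicit Types (f : SPos R n.+1 -> R[i]) (x y k g A X Y v : M) (h H : M -> R[i]).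
Local Notation oE := (@open_expdet R n).
Local Notation oO := (@open_detpos R n.+1).

Lemma mexp_spectral (k : M) (d : 'rV[R]_n.+1) : k^T *m k = 1%:M ->
  mexp (k *m diag_mx d *m k^T) = k *m diag_mx (map_mx expR d) *m k^T.
Proof. by move=> kk; rewrite mexp_conj // mexp_diag. Qed.

(** The trace part of [X] is central and contributes only a positive factor, which spherical
    functions ignore. *)
Lemma mexp_sympart X : X^T = X -> exists2 c : R, 0 < c & mexp X = c *: mexp (sympart X).
Proof.
move=> Xs; have [k [d [kk _ E]]] := special_diagonalizable Xs.
pose s := N%:R^-1 * \tr X; exists (expR s); first exact: expR_gt0.
have kk' := mulmx1C kk.
have -> : sympart X = k *m diag_mx (\row_i (d 0 i - s)) *m k^T.
  have -> : sympart X = X - s%:M.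
    rewrite /sympart Xs -/s; congr (_ - _).
    by apply/matrixP => i j; rewrite !mxE; field.
  have -> : s%:M = k *m diag_mx (\row_i s) *m k^T.
    have -> : diag_mx (\row_i s) = s%:M :> M by apply/matrixP => i j; rewrite !mxE.
    by rewrite mul_mx_scalar -scalemxAl kk' scalemx1.
  rewrite {1}E -mulmxBl -mulmxBr; congr (_ *m _ *m _).
  by apply/matrixP => i j; rewrite !mxE mulrnBl.
rewrite {1}E !mexp_spectral // scalemxAl scalemxAr; congr (_ *m _ *m _).
apply/matrixP => i j; rewrite !mxE mulrnAr; congr (_ *+ _).
by rewrite -expRD addrC subrK.
Qed.

Lemma det_mexp_sym X : X^T = X -> \det (mexp X) = expR (\tr X).
Proof.
move=> Xs; have [k [d [kk k1 E]]] := special_diagonalizable Xs.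
rewrite E (mexp_spectral _ kk) !det_mulmx det_tr k1 mul1r mulr1 det_diag.
rewrite mxtrace_mulC mulmxA kk mul1mx mxtrace_diag.
rewrite [RHS](big_morph expR (@expRD R) (@expR0 R)).
by apply: eq_bigr => i _; rewrite mxE.
Qed.

Lemma det_mexp_ssym Y : ssym Y -> \det (mexp Y) = 1.
Proof. by move=> [Ys Yt]; rewrite det_mexp_sym // Yt expR0. Qed.

Lemma expdet_sym X : X^T = X -> expdet X.
Proof. by move=> Xs; rewrite /expdet /= det_mexp_sym // expR_gt0. Qed.

(** Every difference quotient only uses values on a line that stays in [P], so the functions need
    not agree elsewhere, and no smoothness enters. *)
Lemma iderive_transfer (P : M -> Prop) (phi : M -> M) H H' vs X :
  (forall t v Y, P v -> P Y -> P (t *: v + Y)) -> linear phi ->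
  (forall Y, P Y -> H Y = H' (phi Y)) -> (forall v, v \in vs -> P v) -> P X ->
  iderive vs H X = iderive (map phi vs) H' (phi X).
Proof.
move=> Plin phi_lin E; elim: vs X => [|v vs IH] X Pvs PX; first exact: E.
have Pv : P v by apply: Pvs; rewrite mem_head.
apply: cderive_line; near=> t.
rewrite -phi_lin; apply: IH; last exact: Plin.
by move=> u us; apply: Pvs; rewrite inE us orbT.
Unshelve. all: by end_near. Qed.

Lemma iderive_restrict H H' vs Y : (forall Z, ssym Z -> H Z = H' Z) ->
  (forall v, v \in vs -> ssym v) -> ssym Y -> iderive vs H Y = iderive vs H' Y.
Proof.
move=> E Hvs HY.
have := @iderive_transfer (@ssym R N) id H H' vs Y (fun t v Z => @ssym_lin R n t v Z) (fun _ _ _ => erefl) E Hvs HY.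
by rewrite map_id.
Qed.

(** This is the passage from Sym_n to SSym_n in the radial part: derivatives in scalar directions
    contribute nothing. *)
Lemma iderive_chart_sympart h x vs : spherical h -> detpos x ->
  (forall v, v \in vs -> v^T = v) ->
  iderive vs (chart h x) 0 = iderive (map (@sympart R n) vs) (chart h x) 0.
Proof.
move=> Sh Dx Hvs.
have S0 : sympart (0 : M) = 0 by exact: raddf0.
rewrite -[X in _ = iderive _ _ X]S0.
apply: (iderive_transfer (P := fun v => v^T = v)) => //; last exact: trmx0.
- move=> t v Y vs' Ys; apply/matrixP => i j.
  have vij : v j i = v i j by rewrite -{1}vs' mxE.
  have Yij : Y j i = Y i j by rewrite -{1}Ys mxE.
  by rewrite !mxE vij Yij.
- exact: sympart_linear.
- move=> Y Ys; rewrite /chart; have [c c0 ->] := mexp_sympart Ys.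
  rewrite -scalemxAr; apply: spherical_scale => //.
  by apply: detposM => //; apply: expdet_sym; have [] := ssym_sympart Y.
Qed.

Lemma iderive_chart_conj h x k vs : k^T *m k = 1%:M ->
  iderive vs (fun X => h (x *m k *m mexp X *m k^T)) 0 =
  iderive [seq k *m v *m k^T | v <- vs] (chart h x) 0.
Proof.
move=> kk.
have k0 : k *m 0 *m k^T = 0 by rewrite mulmx0 mul0mx.
rewrite -[X in _ = iderive _ _ X]k0.
apply: (iderive_transfer (P := fun=> True) (phi := fun v => k *m v *m k^T)) => //.
- by move=> a u v; rewrite mulmxDr mulmxDl -scalemxAr -scalemxAl.
- by move=> Y _; rewrite /chart mexp_conj // !mulmxA.
Qed.

Lemma ssym_conj k A : k^T *m k = 1%:M -> ssym A -> ssym (k^T *m A *m k).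
Proof.
move=> kk [As At]; split; first by rewrite !trmx_mul trmxK As mulmxA.
by rewrite mxtrace_mulC mulmxA (mulmx1C kk) mul1mx.
Qed.

Lemma trace_conj_pow k A m : k^T *m k = 1%:M -> \tr ((k^T *m A *m k) ^+ m) = \tr (A ^+ m).
Proof.
move=> kk; have -> : (k^T *m A *m k) ^+ m = k^T *m A ^+ m *m k.
  elim: m => [|m IH]; first by rewrite !expr0 mulmx1 kk.
  rewrite !exprS IH -[_ * (k^T *m A ^+ m *m k)]/(_ *m _) -[A * A ^+ m]/(A *m _) !mulmxA.
  by rewrite -(mulmxA (k^T *m A)) (mulmx1C kk) mulmx1.
by rewrite mxtrace_mulC mulmxA (mulmx1C kk) mul1mx.
Qed.

(** The explicit form of tr((d/dY)^m): the words of tr((d/dX)^m) with letters projected to [ssym].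
    For [m = 2] it is the flat Laplacian. *)
Definition laplace (m : nat) H (X : M) : R[i] :=
  \sum_(s <- trace_words R n m) iderive (map (@sympart R n) s) H X.

Lemma laplace_symbol m A : ssym A ->
  \sum_(s <- trace_words R n m) \prod_(v <- map (@sympart R n) s) (\tr (v *m A))%:C =
  (\tr (A ^+ m))%:C.
Proof.
move=> HA; rewrite -(trace_words_symbol m HA.1); apply: eq_bigr => s _.
by rewrite big_map; apply: eq_bigr => v _; rewrite trace_sympart.
Qed.

Lemma Ck_trace_mul (m : nat) A : Ck m setT (fun Z : M => \tr (Z *m A)).
Proof. by apply: Ck_sum openT _ => i _; exact: Ck_mulmxr openT. Qed.

Lemma cderive_expfun v A Y : cderive v (expfun A) Y = (\tr (v *m A))%:C * expfun A Y.
Proof.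
rewrite /cderive /expfun /= derive_cst.
have L : 'D_v (fun Z : M => \tr (Z *m A)) Y = \tr (v *m A).
  apply: derive_scalar_linear => a u w.
  by rewrite mulmxDl -scalemxAl mxtraceD mxtraceZ.
have dT : differentiable (fun Z : M => \tr (Z *m A)) Y by exact: (Ck_diff (Ck_trace_mul 1 A)).
have [_ ->] := derive_comp_real v (is_derive_expR _) dT.
by rewrite L mulrC -[_ +i* 0]/(_%:C) rmorphM.
Qed.

Lemma iderive_expfun vs A Y :
  iderive vs (expfun A) Y = \prod_(v <- vs) (\tr (v *m A))%:C * expfun A Y.
Proof.
elim: vs Y => [|v vs IH] Y; first by rewrite big_nil mul1r.
have := @cderive_ext R n.+1 setT Y openT Logic.I v _ _ (fun y _ => IH y).
rewrite iderive_cons => ->.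
have Hs : csmooth setT (expfun A).
  by apply: csmooth_real => k; apply: Ck_expR openT _; exact: Ck_trace_mul.
rewrite (cderiveZ Logic.I _ _ Hs) cderive_expfun big_cons.
by rewrite mulrCA mulrA.
Qed.

End SymmetricExponential.

(** * Radial parts of the Maass-Selberg operators *)

Section RadialParts.
Variables (R : realType) (n : nat).
Local Notation M := 'M[R]_n.+1.
Local Notation N := n.+1.
Implicit Types (f : SPos R n.+1 -> R[i]) (x y k g A X Y v : M) (h H : M -> R[i]).
Implicit Types (e : seq (R[i] * seq M)).
Local Notation oE := (@open_expdet R n).
Local Notation oO := (@open_detpos R n.+1).

Lemma iderive_ext (U : set M) vs H H' X : open U -> U X -> (forall Y, U Y -> H Y = H' Y) ->
  iderive vs H X = iderive vs H' X.
Proof.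
move=> oU UX E; elim: vs X UX => [|v vs IH] X UX; first exact: E.
exact: (cderive_ext oU UX v IH).
Qed.

Lemma iderive_symbol_eq (U : set M) H X e e' : open U -> csmooth U H -> U X ->
  (forall p v, p \in e ++ e' -> v \in p.2 -> ssym v) ->
  (forall A, ssym A -> \sum_(p <- e) p.1 * \prod_(v <- p.2) (\tr (v *m A))%:C =
     \sum_(p <- e') p.1 * \prod_(v <- p.2) (\tr (v *m A))%:C) ->
  \sum_(p <- e) p.1 * iderive p.2 H X = \sum_(p <- e') p.1 * iderive p.2 H X.
Proof.
move=> oU HH UX He Hs; apply/eqP; rewrite -subr_eq0.
have E (F : seq M -> R[i]) : \sum_(p <- e ++ [seq (- p.1, p.2) | p <- e']) p.1 * F p.2 =
    \sum_(p <- e) p.1 * F p.2 - \sum_(p <- e') p.1 * F p.2.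
  rewrite big_cat big_map -sumrN; congr (_ + _).
  by apply: eq_bigr => p _; rewrite mulNr.
rewrite -(E (fun vs => iderive vs H X)); apply/eqP.
apply: (iderive_symbol0 oU HH UX).
  move=> p v; rewrite mem_cat => /orP[pe|/mapP[q qe ->]] /=.
    by apply: He; rewrite mem_cat pe.
  by apply: (He q); rewrite mem_cat qe orbT.
by move=> A HA; rewrite (E (fun vs => \prod_(v <- vs) (\tr (v *m A))%:C)) Hs // subrr.
Qed.

Definition laplace_expr m : seq (R[i] * seq M) :=
  [seq (1, map (@sympart R n) s) | s <- trace_words R n m].

Lemma laplaceE m H X : laplace m H X = \sum_(p <- laplace_expr m) p.1 * iderive p.2 H X.
Proof. by rewrite big_map; apply: eq_bigr => s _; rewrite mul1r. Qed.

Lemma laplace_expr_ssym m p v : p \in laplace_expr m -> v \in p.2 -> ssym v.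
Proof. by move=> /mapP[s _ ->] /= /mapP[u _ ->]; exact: ssym_sympart. Qed.

Lemma laplace_expr_symbol m A : ssym A ->
  \sum_(p <- laplace_expr m) p.1 * \prod_(v <- p.2) (\tr (v *m A))%:C = (\tr (A ^+ m))%:C.
Proof.
move=> HA; rewrite big_map -(laplace_symbol m HA).
by apply: eq_bigr => s _; rewrite mul1r.
Qed.

(** [Qop] is a choice, known only by its characterization. [laplace] shows that the characterization
    can be met; evaluating the chosen operator on exponentials at 0 reveals its polynomial, which
    fixes its value on smooth functions. *)
Lemma trace_dY_laplace m f x : smooth f -> \det x = 1 ->
  trace_dY m (fun Y => f (SPos_coset (x *m mexp Y))) 0 = laplace m (chart (lift_fun f) x) 0.
Proof.
move=> Hf d1; have Dx := detpos_det1 d1.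
have Sh := spherical_lift Hf.
rewrite /trace_dY /Qop; set P := [set L : operator _ _ | _].
have [[K [c [vs [Hvs EL]]]] HL] : P (xget (fun _ _ => 0) P).
  apply: xgetPex; exists (laplace m); split.
    pose e := laplace_expr m; pose p0 : R[i] * seq M := (0, [::]).
    exists (size e), (fun j => (nth p0 e j).1), (fun j => (nth p0 e j).2); split.
      move=> j v vj; apply: (laplace_expr_ssym (m := m) (p := nth p0 e j)) => //.
      exact: mem_nth.
    by move=> h Y; rewrite laplaceE (big_nth p0) big_mkord.
  move=> A Y HA _; rewrite laplaceE -(laplace_expr_symbol m HA) mulr_suml.
  by apply: eq_bigr => p _; rewrite iderive_expfun mulrA.
move: (xget _ P) EL HL => L EL HL.
pose e := [seq (c j, vs j) | j <- index_enum 'I_K].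
have s0 : ssym (0 : M) by split; [exact: trmx0 | exact: mxtrace0].
rewrite EL laplaceE.
transitivity (\sum_(p <- e) p.1 * iderive p.2 (chart (lift_fun f) x) 0).
  rewrite big_map; apply: eq_bigr => j _; congr (_ * _).
  (* Off [ssym] the matrix [x *m mexp Z] may leave SL_n, where [SPos_coset] falls back to the
     trivial coset; the two functions are compared only on [ssym]. *)
  apply: iderive_restrict s0; last exact: Hvs.
  move=> Z HZ; rewrite /chart lift_funE //.
  by rewrite det_mulmx d1 det_mexp_ssym // mulr1.
apply: (iderive_symbol_eq oE (csmooth_chart Sh.1 Dx) (@expdet0 R n)).
  move=> p v; rewrite mem_cat => /orP[/mapP[j _ ->]|]; first exact: Hvs.
  exact: laplace_expr_ssym.
move=> A HA; rewrite laplace_expr_symbol //.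
have := HL A 0 HA s0; rewrite EL.
have -> : expfun A 0 = 1 by rewrite /expfun mul0mx mxtrace0 expR0.
rewrite mulr1 => <-; rewrite big_map; apply: eq_bigr => j _.
by rewrite iderive_expfun /expfun mul0mx mxtrace0 expR0 mulr1.
Qed.

(** The chosen representatives differ from [x] by an orthogonal [k], whose effect is to conjugate
    all directions. After projection to [ssym] the polynomial is still [\tr (A ^+ m)], by
    conjugation invariance of the trace. *)
Lemma radial_laplace m f x : smooth f -> \det x = 1 ->
  radial_part (maass_selberg m) f (SPos_coset x) = laplace m (chart (lift_fun f) x) 0.
Proof.
move=> Hf d1; have Dx := detpos_det1 d1; have ux := detpos_unit Dx.
have Sh := spherical_lift Hf.
rewrite -[LHS]/(opmx_trace (opmx_pow (@dX R N) m) (fun X =>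
  f (Defs.proj (Pos_coset (val (repr (Defs.incl (SPos_coset x))) *m mexp X)))) 0).
have [dy zy] := SPos_cosetP (SPos_coset x).
rewrite /Defs.incl; move: (val (repr (SPos_coset x))) dy zy => y dy zy.
have uy : y \in unitmx by apply: detpos_unit; exact: detpos_det1.
have xy : x *m x^T = y *m y^T by exact/(SPos_coset_eq d1 dy).
have ur := valP (repr (Pos_coset y)).
have Er : Pos_coset (val (repr (Pos_coset y))) = Pos_coset y by rewrite /Pos_coset valKd reprK.
move: (val (repr (Pos_coset y))) ur Er => r ur Er.
have xr : x *m x^T = r *m r^T by rewrite xy; exact/esym/(Pos_coset_eq ur uy).
have [k kk rk] : exists2 k, k^T *m k = 1%:M & r = x *m k.
  exists (invmx x *m r); last by rewrite mulKVmx.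
  exact/eqP/(orthmx_quotient ux ur).
have d2 : \det k * \det k = 1 by have := congr1 determinant kk; rewrite det_mulmx det_tr det1.
(* The representative [x *m k] may have determinant -1. The factor [k^T] restores a positive
   determinant and leaves the product with the transpose unchanged. *)
pose phi X := x *m k *m mexp X *m k^T.
have Dphi X : expdet X -> detpos (phi X).
  move=> EX; rewrite /detpos /= /phi !det_mulmx det_tr d1 mul1r (mulrAC (\det k)) d2 mul1r; exact: EX.
have E X : expdet X -> f (Defs.proj (Pos_coset (r *m mexp X))) = lift_fun f (phi X).
  move=> EX; rewrite (@proj_coset _ _ (r *m mexp X) (phi X)) //.
  - by rewrite unitmx_mul ur /= detpos_unit.
  - exact: Dphi.
  - rewrite /phi rk [X in _ = _ *m X]trmx_mul trmxK !mulmxA.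
    by rewrite -(mulmxA (x *m k *m mexp X)) kk mulmx1.
have Hphi : csmooth expdet (fun X => lift_fun f (phi X)).
  apply: (csmooth_comp (U' := detpos) (phi := phi) oE Dphi _ Sh.1) => q i j.
  have H1 : forall a b, Ck q expdet (fun X => (x *m k *m mexp X) a b).
    by move=> a b; apply: (Ck_sub (U := setT)) => //; exact: Ck_chart_map.
  exact: (Ck_mulmx oE H1 (fun a b => Ck_cst q expdet (k^T a b))).
have HG : csmooth expdet (fun X => f (Defs.proj (Pos_coset (r *m mexp X)))).
  by apply: (csmooth_ext oE _ Hphi) => X EX; rewrite E.
apply: etrans (opmx_trace_words m oE HG (@expdet0 R n)) _.
pose cv v := k *m v *m k^T.
transitivity (\sum_(p <- [seq (1 : R[i], map (@sympart R n) (map cv s)) | s <- trace_words R n m])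
    p.1 * iderive p.2 (chart (lift_fun f) x) 0).
  rewrite big_map; apply: eq_big_seq => s sm; rewrite mul1r.
  rewrite (iderive_ext s oE (@expdet0 R n) E) /phi (iderive_chart_conj _ _ _ kk).
  apply: iderive_chart_sympart => // v /mapP[u us ->].
  by rewrite /cv !trmx_mul trmxK (trace_words_sym sm us) mulmxA.
rewrite laplaceE; apply: (iderive_symbol_eq oE (csmooth_chart Sh.1 Dx) (@expdet0 R n)).
  move=> p v; rewrite mem_cat => /orP[/mapP[s _ ->] /= /mapP[u _ ->]|].
    exact: ssym_sympart.
  exact: laplace_expr_ssym.
move=> A HA; rewrite laplace_expr_symbol // -(trace_conj_pow A m kk) big_map.
have [As _] := ssym_conj kk HA.
rewrite -(trace_words_symbol m As); apply: eq_bigr => s _.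
rewrite mul1r !big_map; apply: eq_bigr => v _; congr (_%:C).
by rewrite trace_sympart // /cv -!mulmxA mxtrace_mulC !mulmxA.
Qed.

Lemma chart_expr r e0 : (forall p, p \in e0 -> (size p.2 <= r)%N) ->
  exists e, [/\ forall p, p \in e -> (size p.2 <= r)%N,
    forall A, symb r e A = symb r e0 A &
    forall h x, csmooth detpos h -> detpos x ->
      \sum_(p <- e0) p.1 * iderive p.2 (chart h x) 0 = opsum e h x].
Proof.
elim: e0 => [|[a vs] e0 IH] He0.
  by exists [::]; split=> // h x _ _; rewrite /opsum !big_nil.
have [p pe|e [He Hs E]] := IH; first by apply: He0; rewrite inE pe orbT.
have vr : (size vs <= r)%N by apply: (He0 (a, vs)); rewrite mem_head.
have [J [c [w [H1 H2 H3 H4]]]] := chart_to_words vs.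
exists ([seq (a * (c j 0)%:C, w j) | j <- index_enum J] ++ e); split.
- move=> p; rewrite mem_cat => /orP[/mapP[j _ ->] /=|]; last exact: He.
  exact: leq_trans (H1 j) vr.
- move=> A; rewrite /symb big_cat big_cons -/(symb r e A) Hs -/(symb r e0 A) /=.
  have [sr|sr] := eqVneq (size vs) r.
    congr (_ + _); rewrite -(H4 A) sr /symb !big_map mulr_sumr.
    by apply: eq_bigr => j _; rewrite mulrA.
  rewrite big_map big1 ?add0r // => j /eqP E1.
  by have := H1 j; rewrite E1 leqNgt ltn_neqAle sr vr.
- move=> h x Hh Dx; rewrite big_cons /opsum big_cat /= -/(opsum e h x) -E //.
  congr (_ + _); rewrite (H3 h x 0 Hh Dx (@expdet0 R n)) mexp0 mulmx1 big_map mulr_sumr.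
  by apply: eq_bigr => j _; rewrite mulrA.
Qed.

Lemma maass_selberg_opsum m : exists e, [/\ forall p, p \in e -> (size p.2 <= m)%N,
  forall A, ssym A -> symb m e A = (\tr (A ^+ m))%:C &
  forall f x, smooth f -> \det x = 1 ->
    radial_part (maass_selberg m) f (SPos_coset x) = opsum e (lift_fun f) x].
Proof.
have size_expr p : p \in laplace_expr m -> size p.2 = m.
  by move=> /mapP[s sm ->]; rewrite /= size_map (size_trace_words sm).
have [p pm|e [He Hs E]] := @chart_expr m (laplace_expr m); first by rewrite size_expr.
exists e; split=> //.
  move=> A HA; rewrite Hs -(laplace_expr_symbol m HA) /symb [LHS]big_mkcond.
  by apply: eq_big_seq => p pm; rewrite size_expr // eqxx.
move=> f x Hf d1; rewrite radial_laplace // laplaceE.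
by apply: E; [have [] := spherical_lift Hf | exact: detpos_det1].
Qed.

End RadialParts.

(** * Invariant operators as polynomials *)

Section Represented.
Variables (R : realType) (n : nat).
Local Notation M := 'M[R]_n.+1.
Local Notation N := n.+1.
Local Notation Op := (operator R (SPos R n.+1)).
Implicit Types (f : SPos R n.+1 -> R[i]) (x y k g A X Y v : M) (h H : M -> R[i]).
Implicit Types (e : seq (R[i] * seq M)) (D : Op) (r : nat).
Local Notation oO := (@open_detpos R n.+1).

Lemma opsum_ext e h h' x : (forall y, detpos y -> h y = h' y) -> detpos x ->
  opsum e h x = opsum e h' x.
Proof. by move=> E Dx; apply: eq_bigr => p _; rewrite (wder_ext p.2 E Dx). Qed.

Lemma csmooth_opsum e h : csmooth detpos h -> csmooth detpos (opsum e h).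
Proof.
move=> Hh; apply: (csmooth_sum _ oO) => p; apply: (csmoothM oO); first exact: csmooth_cst.
exact: csmooth_wder.
Qed.

Lemma opsum_cat e e' h x : opsum (e ++ e') h x = opsum e h x + opsum e' h x.
Proof. exact: big_cat. Qed.

Lemma symb_cat r e e' A : symb r (e ++ e') A = symb r e A + symb r e' A.
Proof. exact: big_cat. Qed.

Definition scale_expr (c : R[i]) e : seq (R[i] * seq M) := [seq (c * p.1, p.2) | p <- e].

Lemma opsum_scale c e h x : opsum (scale_expr c e) h x = c * opsum e h x.
Proof. by rewrite /opsum big_map mulr_sumr; apply: eq_bigr => p _; rewrite mulrA. Qed.

Lemma symb_scale r c e A : symb r (scale_expr c e) A = c * symb r e A.
Proof. by rewrite /symb big_map mulr_sumr; apply: eq_bigr => p _; rewrite mulrA. Qed.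

Lemma size_scale_expr c e r : (forall p, p \in e -> (size p.2 <= r)%N) ->
  forall p, p \in scale_expr c e -> (size p.2 <= r)%N.
Proof. by move=> He p /mapP[q qe ->]; exact: (He q). Qed.

Definition comp_expr e e' : seq (R[i] * seq M) :=
  [seq (p.1 * q.1, p.2 ++ q.2) | p <- e, q <- e'].

Lemma opsum_comp e e' h x : csmooth detpos h -> detpos x ->
  opsum (comp_expr e e') h x = opsum e (opsum e' h) x.
Proof.
move=> Hh Dx; rewrite /opsum big_allpairs_dep; apply: eq_bigr => p _.
rewrite (wder_sum p.2 e' (fun q => q.1)) //; last by move=> q; exact: csmooth_wder.
rewrite mulr_sumr; apply: eq_bigr => q _; by rewrite wder_cat mulrA.
Qed.

Lemma symb_comp r r' e e' A : (forall p, p \in e -> (size p.2 <= r)%N) ->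
  (forall p, p \in e' -> (size p.2 <= r')%N) ->
  symb (r + r') (comp_expr e e') A = symb r e A * symb r' e' A.
Proof.
move=> He He'; rewrite /symb [LHS]big_mkcond big_allpairs_dep.
rewrite [X in _ = X * _]big_mkcond [X in _ = _ * X]big_mkcond big_distrlr /=.
apply: eq_big_seq => p /He sp; apply: eq_big_seq => q /He' sq.
have -> : (size (p.2 ++ q.2) == r + r')%N = (size p.2 == r) && (size q.2 == r').
  rewrite size_cat; move: sp sq; set a := size p.2; set b := size q.2 => sp sq.
  by apply/eqP/andP => [E|[/eqP -> /eqP ->] //]; split; apply/eqP; lia.
case: eqP => _ /=; last by rewrite mul0r.
case: eqP => _ /=; last by rewrite mulr0.
by rewrite big_cat /=; move: (\prod_(_ <- _) _) (\prod_(_ <- _) _) => a b; ring.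
Qed.

Definition represents D e : Prop := forall f x, smooth f -> \det x = 1 ->
  D f (SPos_coset x) = opsum e (lift_fun f) x.

(** [S] is prescribed only on [ssym], and [r] only bounds the order: an operator of smaller order is
    represented with [S] zero ([represented_lt]). *)
Definition represented r D (S : M -> R[i]) : Prop := exists e,
  [/\ forall p, p \in e -> (size p.2 <= r)%N, forall A, ssym A -> symb r e A = S A &
      represents D e].

Lemma represents_lift D e f x : represents D e -> smooth f -> detpos x ->
  lift_fun (D f) x = opsum e (lift_fun f) x.
Proof.
move=> DE Hf Dx; rewrite /lift_fun DE ?det_normalize //.
exact: opsum_normalize (spherical_lift Hf) Dx.
Qed.

Lemma represents_smooth D e f : represents D e -> smooth f -> smooth (D f).
Proof.
move=> DE Hf; apply: (smooth_intro (csmooth_opsum e (spherical_lift Hf).1)).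
by move=> x d1; exact: DE.
Qed.

Lemma represents_comp D D' e e' : represents D e -> represents D' e' ->
  represents (D \o D') (comp_expr e e').
Proof.
move=> DE DE' f x Hf d1; have Dx := detpos_det1 d1.
rewrite (opsum_comp _ _ (spherical_lift Hf).1 Dx) /= DE //; last exact: represents_smooth DE' Hf.
by apply: opsum_ext Dx => y Dy; exact: represents_lift.
Qed.

(** For an arbitrary expression, [opsum e h] need not descend to cosets, even for spherical [h];
    representing an operator on [SPos] forces it to. *)
Lemma represents_spherical D e h x y : represents D e -> spherical h ->
  \det x = 1 -> \det y = 1 -> x *m x^T = y *m y^T -> opsum e h x = opsum e h y.
Proof.
move=> DE Sh dx dy xy; have [f Hf E] := spherical_lift_exists Sh.
rewrite -!(opsum_ext e E); try exact: detpos_det1.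
by rewrite -!DE //; congr (D f _); apply/(SPos_coset_eq dx dy).
Qed.

Lemma represented_id : represented 0 id (fun=> 1).
Proof.
exists [:: (1, [::])]; split.
- by move=> p; rewrite inE => /eqP ->.
- by move=> A _; rewrite /symb big_cons big_nil /= big_nil mulr1 addr0.
- by move=> f x Hf d1; rewrite /opsum big_seq1 mul1r /= lift_funE.
Qed.

Lemma represented_comp r r' D D' S S' : represented r D S -> represented r' D' S' ->
  represented (r + r') (D \o D') (fun A => S A * S' A).
Proof.
move=> [e [He Hs DE]] [e' [He' Hs' DE']]; exists (comp_expr e e'); split.
- move=> p /allpairsP[[q q'] /= [qe qe' ->]] /=; rewrite size_cat leq_add ?He ?He' //.
- by move=> A HA; rewrite symb_comp // Hs // Hs'.
- exact: represents_comp.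
Qed.

Lemma represented_iter r D S m : represented r D S ->
  represented (r * m) (iter m D) (fun A => S A ^+ m).
Proof.
move=> HD; elim: m => [|m IH].
  by rewrite muln0; exact: represented_id.
have [e [He Hs DE]] := represented_comp HD IH.
exists e; split.
- by rewrite mulnS.
- by move=> A HA; rewrite mulnS Hs // exprS.
- exact: DE.
Qed.

Lemma represented0 r : represented r (fun _ _ => 0) (fun=> 0).
Proof. by exists [::]; split=> // [A _|f x _ _]; rewrite /symb /opsum big_nil. Qed.

Lemma represented_add r D D' S S' c : represented r D S -> represented r D' S' ->
  represented r (fun f z => c * D f z + D' f z) (fun A => c * S A + S' A).
Proof.
move=> [e [He Hs DE]] [e' [He' Hs' DE']]; exists (scale_expr c e ++ e'); split.
- by move=> p; rewrite mem_cat => /orP[|/He'] //; exact: size_scale_expr.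
- by move=> A HA; rewrite symb_cat symb_scale Hs // Hs'.
- by move=> f x Hf d1; rewrite opsum_cat opsum_scale DE // DE'.
Qed.

Lemma represented_lt r r' D S : (r < r')%N -> represented r D S -> represented r' D (fun=> 0).
Proof.
move=> rr [e [He _ DE]]; exists e; split=> //.
  by move=> p /He pr; apply: leq_trans pr (ltnW rr).
move=> A _; rewrite /symb big_seq_cond big1 // => p /andP[/He pr /eqP pr'].
by move: pr; rewrite pr' leqNgt rr.
Qed.

Lemma smooth_linear (a : R[i]) f1 f2 : smooth f1 -> smooth f2 ->
  smooth (fun z => a * f1 z + f2 z).
Proof.
move=> H1 H2; have S1 := (spherical_lift H1).1; have S2 := (spherical_lift H2).1.
apply: (smooth_intro (csmoothD oO (csmoothM oO (csmooth_cst _ a) S1) S2)).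
by move=> x d1; rewrite !lift_funE.
Qed.

Lemma opsum_linear e (a : R[i]) h h' x : csmooth detpos h -> csmooth detpos h' -> detpos x ->
  opsum e (fun y => a * h y + h' y) x = a * opsum e h x + opsum e h' x.
Proof.
move=> Hh Hh' Dx; rewrite /opsum mulr_sumr -big_split; apply: eq_bigr => p _ /=.
pose F (b : bool) := if b then h else h'; pose c (b : bool) := if b then a else 1.
have E y : detpos y -> a * h y + h' y = \sum_(b : bool) c b * F b y.
  by move=> _; rewrite big_bool /= mul1r.
rewrite (wder_ext p.2 E Dx) (wder_sum p.2 _ c (F := F)) //; last by case.
by rewrite big_bool /= mul1r mulrDr mulrCA.
Qed.

Lemma represents_invariant D e : represents D e -> invariant_diff_operator D.
Proof.
move=> DE; split; first split.
- by move=> f; exact: (represents_smooth DE).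
- move=> a f1 f2 H1 H2; apply: SPos_fun_eq => x d1.
  rewrite !DE //; last exact: smooth_linear.
  exact: (opsum_linear _ _ (spherical_lift H1).1 (spherical_lift H2).1 (detpos_det1 d1)).
(* The coefficients do not depend on [g]: the chart at [g] is a translate of the chart at the
   identity, and words are left-invariant. *)
- move=> g; have [J [a [vs [H1 H2 H3]]]] := chartable_opsum e.
  have dg : \det (val g) = 1 by exact/eqP/(valP g).
  exists (@chartdom R n), #|J|, (fun j => vs (enum_val j)), (fun j => a (enum_val j)); split.
  + exact: open_chartdom.
  + exact: chartdom0.
  + by move=> j; exact: H1.
  + move=> j; have [Hr Hi] := H2 (enum_val j); split=> x [Ux _].
      by exists (@chartdom R n), (fun x => complex.Re (a (enum_val j) x)); split=> //;
        exact: open_chartdom.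
    by exists (@chartdom R n), (fun x => complex.Im (a (enum_val j) x)); split=> //;
      exact: open_chartdom.
  + move=> f Y Hf [CY HY]; have Sh := spherical_lift Hf.
    have dY Z : ssym Z -> \det (val g *m mexp Z) = 1.
      by move=> HZ; rewrite det_mulmx dg det_mexp_ssym // mulr1.
    rewrite /in_chart DE ?dY // (H3 _ _ _ Sh (detpos_det1 dg) CY).
    transitivity (\sum_(j < #|J|) a (enum_val j) Y *
        iderive (vs (enum_val j)) (chart (lift_fun f) (val g)) Y).
      by rewrite (reindex (@enum_val J predT)) //; apply: onW_bij; exact: enum_val_bij.
    apply: eq_bigr => j _; congr (_ * _).
    apply: iderive_restrict HY; last exact: H1.
    by move=> Z HZ; rewrite /chart lift_funE ?dY.
- move=> g f Hf; apply: SPos_fun_eq => x d1.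
  have dg : \det (val g) = 1 by exact/eqP/(valP g).
  rewrite DE //; last exact: smooth_translation.
  rewrite /= translation_coset // DE ?det_mulmx ?dg ?d1 ?mul1r //.
  rewrite (opsum_ext _ (fun y Dy => lift_translation f g Dy) (detpos_det1 d1)).
  apply: eq_bigr => p _; congr (_ * _).
  exact: (wder_left p.2 (spherical_lift Hf).1 (detpos_det1 dg) (detpos_det1 d1)).
Qed.

(** Only the centre of the chart at the identity is used; left invariance carries the expression
    found there to all points. *)
Lemma invariant_represents D : invariant_diff_operator D -> exists e, represents D e.
Proof.
move=> [[Dsm _ Dloc] Dinv].
have [U [K [vs [a [oU U0 Hvs Ha E]]]]] := Dloc (@SL1 R N).
pose e0 := [seq (a j 0, vs j) | j <- index_enum 'I_K].
pose r := \max_(p <- e0) size p.2.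
have [p pe|e [He _ EE]] := @chart_expr R n r e0.
  exact: (@leq_bigmax_seq _ e0 xpredT (fun p => size p.2) p pe isT).
have s0 : ssym (0 : M) by split; [exact: trmx0 | exact: mxtrace0].
have D1 f : smooth f -> D f (SPos_coset 1%:M) = opsum e (lift_fun f) 1%:M.
  move=> Hf; have Sh := spherical_lift Hf.
  have := E f 0 Hf (conj U0 s0).
  rewrite {1}/in_chart mexp0 mulmx1 /= => ->.
  rewrite -EE ?big_map; [|exact: Sh.1|exact: detpos1].
  apply: eq_bigr => j _; congr (_ * _); apply: iderive_restrict s0; last exact: Hvs.
  move=> Z HZ; rewrite /in_chart /chart lift_funE //.
  by rewrite det_mulmx det1 mul1r det_mexp_ssym.
exists e => f x Hf d1.
have vx : val (insubd (@SL1 R N) x) = x by rewrite insubdK //; apply/eqP.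
pose g := insubd (@SL1 R N) x.
have -> : SPos_coset x = translation g (SPos_coset 1%:M).
  by rewrite translation_coset ?det1 // vx mulmx1.
rewrite -[D f _]/((D f \o translation g) (SPos_coset 1%:M)) -Dinv //.
rewrite D1; last exact: smooth_translation.
have D1' := @detpos1 R n.
rewrite (opsum_ext _ (fun y Dy => lift_translation f g Dy) D1') vx.
apply: eq_bigr => p _; congr (_ * _).
by rewrite (wder_left p.2 (spherical_lift Hf).1 (detpos_det1 d1) D1') mulmx1.
Qed.

End Represented.

(** * Generation and algebraic independence *)

Section Polynomials.
Variables (R : realType) (n : nat).
Local Notation M := 'M[R]_n.+1.
Local Notation N := n.+1.
Local Notation C := R[i].
Local Notation Op := (operator R (SPos R n.+1)).
Implicit Types (f : SPos R n.+1 -> R[i]) (x y A : M) (h : M -> R[i]).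
Implicit Types (e : seq (R[i] * seq M)) (D : Op) (r : nat) (p : mpoly n R[i]).

Definition radial_maass (i : 'I_n) : Op := radial_part (@maass_selberg R n.+1 i.+2).
Local Notation T := radial_maass.

Definition monomial_operator (mu : multinom n) : Op :=
  \big[(fun A B : Op => A \o B)/id]_(i < n) iter (tnth (multinom_val mu) i) (T i).

Lemma represented_radial (i : 'I_n) : represented i.+2 (T i) (fun A => (\tr (A ^+ i.+2))%:C).
Proof. by have [e [H1 H2 H3]] := @maass_selberg_opsum R n i.+2; exists e. Qed.

Lemma represented_monomial mu : represented (weight mu) (monomial_operator mu)
  (fun A => \prod_(i < n) (\tr (A ^+ i.+2))%:C ^+ mu i).
Proof.
rewrite /weight /monomial_operator; elim: (index_enum _) => [|i s [e [IH1 IH2 IH3]]].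
  have [e [H1 H2 H3]] := represented_id R n; exists e; split.
  - by rewrite big_nil.
  - by move=> A HA; rewrite !big_nil; exact: H2.
  - by rewrite big_nil.
have HD := represented_iter (mu i) (represented_radial i).
have [e' [H1 H2 H3]] := represented_comp HD (ex_intro _ e (And3 IH1 IH2 IH3)).
exists e'; split.
- by rewrite big_cons.
- by move=> A HA; rewrite !big_cons; exact: H2.
- by rewrite big_cons.
Qed.

Lemma represented_poly p r : (forall mu, mu \in msupp p -> (weight mu <= r)%N) ->
  represented r (poly_operator T p) (fun A => \sum_(mu <- msupp p | weight mu == r)
     mcoeff mu p * \prod_(i < n) (\tr (A ^+ i.+2))%:C ^+ mu i).
Proof.
move=> Hw; have -> : poly_operator T p =
  (fun f z => \sum_(mu <- msupp p) mcoeff mu p * monomial_operator mu f z) by [].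
elim: (msupp p) Hw => [|mu s IH] Hw.
  have [e [H1 H2 H3]] := represented0 R n r; exists e; split=> //.
  - by move=> A HA; rewrite big_nil; exact: H2.
  - by move=> f x Hf d1; rewrite big_nil; exact: H3.
have {}IH := IH (fun nu ns => Hw nu (mem_behead (s := mu :: s) ns)).
have wmu : (weight mu <= r)%N by apply: Hw; rewrite mem_head.
pose S A := if weight mu == r then \prod_(i < n) (\tr (A ^+ i.+2))%:C ^+ mu i else 0 : C.
have HS : represented r (monomial_operator mu) S.
  have HD := represented_monomial mu; rewrite /S; case: eqP => [<- //|/eqP ne].
  by apply: represented_lt HD; rewrite ltn_neqAle ne.
have [e [H1 H2 H3]] := represented_add (mcoeff mu p) HS IH; exists e; split=> //.
- move=> A HA; rewrite H2 // big_cons /S; case: ifP => _ //.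
  by rewrite mulr0 add0r.
- by move=> f x Hf d1; rewrite big_cons; exact: H3.
Qed.

Lemma big_msupp p (s : seq (multinom n)) (F : multinom n -> C) : uniq s ->
  {subset msupp p <= s} ->
  \sum_(mu <- msupp p) mcoeff mu p * F mu = \sum_(mu <- s) mcoeff mu p * F mu.
Proof.
move=> us ps; rewrite [RHS](bigID (mem (msupp p))) /= [X in _ + X]big1 ?addr0; last first.
  by move=> mu mup; rewrite memN_msupp_eq0 ?mul0r.
rewrite -[RHS]big_filter; apply: perm_big; apply: uniq_perm.
- exact: msupp_uniq.
- exact: filter_uniq.
- by move=> mu; rewrite mem_filter; apply/idP/andP => [H|[]//]; split=> //; exact: ps.
Qed.

Lemma poly_operator_add p q f z :
  poly_operator T (p + q) f z = poly_operator T p f z + poly_operator T q f z.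
Proof.
pose s := undup (msupp (p + q) ++ msupp p ++ msupp q).
have us : uniq s by exact: undup_uniq.
have E p' : {subset msupp p' <= s} -> poly_operator T p' f z =
    \sum_(mu <- s) mcoeff mu p' * monomial_operator mu f z.
  by move=> ps; exact: (big_msupp (fun mu => monomial_operator mu f z) us ps).
rewrite !E; try by move=> mu H; rewrite mem_undup !mem_cat H ?orbT.
rewrite -big_split; apply: eq_bigr => mu _.
by rewrite mcoeffD mulrDl.
Qed.

Lemma trace_diag_pow (x : 'I_n.+1 -> R) k :
  \tr ((diag_mx (\row_i x i) : M) ^+ k) = \sum_i x i ^+ k.
Proof.
have -> : (diag_mx (\row_i x i) : M) ^+ k = diag_mx (\row_i x i ^+ k).
  elim: k => [|k IH]; first by apply/matrixP => i j; rewrite expr0 !mxE expr0.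
  rewrite exprS IH -[_ * _]/(_ *m _) mulmx_diag; congr diag_mx.
  by apply/matrixP => i j; rewrite !mxE exprS.
by rewrite mxtrace_diag; apply: eq_bigr => i _; rewrite mxE.
Qed.

Lemma symb_diag r e : exists q : mpoly n.+1 C, forall x : 'I_n.+1 -> R,
  symb r e (diag_mx (\row_i x i)) = meval (fun i => (x i)%:C) q.
Proof.
exists (\sum_(p <- e | size p.2 == r) mpolyC n.+1 p.1 *
  \prod_(v <- p.2) \sum_i mpolyC n.+1 (v i i)%:C * mpolyX C (mnm1 i)).
move=> x; rewrite rmorph_sum; apply: eq_bigr => p _.
rewrite /= mevalM mevalC rmorph_prod; congr (_ * _); apply: eq_bigr => v _.
rewrite /= rmorph_sum /mxtrace rmorph_sum; apply: eq_bigr => i _ /=.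
by rewrite mevalM mevalC mevalXU mul_mx_diag !mxE rmorphM.
Qed.

Lemma symb_homogeneous r e (t : R) A : symb r e (t *: A) = (t ^+ r)%:C * symb r e A.
Proof.
rewrite /symb mulr_sumr; apply: eq_bigr => p /eqP <-; rewrite mulrCA; congr (_ * _).
elim: p.2 => [|v s IH]; first by rewrite !big_nil expr0 mulr1.
rewrite !big_cons IH -scalemxAr mxtraceZ exprS !rmorphM /=.
by move: (\prod_(_ <- _) _) => z; ring.
Qed.

(** Induction on the order. Invariance is asked only at points of SO_n, which is all that
    [symb_invariant] uses and what passes to the remainder. *)
Lemma generate r e : (forall p : R[i] * seq M, p \in e -> (size p.2 < r)%N) ->
  (forall h k, spherical h -> k^T *m k = 1%:M -> \det k = 1 ->
     opsum e h k = opsum e h 1%:M) ->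
  exists p : mpoly n R[i], forall f x, smooth f -> \det x = 1 ->
    opsum e (lift_fun f) x = poly_operator T p f (SPos_coset x).
Proof.
elim: r e => [|r IH] e He Hinv.
  have -> : e = [::] by case: e He {Hinv} => // p e /(_ p (mem_head _ _)).
  by exists 0 => f x _ _; rewrite /opsum /poly_operator msupp0 !big_nil.
have He' (p : R[i] * seq M) : p \in e -> (size p.2 <= r)%N by move=> /He.
have [q Hq] := symb_diag r e.
have [P [HP EP]] := invariant_polynomial (fun (x : 'I_n.+1 -> R) _ => Hq x) (symb_invariant He' Hinv)
  (fun t A _ => symb_homogeneous r e t A).
have HwP mu : mu \in msupp P -> (weight mu <= r)%N by move=> /HP ->.
have [eP [HeP HsP DP]] := represented_poly HwP.
(* The symbol of order [r] cancels in [e2], so on spherical functions [e2] equals an expression [e3]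
   with words of length less than [r]. *)
pose e2 := e ++ scale_expr (-1) eP.
have [||e3 [He3 E3]] := @low_symbol0 R n r e2.
- by move=> p; rewrite mem_cat => /orP[/He'//|]; exact: size_scale_expr.
- move=> A HA; rewrite symb_cat symb_scale HsP // EP // mevalE mulN1r.
  apply/eqP; rewrite subr_eq0; apply/eqP; rewrite [RHS]big_seq_cond big_seq.
  by apply: eq_bigl => mu; case muP: (mu \in msupp P) => //=; rewrite (HP mu muP) eqxx.
have E2 h x : opsum e2 h x = opsum e h x - opsum eP h x.
  by rewrite opsum_cat opsum_scale mulN1r.
have D1 := @detpos1 R n.
have [|p3 Hp3] := IH e3 He3.
  (* [e3] agrees with [e2] on spherical functions only; this is enough to inherit the invariance of
     [e] and of [eP]. *)
  move=> h k Sh kk k1; have Dk := detpos_det1 k1.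
  rewrite -!E3 // !E2 Hinv //; congr (_ - _).
  apply: (represents_spherical DP) => //; first exact: det1.
  by rewrite trmx1 mulmx1 (mulmx1C kk).
exists (P + p3) => f x Hf d1.
rewrite poly_operator_add -Hp3 // -E3; last exact: detpos_det1; last exact: spherical_lift.
by rewrite E2 DP // addrC subrK.
Qed.

Lemma radial_maass_generates D : invariant_diff_operator D ->
  exists p, forall f, smooth f -> D f = poly_operator T p f.
Proof.
move=> /invariant_represents[e DE].
pose r := \max_(t <- e) size t.2.
have [t te|h k Sh kk k1|p Hp] := @generate r.+1 e.
- by rewrite ltnS; exact: (@leq_bigmax_seq _ e xpredT (fun t => size t.2) t te isT).
- apply: (represents_spherical DE) => //; first exact: det1.
  by rewrite trmx1 mulmx1 (mulmx1C kk).
by exists p => f Hf; apply: SPos_fun_eq => x d1; rewrite DE // Hp.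
Qed.

(* The part of top weight of a relation is a relation between power sums. *)
Lemma poly_operator_top p r : (forall f, smooth f -> poly_operator T p f = (fun=> 0)) ->
  (forall mu, mu \in msupp p -> (weight mu <= r)%N) ->
  forall mu, mu \in msupp p -> weight mu != r.
Proof.
move=> H0 Hw; have [e [He Hs DE]] := represented_poly Hw.
have Z A : ssym A -> symb r e A = 0.
  apply: symb_eq0 => // h Sh; have [f Hf E] := spherical_lift_exists Sh.
  rewrite -(opsum_ext e E (@detpos1 R n)) -DE //; last exact: det1.
  by rewrite H0.
pose q : mpoly n C := \sum_(mu <- msupp p | weight mu == r) mcoeff mu p *: mpolyX C mu.
have q0 : q = 0.
  apply: centered_psum_independent => x x0.
  have HA := ssym_diag x0.
  rewrite -[RHS](Z _ HA) Hs // /q raddf_sum; apply: eq_bigr => mu _.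
  rewrite /= mevalZ mevalX; congr (_ * _); apply: eq_bigr => i _.
  by rewrite trace_diag_pow.
move=> mu mup; apply/negP => /eqP wmu.
have : mcoeff mu q = 0 by rewrite q0 mcoeff0.
rewrite /q (raddf_sum (mcoeff mu)) big_mkcond (bigD1_seq mu) ?msupp_uniq //= wmu eqxx.
rewrite mcoeffZ mcoeffX eqxx mulr1 big1 ?addr0.
  by move/eqP; rewrite -[_ == 0]negbK -mcoeff_msupp mup.
move=> nu nm; case: ifP => // _.
by rewrite mcoeffZ mcoeffX (negbTE nm) mulr0.
Qed.

Lemma radial_maass_independent : algebraically_independent T.
Proof.
move=> p H0.
have K r : (forall mu, mu \in msupp p -> (weight mu < r)%N) -> p = 0.
  elim: r => [|r IH] Hw.
    by apply/eqP; rewrite -msupp_eq0; case: (msupp p) Hw => // mu s /(_ mu (mem_head _ _)).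
  apply: IH => mu mup; rewrite ltn_neqAle (poly_operator_top H0 _ mup) /=.
    exact: Hw.
  by move=> nu /Hw.
pose r := \max_(mu <- msupp p) weight mu.
apply: (K r.+1) => mu mup; rewrite ltnS.
exact: (@leq_bigmax_seq _ (msupp p) xpredT (fun mu => weight mu) mu mup isT).
Qed.

End Polynomials.

(* The generators are indexed by i < n - 1, with k = i + 2 ranging over 2..n. *)
Theorem theorem4p3 (R : realType) (n : nat) (hn : (1 <= n)%N) :
  (forall k : nat, (2 <= k <= n)%N ->
     forall (f : SPos R n -> R[i]) (g : SL R n), smooth f ->
       radial_part (maass_selberg k) f (SPos_coset (val g)) =
       trace_dY k
         (fun Y => f (SPos_coset (val g *m mexp Y))) 0) /\
  (let P_delta := fun i : 'I_n.-1 =>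
     radial_part (@maass_selberg R n i.+2) in
   algebraically_independent P_delta /\
   generates_invariant_operators P_delta).
Proof.
(* With [n.+1] in place of [n] the index type becomes ['I_n]; SL_1, with no generators at all, needs
   no separate treatment. *)
case: n hn => // n _; split.
  move=> k _ f g Hf; have d1 : \det (val g) = 1 by exact/eqP/(valP g).
  by rewrite radial_laplace // trace_dY_laplace.
split; first exact: (@radial_maass_independent R n).
split; last exact: (@radial_maass_generates R n).
by move=> i; have [e [_ _ DE]] := @represented_radial R n i; exact: represents_invariant DE.
Qed.
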